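(* Let $1<\alpha<2$ and let $E,A\in\mathbb{R}^{n\times n}$ be such that the singular fractional order system $$ED^{\alpha}x(t)=Ax(t),\qquad x(t)\in\mathbb{R}^n,$$ is regular. Then the system is asymptotically stable if and only if $$\left|\arg\left(\mathrm{spec}(E,A)\right)\right|>\frac{\pi}{2}\alpha,$$ i.e. every $\lambda\in\mathrm{spec}(E,A)$ satisfies $|\arg\lambda|>\frac{\pi}{2}\alpha$.
   Context: $D^{\alpha}$ is the Caputo fractional derivative of order $\alpha$ with lower terminal $0$. A system is regular if it has a unique solution (a solution of $ED^\alpha x=Ax+g$ exists for every sufficiently differentiable $g$ and is determined by $g$ and the initial data). $\mathrm{spec}(E,A)$ is the set of all (finite) eigenvalues, $\{s\in\mathbb{C}: |s|<\infty,\ \det(sE-A)=0\}$. The argument is taken in $[-\pi,\pi]$ (principal value). An admissible initial condition is an $x(0)$ which does not result in discontinuous behaviour of the solution at $t=0$. The regular system is called asymptotically stable if $\lim_{t\to+\infty}\|x(t)\|=0$ for every admissible initial condition $x(0)$. *)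

(* Defs.v *)
From HB Require Import structures.
From mathcomp Require Import all_boot all_order all_algebra.
From mathcomp Require Import all_classical all_reals all_analysis.
From mathcomp Require Import complex.

Set Implicit Arguments.
Unset Strict Implicit.
Unset Printing Implicit Defensive.

Import Order.TTheory GRing.Theory Num.Theory.
Import numFieldNormedType.Exports.

Local Open Scope classical_set_scope.
Local Open Scope ring_scope.

Definition Gamma (R : realType) (z : R) : R :=
  \int[lebesgue_measure]_(t in `]0, +oo[) (t `^ (z - 1) * expR (- t)).

(* Functions are total on R, but only their values on [0, +oo[ matter.  This is
   C^1([0, +oo[) /\ C^2(]0, +oo[) with f'' integrable near 0: together with the
   continuity of f at 0, integrability of f'' makes f' extend continuously to 0.
   One cannot ask for f'' to be continuous at 0, since the solutions of
   fractional equations of order in ]1, 2[ behave like t `^ alpha there. *)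
Definition caputo_differentiable (R : realType) (f : R -> R) : Prop :=
  [/\ {within `[0, +oo[, continuous f},
      forall t, 0 < t ->
        [/\ derivable f t 1, derivable f^`()%classic t 1
          & {for t, continuous f^`(2)%classic}]
    & forall T, 0 < T ->
        lebesgue_measure.-integrable `]0, T[ (EFin \o f^`(2)%classic)].

(* For 1 < alpha < 2, so that the integer order used is ceil(alpha) = 2. *)
Definition caputo (R : realType) (alpha : R) (f : R -> R) (t : R) : R :=
  (Gamma (2 - alpha))^-1 *
  \int[lebesgue_measure]_(s in `]0, t[) ((t - s) `^ (1 - alpha) * f^`(2)%classic s).

Definition coordinate (R : realType) (n : nat) (x : R -> 'cV[R]_n) (i : 'I_n) :
  R -> R := fun t => x t i 0.

Definition caputo_vec (R : realType) (n : nat) (alpha : R) (x : R -> 'cV[R]_n)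
  (t : R) : 'cV[R]_n := \col_i caputo alpha (coordinate x i) t.

(* At t = 0 the Caputo integral is over an empty interval, hence the equation is
   only imposed for t > 0. *)
Definition is_solution (R : realType) (n : nat) (alpha : R) (E A : 'M[R]_n)
  (g x : R -> 'cV[R]_n) : Prop :=
  (forall i, caputo_differentiable (coordinate x i)) /\
  (forall t, 0 < t -> E *m caputo_vec alpha x t = A *m x t + g t).

(* As 1 < alpha < 2, the initial data consist of x(0) and x'(0). *)
Definition has_initial_data (R : realType) (n : nat) (x : R -> 'cV[R]_n)
  (x0 v0 : 'cV[R]_n) : Prop :=
  x 0 = x0 /\ forall i, (coordinate x i)^`()%classic @ 0^'+ --> v0 i 0.

(* f, D^alpha f, D^alpha (D^alpha f), ... exist up to the m-th one and extend
   continuously to [0, +oo[. *)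
Fixpoint iter_caputo_differentiable (R : realType) (alpha : R) (m : nat)
  (f : R -> R) : Prop :=
  if m is m'.+1 then
    caputo_differentiable f /\
    exists2 h, (forall t, 0 < t -> h t = caputo alpha f t)
      & iter_caputo_differentiable alpha m' h
  else {within `[0, +oo[, continuous f}.

(* "Sufficiently differentiable" is understood with respect to D^alpha: the
   nilpotent part of a regular pencil applies up to n - 1 iterates of D^alpha
   to g, and plain smoothness of g on [0, +oo[ does not make these exist (if
   g(t) = t ^+ 2, then D^alpha g is a multiple of t `^ (2 - alpha), which is
   not C^1 at 0). *)
Definition regular (R : realType) (n : nat) (alpha : R) (E A : 'M[R]_n) :
  Prop :=
  (exists m, forall g : R -> 'cV[R]_n,
     (forall i, iter_caputo_differentiable alpha m (coordinate g i)) ->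
     exists x, is_solution alpha E A g x) /\
  (forall (g x y : R -> 'cV[R]_n) (x0 v0 : 'cV[R]_n),
     is_solution alpha E A g x -> has_initial_data x x0 v0 ->
     is_solution alpha E A g y -> has_initial_data y x0 v0 ->
     forall t, 0 <= t -> x t = y t).

(* Solutions are continuous on [0, +oo[ by definition, so that x0 is admissible
   when it is the value at 0 of a solution without jump at t = 0. *)
Definition admissible (R : realType) (n : nat) (alpha : R) (E A : 'M[R]_n)
  (x0 : 'cV[R]_n) : Prop :=
  exists2 x, is_solution alpha E A (fun=> 0) x & x 0 = x0.

Definition asymptotically_stable (R : realType) (n : nat) (alpha : R)
  (E A : 'M[R]_n) : Prop :=
  forall x0, admissible alpha E A x0 ->
  forall x, is_solution alpha E A (fun=> 0) x -> x 0 = x0 ->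
  `|x t| @[t --> +oo] --> (0 : R).

Definition spec (R : realType) (n : nat) (E A : 'M[R]_n) : set R[i] :=
  [set s | \det (s *: map_mx (real_complex R) E - map_mx (real_complex R) A)
           = 0].

(* Principal argument, in ]-pi, pi].  The value at 0 is set to 0. *)
Definition arg (R : realType) (z : R[i]) : R :=
  if z == 0 then 0 else
  let theta := acos (complex.Re z / ComplexField.Normc.normc z) in
  if 0 <= complex.Im z then theta else - theta.

(* Main.v *)
(* If 0 is not an eigenvalue, A is invertible and a solution satisfies
   x = N D^alpha x with N = A^-1 E.  Write the characteristic polynomial of N as
   X^m q with q(0) <> 0; by Cayley-Hamilton and m applications of D^alpha,
   q(N) x = 0, hence D^alpha x = B x for a polynomial B in N.  Such an x grows at
   most exponentially, and its Laplace transform at p is a linear combination of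
   the functions H(p) = p^a p^(alpha j) / Q(p^alpha), where a is alpha - 1 or
   alpha - 2, j < deg Q, and Q is the reversal of q, the roots of which are
   eigenvalues of the pencil.  When these have |arg| > alpha pi / 2, H extends
   analytically to a sector |arg s| < v with v > pi / 2, and Cauchy's formula
   shows that H is the Laplace transform of an integral of H(s) exp (t s) over
   two rays of the left half plane, which tends to 0 at infinity.  Injectivity of
   the Laplace transform then gives x -> 0.

   Conversely, an eigenvalue lambda with eigenvector v gives the solutions
   Re (c v E_alpha (lambda t^alpha)).  If they all vanish at infinity, the Laplace
   transform U of E_alpha (lambda t^alpha) exists for Re s > 0, is o(1 / Re s) and
   satisfies (s^alpha - lambda) U(s) = s^(alpha - 1).  If |arg lambda| <=
   alpha pi / 2, letting s tend to a root of s^alpha = lambda in the closed right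
   half plane yields a contradiction. *)

Require Import Defs.
From mathcomp Require Import all_boot all_order all_algebra.
From mathcomp Require Import all_classical all_reals all_analysis.
From mathcomp Require Import complex measurable_realfun.
From mathcomp Require Import ring lra.

Set Implicit Arguments.
Unset Strict Implicit.
Unset Printing Implicit Defensive.

Import Order.TTheory GRing.Theory Num.Theory.
Import numFieldNormedType.Exports.

Local Open Scope classical_set_scope.
Local Open Scope ring_scope.

(** * Integrals over the line *)

(** D^alpha x need not be Caputo differentiable, so D^alpha is never iterated on functions: it is
    only applied to identities [M *m x t = 0], whose validity it preserves. Since s^a is
    multivalued, an analytic function is written as a function of the modulus r and the angle x,
    where s^a is r^a e^{iax} without any cut; deforming a contour then means that the angular
    derivative of a ray integral is the integral of an exact radial derivative. The exponents alpha
    - 1 and alpha - 2 accompany x(0) and x'(0) once the transformed equation is multiplied by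
    p^alpha; in both cases H(s) is O(min(r^{alpha-2}, 1/r)), the single estimate on which all the
    contour integrals rest. In the converse, the delicate case is |arg lambda| = alpha pi / 2: the
    root of s^alpha = lambda then lies on the imaginary axis, where the transform U may not exist.
    It is approached at fixed modulus by shrinking the angle by a factor 1 - e; then |s^alpha -
    lambda| is O(e) while Re s is at least a multiple of e, so that the bound o(1 / Re s) is just
    enough. *)

Section LebesgueLine.
Variable R : realType.
Local Notation mu := (@lebesgue_measure R).
Implicit Types (f g : R -> R).

Definition L1 f := mu.-integrable setT (EFin \o f).

Lemma preimage_affine_ocitv (a b p q : R) : 0 < a ->
  (fun x : R => a * x + b) @^-1` `]p, q] = `](p - b) / a, (q - b) / a]%classic.
Proof.
move=> a0; apply/seteqP; split => x /=; rewrite !in_itv/= => /andP[h1 h2];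
  apply/andP; split.
- by rewrite ltr_pdivrMr// mulrC ltrBlDr.
- by rewrite ler_pdivlMr// mulrC lerBrDr.
- by rewrite -ltrBlDr mulrC -ltr_pdivrMr.
- by rewrite -lerBrDr mulrC -ler_pdivlMr.
Qed.

Lemma measurable_affine (a b : R) :
  measurable_fun [set: R] (fun x : R => a * x + b).
Proof. by apply: measurable_funD => //; exact: measurable_funM. Qed.

(** The pushforward rescaled by a gives every half-open interval its length, so it is Lebesgue
    measure by uniqueness. *)
Lemma lebesgue_measure_affine (a b : R) (A : set R) : 0 < a -> measurable A ->
  mu ((fun x : R => a * x + b) @^-1` A) = (a^-1%:E * mu A)%E.
Proof.
move=> a0 mA.
pose phi : R -> measurableTypeR R := fun x => a * x + b.
have mphi : measurable_fun [set: R] phi := measurable_affine a b.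
pose nu : {measure set (measurableTypeR R) -> \bar R} :=
  mscale (NngNum (ltW a0)) (pushforward mu phi).
have -> : mu A = nu mphi A; last first.
  by rewrite /nu /mscale/= muleA -EFinM mulVf ?gt_eqF// mul1e.
apply: lebesgue_measure_unique mA => _ [[p q]] _ <-.
have -> : nu mphi `]p, q]%classic = (a%:E * mu `]((p - b) / a)%R, ((q - b) / a)%R]%classic)%E.
  by rewrite -preimage_affine_ocitv.
rewrite !lebesgue_measure_itv/= !lte_fin ltr_pM2r ?invr_gt0// ltrD2r.
case: ifPn => // _; last by rewrite mule0.
by rewrite -!EFinD -EFinM -mulrBl opprB addrA subrK mulrCA divff ?mulr1// gt_eqF.
Qed.

Lemma ge0_integral_affine (a b : R) (f : R -> \bar R) : 0 < a ->
  measurable_fun setT f -> (forall x, 0 <= f x)%E ->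
  (\int[mu]_x f (a * x + b)%R = a^-1%:E * \int[mu]_x f x)%E.
Proof.
move=> a0 mf f0.
pose phi : R -> measurableTypeR R := fun x => a * x + b.
have mphi : measurable_fun [set: R] phi := measurable_affine a b.
have := @ge0_integral_pushforward _ _ (measurableTypeR R) _ R phi mphi mu setT f measurableT mf
  (fun x _ => f0 x).
rewrite preimage_setT => <-.
have ai0 : 0 <= a^-1 by rewrite invr_ge0 ltW.
rewrite (eq_measure_integral (mscale (NngNum ai0) mu)) ?ge0_integral_mscale//=.
by move=> A mA _; rewrite /mscale/= /pushforward lebesgue_measure_affine.
Qed.

Lemma ge0_integral_oppr (f : R -> \bar R) :
  measurable_fun setT f -> (forall x, 0 <= f x)%E ->
  (\int[mu]_x f (- x)%R = \int[mu]_x f x)%E.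
Proof.
move=> mf f0.
pose phi : R -> measurableTypeR R := fun x => - x.
have mphi : measurable_fun [set: R] phi by exact: oppr_measurable.
have := @ge0_integral_pushforward _ _ (measurableTypeR R) _ R phi mphi mu setT f measurableT mf
  (fun x _ => f0 x).
rewrite preimage_setT => <-.
by apply: eq_measure_integral => A mA _; exact: lebesgue_measureN.
Qed.

(** A substitution known for nonnegative functions extends to L1 through positive and negative
    parts; increasing affine maps and the reflection x -> -x are the instances. *)
Lemma L1_comp (T : R -> R) (c : R) : measurable_fun setT T -> 0 <= c ->
  (forall f : R -> \bar R, measurable_fun setT f -> (forall x, 0 <= f x)%E ->
    (\int[mu]_x f (T x) = c%:E * \int[mu]_x f x)%E) ->
  forall f, L1 f -> L1 (f \o T) /\ \int[mu]_x f (T x) = c * \int[mu]_x f x.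
Proof.
move=> mT c0 hT f fL; have /integrableP[mf lf] := fL.
have mf' : measurable_fun setT f by exact/measurable_EFinP.
have fTL : L1 (f \o T).
  apply/integrableP; split.
    by apply/measurable_EFinP; exact: measurableT_comp.
  rewrite /= (hT (fun y => `|(f y)%:E|%E))//; first by rewrite lte_mul_pinfty// lee_fin.
  exact: measurableT_comp.
split => //; rewrite /Rintegral integralE [in RHS]integralE.
have -> : ((fun x => (f (T x))%:E)^\+ = (EFin \o f)^\+ \o T)%E.
  by rewrite -funepos_comp.
have -> : ((fun x => (f (T x))%:E)^\- = (EFin \o f)^\- \o T)%E.
  by rewrite -funeneg_comp.
rewrite (hT (EFin \o f)^\+%E)// ?(hT (EFin \o f)^\-%E)//;
  [|exact: measurable_funeneg|exact: measurable_funepos].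
have fp := integrable_pos_fin_num measurableT fL.
have fn := integrable_neg_fin_num measurableT fL.
rewrite -muleBr//; last by rewrite fin_num_adde_defl// fin_numN.
by rewrite fineM// fin_numB fp.
Qed.

Lemma L1_affine (a b : R) f : 0 < a -> L1 f -> L1 (fun x => f (a * x + b)).
Proof.
move=> a0 fL; have [] := @L1_comp (fun x => a * x + b) a^-1 _ _ _ f fL => //.
- exact: measurable_affine.
- by rewrite invr_ge0 ltW.
- by move=> h mh h0; exact: ge0_integral_affine.
Qed.

Lemma Rintegral_affine (a b : R) f : 0 < a -> L1 f ->
  \int[mu]_x f (a * x + b) = a^-1 * \int[mu]_x f x.
Proof.
move=> a0 fL; have [] := @L1_comp (fun x => a * x + b) a^-1 _ _ _ f fL => //.
- exact: measurable_affine.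
- by rewrite invr_ge0 ltW.
- by move=> h mh h0; exact: ge0_integral_affine.
Qed.

Lemma L1_oppr f : L1 f -> L1 (fun x => f (- x)).
Proof.
move=> fL; have [] := @L1_comp -%R 1 _ _ _ f fL => //.
by move=> h mh h0; rewrite mul1e; exact: ge0_integral_oppr.
Qed.

Lemma Rintegral_oppr f : L1 f -> \int[mu]_x f (- x) = \int[mu]_x f x.
Proof.
move=> fL; have [] := @L1_comp -%R 1 _ _ _ f fL => //.
  by move=> h mh h0; rewrite mul1e; exact: ge0_integral_oppr.
by rewrite mul1r.
Qed.

Lemma L1_shift (b : R) f : L1 f -> L1 (fun x => f (x + b)).
Proof.
by move=> /(@L1_affine 1 b _ ltr01); under eq_fun do rewrite mul1r.
Qed.

Lemma Rintegral_shift (b : R) f : L1 f ->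
  \int[mu]_x f (x + b) = \int[mu]_x f x.
Proof.
move=> /(@Rintegral_affine 1 b _ ltr01); rewrite invr1 mul1r => <-.
by apply: eq_Rintegral => x _; rewrite mul1r.
Qed.

Lemma L1_measurable f : L1 f -> measurable_fun setT f.
Proof. by case/integrableP => /measurable_EFinP. Qed.

Lemma L1_le f g : measurable_fun setT f -> (forall x, `|f x| <= g x) ->
  L1 g -> L1 f.
Proof.
move=> mf fg gL; apply: (le_integrable measurableT _ _ gL).
  exact/measurable_EFinP.
by move=> x _ /=; rewrite lee_fin (le_trans (fg x))// ler_norm.
Qed.

Lemma L1D f g : L1 f -> L1 g -> L1 (fun x => f x + g x).
Proof.
move=> fL gL; rewrite /L1 (_ : _ \o _ = (EFin \o f) \+ (EFin \o g))%E//.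
exact: integrableD.
Qed.

Lemma L1Z (c : R) f : L1 f -> L1 (fun x => c * f x).
Proof.
move=> fL; rewrite /L1 (_ : _ \o _ = (fun x => c%:E * (EFin \o f) x)%E)//.
exact: integrableZl.
Qed.

Lemma L1N f : L1 f -> L1 (fun x => - f x).
Proof. by move=> /(L1Z (- 1)); under eq_fun do rewrite mulN1r. Qed.

Lemma L1B f g : L1 f -> L1 g -> L1 (fun x => f x - g x).
Proof. by move=> fL /L1N; exact: L1D. Qed.

Lemma L10 : L1 (fun=> 0).
Proof. exact: integrable0. Qed.


Lemma L1_normr f : L1 f -> L1 (fun x => `|f x|).
Proof. exact: integrable_norm. Qed.

Lemma L1_ge0_lty f : measurable_fun setT f -> (forall x, 0 <= f x) ->
  (\int[mu]_x (f x)%:E < +oo)%E -> L1 f.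
Proof.
move=> mf f0 lf; apply/integrableP; split; first exact/measurable_EFinP.
by under eq_integral do rewrite /= ger0_norm//.
Qed.

Lemma EFin_Rintegral f : L1 f -> (\int[mu]_x f x)%:E = (\int[mu]_x (f x)%:E)%E.
Proof. by move=> fL; rewrite fineK//; exact: integrable_fin_num. Qed.

(** Domination of the inner absolute integrals by an L1 function [G] gives integrability on the
    plane by Tonelli, hence Fubini for real-valued iterated integrals. *)
Lemma fubini_line (F : R * R -> R) (G : R -> R) :
  measurable_fun setT F ->
  (forall y, L1 (fun x => F (x, y))) -> L1 G ->
  (forall y, \int[mu]_x `|F (x, y)| <= G y) ->
  [/\ L1 (fun x => \int[mu]_y F (x, y)), L1 (fun y => \int[mu]_x F (x, y)) &
      \int[mu]_x \int[mu]_y F (x, y) = \int[mu]_y \int[mu]_x F (x, y)].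
Proof.
move=> mF FL GL FG.
have mEF : measurable_fun setT (EFin \o F) by exact/measurable_EFinP.
have iF : (mu \x mu)%E.-integrable setT (EFin \o F).
  apply: (proj2 (@integrable21ltyP _ _ (measurableTypeR R) (measurableTypeR R) R mu mu _ mEF)).
  apply: (@le_lt_trans _ _ (\int[mu]_y `|(EFin \o G) y|)%E); last first.
    by case/integrableP : GL.
  apply: ge0_le_integral => //=.
  - by move=> y _; exact: integral_ge0.
  - apply: (@measurable_fun_fubini_tonelli_G _ _ (measurableTypeR R)
      (measurableTypeR R) R mu (fun z => `|F z|%:E)) => //.
    by apply/measurable_EFinP; exact: (measurableT_comp _ mF).
  - by do 2 apply: measurableT_comp => //; exact: L1_measurable.
  - move=> y _; rewrite -(EFin_Rintegral (L1_normr (FL y))) lee_fin.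
    by rewrite (le_trans (FG y))// ler_norm.
(* Sections in y are integrable for almost every x only, so the inner integral may be infinite on a
   null set; taking [fine] changes neither integrability nor the integral. *)
have sw (H : R -> \bar R) : mu.-integrable setT H ->
    L1 (fun x => fine (H x)) /\
    (\int[mu]_x fine (H x))%:E = (\int[mu]_x H x)%E.
  move=> iH; have aeH : ae_eq mu setT H (EFin \o fine \o H).
    have := integrable_ae measurableT iH; apply: filterS => x /= h _.
    by rewrite fineK// h.
  have mfH : measurable_fun setT (fine \o H).
    by apply: measurableT_comp => //; exact: (measurable_int mu).
  have iH' : L1 (fun x => fine (H x)).
    apply/integrableP; split; first exact/measurable_EFinP.
    have /integrableP[mH lH] := iH.
    apply: le_lt_trans lH; apply: ge0_le_integral => //=.
    - by do 2 apply: measurableT_comp => //.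
    - exact: measurableT_comp.
    - by move=> x _; case: (H x) => //=; rewrite normr0 leey.
  split => //; rewrite EFin_Rintegral//; apply: ae_eq_integral => //.
  - by apply/measurable_EFinP.
  - exact: (measurable_int mu).
  - by apply: filterS aeH => x h /h.
have [L1x Ex] := sw _ (integrable_fubini_F iF).
have L1y : L1 (fun y => \int[mu]_x F (x, y)).
  apply: L1_le GL => [|y]; last first.
    by apply: le_trans (FG y); exact: le_normr_Rintegral (FL y).
  have mG := measurable_fubini_G iF.
  by apply: (measurableT_comp _ mG).
split => //.
apply: EFin_inj; rewrite Ex [RHS]EFin_Rintegral//.
rewrite /fubini_F (Fubini iF); apply: eq_integral => y _ /=.
by rewrite -EFin_Rintegral.
Qed.

End LebesgueLine.

(** * Improper integrals over the open half line *)

Section HalfLine.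
Variable R : realType.
Local Notation mu := (@lebesgue_measure R).
Implicit Types (f F g : R -> R).

(** Extension by zero turns integrals over the half line into integrals over the whole line, where
    translations, convolutions and Fubini need no tracking of domains. *)
Definition onpos f : R -> R := fun t => if 0 < t then f t else 0.

Lemma onposE f t : 0 < t -> onpos f t = f t.
Proof. by rewrite /onpos => ->. Qed.

Lemma onpos0 f t : t <= 0 -> onpos f t = 0.
Proof. by rewrite /onpos ltNge => ->. Qed.

Lemma onpos_restrict f : onpos f = f \_ `]0, +oo[.
Proof.
apply/funext => t; rewrite /onpos patchE.
have [t0|t0] := ltP 0 t; first by rewrite mem_set//= in_itv/= t0.
by rewrite memNset//= in_itv/= andbT; apply/negP; rewrite -leNgt.
Qed.

Lemma Rintegral_onpos f :
  \int[mu]_(t in `]0, +oo[) f t = \int[mu]_t onpos f t.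
Proof. by rewrite Rintegral_mkcond onpos_restrict. Qed.

Lemma L1_onposP f : L1 (onpos f) <-> mu.-integrable `]0, +oo[ (EFin \o f).
Proof. by rewrite /L1 onpos_restrict -restrict_EFin -integrable_mkcond. Qed.

Lemma measurable_onpos f : (forall t, 0 < t -> {for t, continuous f}) ->
  measurable_fun setT (onpos f).
Proof.
move=> cf; rewrite onpos_restrict; apply/(measurable_restrictT _ _).1 => //.
apply: open_continuous_measurable_fun; first exact: interval_open.
by move=> t; rewrite inE/= in_itv/= andbT => /cf.
Qed.

Lemma onpos_le f g : (forall t, 0 < t -> f t <= g t) ->
  forall t, onpos f t <= onpos g t.
Proof. by move=> h t; rewrite /onpos; case: ifPn => // /h. Qed.

Lemma normr_onpos f t : `|onpos f t| = onpos (fun x => `|f x|) t.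
Proof. by rewrite /onpos; case: ifPn => //; rewrite normr0. Qed.

Lemma L1_onpos_le f g : (forall t, 0 < t -> {for t, continuous f}) ->
  (forall t, 0 < t -> `|f t| <= g t) -> L1 (onpos g) -> L1 (onpos f).
Proof.
move=> cf fg; apply: L1_le; first exact: measurable_onpos.
by move=> t; rewrite normr_onpos; exact: onpos_le.
Qed.

Lemma FTC2_closed f F (a b : R) : a < b ->
  (forall x, a <= x <= b -> is_derive x 1 F (f x)) ->
  (forall x, a <= x <= b -> {for x, continuous f}) ->
  mu.-integrable `[a, b] (EFin \o f) /\
  (\int[mu]_(x in `[a, b]) (f x)%:E = (F b - F a)%:E)%E.
Proof.
move=> ab dF cf.
have cw : {within `[a, b], continuous f}.
  apply: continuous_in_subspaceT => x /[!inE]/=.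
  by rewrite in_itv/=; exact: cf.
split; first by apply: continuous_compact_integrable => //; exact: segment_compact.
rewrite (@continuous_FTC2 _ f F)//.
- split; [move=> x /[!in_itv]/= /andP[ax xb] | | ].
  + by have := dF x; rewrite !ltW//= => /(_ isT) [].
  + apply: cvg_at_right_filter; apply: differentiable_continuous.
    by apply/derivable1_diffP; have := dF a; rewrite lexx ltW//= => /(_ isT) [].
  + apply: cvg_at_left_filter; apply: differentiable_continuous.
    by apply/derivable1_diffP; have := dF b; rewrite lexx ltW//= => /(_ isT) [].
- move=> x /[!in_itv]/= /andP[ax xb]; rewrite derive1E.
  by have := dF x; rewrite !ltW//= => /(_ isT) [].
Qed.

(** Compact intervals exhausting the half line, on which the fundamental theorem applies. It is used
    on [A n.+1], because [A 0] is reduced to the point 1. *)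
Let A (n : nat) : set R := `[n.+1%:R^-1, n.+1%:R]%classic.

Let A_nd : {homo A : n m / (n <= m)%N >-> (n <= m)%O}.
Proof.
move=> n m nm; apply/subsetPset => x; rewrite /A/= !in_itv/= => /andP[h1 h2].
rewrite (le_trans h2) ?ler_nat// andbT (le_trans _ h1)//.
by rewrite lef_pV2 ?posrE// ler_nat.
Qed.

Let bigcupA : \bigcup_n A n = `]0, +oo[%classic.
Proof.
apply/seteqP; split => x /=.
  move=> [n _]; rewrite /A/= !in_itv/= => /andP[h1 _].
  by rewrite andbT (lt_le_trans _ h1)// invr_gt0.
rewrite in_itv/= andbT => x0.
pose n := maxn (Num.truncn x) (Num.truncn x^-1).
have h (y : R) : 0 < y -> (Num.truncn y <= n)%N -> y <= n.+1%:R.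
  move=> y0 yn; apply: ltW; rewrite (lt_le_trans (truncnS_gt _))//.
  by rewrite ler_nat ltnS.
exists n => //; rewrite /A/= in_itv/= h ?leq_maxl// andbT.
by rewrite -[leRHS]invrK lef_pV2 ?posrE ?invr_gt0// h ?invr_gt0 ?leq_maxr.
Qed.

Let A_lt (n : nat) : (n.+2%:R^-1 : R) < n.+2%:R.
Proof.
rewrite (@le_lt_trans _ _ 1) ?invf_le1 ?ltr1n//.
by rewrite (ler_nat _ 1).
Qed.

Let A_gt0 (n : nat) (x : R) : n.+1%:R^-1 <= x -> 0 < x.
Proof. by apply: lt_le_trans; rewrite invr_gt0. Qed.

Let A_subset n : A n `<=` `]0, +oo[.
Proof. by rewrite -bigcupA; exact: bigcup_sup. Qed.

Let FTC_A f F n :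
  (forall t : R, 0 < t -> {for t, continuous f}) ->
  (forall t : R, 0 < t -> is_derive t 1 F (f t)) ->
  (\int[mu]_(x in A n.+1) (f x)%:E = (F n.+2%:R - F n.+2%:R^-1)%:E)%E.
Proof.
move=> cf dF; apply: (proj2 (FTC2_closed (A_lt n) _ _)).
- by move=> x /andP[/A_gt0 x0 _]; exact: dF.
- by move=> x /andP[/A_gt0 x0 _]; exact: cf.
Qed.

(** Monotone convergence along the [A n]: each integral is a difference of two values of [F], hence
    at most 2 M. *)
Lemma L1_onpos_primitive f F (M : R) :
  (forall t : R, 0 < t -> 0 <= f t) ->
  (forall t : R, 0 < t -> {for t, continuous f}) ->
  (forall t : R, 0 < t -> is_derive t 1 F (f t)) ->
  (forall t : R, 0 < t -> `|F t| <= M) -> L1 (onpos f).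
Proof.
move=> f0 cf dF FM.
apply: L1_ge0_lty; first exact: measurable_onpos.
  by move=> t; rewrite /onpos; case: ifPn => // /f0.
apply: (@le_lt_trans _ _ ((M + M)%:E)); last exact: ltry.
rewrite (_ : (fun t => (onpos f t)%:E) = (EFin \o f) \_ `]0, +oo[); last first.
  by rewrite restrict_EFin onpos_restrict.
rewrite -integral_mkcond -bigcupA.
have mf : measurable_fun (`]0, +oo[ : set R) f.
  apply: open_continuous_measurable_fun; first exact: interval_open.
  by move=> t; rewrite inE/= in_itv/= andbT => /cf.
have cvgA : (\int[mu]_(x in A n) (EFin \o f) x)%E @[n --> \oo] -->
    (\int[mu]_(x in \bigcup_n A n) (EFin \o f) x)%E.
  apply: ge0_nondecreasing_set_cvg_integral => //.
  - by move=> n; exact: measurable_itv.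
  - move=> n; apply/measurable_EFinP; apply: measurable_funS mf => //; exact: A_subset.
  - by move=> n x /A_subset /=; rewrite in_itv/= andbT lee_fin => /f0.
rewrite -(cvg_lim _ cvgA)//; apply: lime_le; first exact: cvgP cvgA.
near=> n; have n0 : (0 < n)%N by near: n; exists 1%N.
rewrite -(prednK n0) /= (FTC_A _ cf dF) lee_fin.
by rewrite (le_trans (ler_norm _))// (le_trans (ler_normB _ _))// lerD// FM// invr_gt0.
Unshelve. all: end_near. Qed.

Lemma dominated_cvg_line (fn : nat -> R -> R) f g :
  (forall n, measurable_fun setT (fn n)) ->
  (forall x, fn n x @[n --> \oo] --> f x) ->
  (forall n x, `|fn n x| <= g x) -> L1 g ->
  L1 f /\ \int[mu]_x fn n x @[n --> \oo] --> \int[mu]_x f x.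
Proof.
move=> mfn cfn fng gL.
have mf : measurable_fun setT f.
  by apply: (measurable_fun_cvg mfn) => x _; exact: cfn.
have [| | | | |fL _ h] := @dominated_convergence _ _ _ mu setT measurableT
  (fun n => EFin \o fn n) (EFin \o f) (EFin \o g) _ _ _ _ _.
- by move=> n; apply/measurable_EFinP; exact: mfn.
- by apply/measurable_EFinP; exact: mf.
- by apply: aeW => x _; apply: cvg_EFin; [exact: nearW|exact: cfn].
- exact: gL.
- by apply: aeW => x n _ /=; rewrite lee_fin.
split => //; apply: fine_cvg.
by rewrite EFin_Rintegral.
Qed.

(** As [f] may change sign, the integrals over the [A n] converge by domination by |f| and not by
    monotonicity. *)
Lemma Rintegral_onpos_primitive f F (l0 l1 : R) :
  L1 (onpos f) ->
  (forall t : R, 0 < t -> {for t, continuous f}) ->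
  (forall t : R, 0 < t -> is_derive t 1 F (f t)) ->
  F @ 0^'+ --> l0 -> F @ +oo --> l1 ->
  \int[mu]_t onpos f t = l1 - l0.
Proof.
move=> fL cf dF F0 Foo.
pose fn n : R -> R := (onpos f) \_ (A n.+1).
have [| | | |_ cvf] := @dominated_cvg_line fn (onpos f) (fun x => `|onpos f x|).
- move=> n; apply/(measurable_restrictT _ _).1; first exact: measurable_itv.
  exact: measurable_funTS (L1_measurable fL).
- move=> x; apply: cvg_near_cst.
  have [x0|x0] := ltP 0 x; last first.
    by near=> n; rewrite /fn patchE onpos0//; case: ifP.
  have : `]0, +oo[%classic x by rewrite /= in_itv/= x0.
  rewrite -bigcupA => -[N _ ANx]; near=> n; rewrite /fn patchE mem_set//.
  apply: (subsetPset _ _ (A_nd _)) ANx; rewrite (@leq_trans n)//.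
  by near: n; exists N.
- by move=> n x; rewrite /fn patchE; case: ifP => //; rewrite normr0.
- exact: L1_normr.
apply: (cvg_unique _ cvf) => //.
have -> : (fun n => \int[mu]_x fn n x) = (fun n => F n.+2%:R - F n.+2%:R^-1).
  apply/funext => n; rewrite -Rintegral_mkcond -[RHS]/(fine (_ %:E)).
  rewrite -(FTC_A n cf dF); congr fine; apply: eq_integral => x.
  by rewrite inE => /A_subset/=; rewrite in_itv/= andbT => x0; rewrite onposE.
apply: cvgB.
- move/cvg_pinftyP : Foo; apply; apply/cvgrnyP.
  by apply/cvgnyPge => m; near=> n; rewrite !leqW//; near: n; exists m.
- move/cvg_at_rightP : F0; apply; split; first by move=> n; rewrite invr_gt0.
  by have := @cvg_harmonic R; rewrite -cvg_shiftS.
Unshelve. all: end_near. Qed.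
End HalfLine.

(** * Fractional kernels *)

Section RealCalculus.
Variable R : realType.
Implicit Types (f g : R -> R) (x a b : R).

Lemma der_eq f x a b : is_derive x 1 f a -> a = b -> is_derive x 1 f b.
Proof. by move=> + <-. Qed.

Lemma der_cst x (c : R) : is_derive x 1 (fun=> c) 0.
Proof. exact: is_derive_cst. Qed.

Lemma der_id x : is_derive x 1 (fun y : R => y) 1.
Proof. exact: is_derive_id. Qed.

Lemma der_add f g x a b : is_derive x 1 f a -> is_derive x 1 g b ->
  is_derive x 1 (fun y => f y + g y) (a + b).
Proof. by move=> df dg; exact: is_deriveD. Qed.

Lemma der_sub f g x a b : is_derive x 1 f a -> is_derive x 1 g b ->
  is_derive x 1 (fun y => f y - g y) (a - b).
Proof. by move=> df dg; exact: is_deriveB. Qed.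

Lemma der_opp f x a : is_derive x 1 f a -> is_derive x 1 (fun y => - f y) (- a).
Proof. by move=> df; exact: is_deriveN. Qed.

Lemma der_mul f g x a b : is_derive x 1 f a -> is_derive x 1 g b ->
  is_derive x 1 (fun y => f y * g y) (a * g x + f x * b).
Proof.
move=> df dg; have -> : a * g x + f x * b = f x *: b + g x *: a.
  by rewrite addrC mulrC [a * _]mulrC -[in RHS]/(f x * b) mulrC.
exact: is_deriveM.
Qed.

Lemma der_scale (c : R) f x a : is_derive x 1 f a ->
  is_derive x 1 (fun y => c * f y) (c * a).
Proof.
by move=> df; apply: der_eq (der_mul (der_cst x c) df) _; rewrite mul0r add0r.
Qed.

Lemma der_inv f x a : f x != 0 -> is_derive x 1 f a ->
  is_derive x 1 (fun y => (f y)^-1) (- a / f x ^+ 2).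
Proof.
move=> f0 df; have -> : - a / f x ^+ 2 = - f x ^- 2 *: a.
  by rewrite -[RHS]/(_ * _) mulNr mulNr mulrC.
exact: is_deriveV.
Qed.

Lemma der_comp f g x a b : is_derive (g x) 1 f a -> is_derive x 1 g b ->
  is_derive x 1 (fun y => f (g y)) (a * b).
Proof. by move=> df dg; exact: (@is_derive1_comp _ f g). Qed.

Lemma der_expR f x a : is_derive x 1 f a ->
  is_derive x 1 (fun y => expR (f y)) (expR (f x) * a).
Proof. exact: der_comp (is_derive_expR _). Qed.

Lemma der_cos f x a : is_derive x 1 f a ->
  is_derive x 1 (fun y => cos (f y)) (- sin (f x) * a).
Proof. exact: der_comp (is_derive_cos _). Qed.

Lemma der_sin f x a : is_derive x 1 f a ->
  is_derive x 1 (fun y => sin (f y)) (cos (f x) * a).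
Proof. exact: der_comp (is_derive_sin _). Qed.

Lemma der_powR f x a (z : R) : 0 < f x -> is_derive x 1 f a ->
  is_derive x 1 (fun y => f y `^ z) (z * f x `^ (z - 1) * a).
Proof. by move=> f0; exact: der_comp (is_derive1_powR z f0). Qed.

Lemma der_continuous f x a : is_derive x 1 f a -> {for x, continuous f}.
Proof.
by move=> [df _]; apply: differentiable_continuous; apply/derivable1_diffP.
Qed.

Lemma cont_cst x (c : R) : {for x, continuous (fun _ : R => c)}.
Proof. exact: cvg_cst. Qed.

Lemma cont_id x : {for x, continuous (fun y : R => y)}.
Proof. exact: cvg_id. Qed.

Lemma cont_add f g x : {for x, continuous f} -> {for x, continuous g} ->
  {for x, continuous (fun y => f y + g y)}.
Proof. by move=> cf cg; exact: cvgD. Qed.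

Lemma cont_opp f x : {for x, continuous f} -> {for x, continuous (fun y => - f y)}.
Proof. by move=> cf; exact: cvgN. Qed.

Lemma cont_sub f g x : {for x, continuous f} -> {for x, continuous g} ->
  {for x, continuous (fun y => f y - g y)}.
Proof. by move=> cf cg; exact: cvgB. Qed.

Lemma cont_mul f g x : {for x, continuous f} -> {for x, continuous g} ->
  {for x, continuous (fun y => f y * g y)}.
Proof. by move=> cf cg; exact: cvgM. Qed.

Lemma cont_inv f x : f x != 0 -> {for x, continuous f} ->
  {for x, continuous (fun y => (f y)^-1)}.
Proof. by move=> f0 cf; exact: cvgV. Qed.

Lemma cont_comp f g x : {for g x, continuous f} -> {for x, continuous g} ->
  {for x, continuous (fun y => f (g y))}.
Proof. by move=> cf cg; exact: continuous_comp. Qed.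

Lemma cont_expR f x : {for x, continuous f} ->
  {for x, continuous (fun y => expR (f y))}.
Proof. by apply: cont_comp; exact: continuous_expR. Qed.

Lemma cont_cos f x : {for x, continuous f} ->
  {for x, continuous (fun y => cos (f y))}.
Proof. by apply: cont_comp; exact: continuous_cos. Qed.

Lemma cont_sin f x : {for x, continuous f} ->
  {for x, continuous (fun y => sin (f y))}.
Proof. by apply: cont_comp; exact: continuous_sin. Qed.

Lemma cont_powR f x (z : R) : 0 < f x -> {for x, continuous f} ->
  {for x, continuous (fun y => f y `^ z)}.
Proof.
move=> f0; apply: (@cont_comp (fun y => y `^ z)).
exact: der_continuous (is_derive1_powR z f0).
Qed.

Lemma cont_normr f x : {for x, continuous f} ->
  {for x, continuous (fun y => `|f y|)}.
Proof. by move=> cf; exact: cvg_norm. Qed.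

End RealCalculus.

(** Continuity by recursion on the syntax of the function. What remains, unless it is a hypothesis,
    is positivity of the bases of powers, nonvanishing of denominators and continuity of the
    atoms. *)
Ltac cont := lazymatch goal with
  | |- {for _, continuous ?f} => lazymatch f with
    | (fun _ => ?c) => exact: cont_cst
    | (fun y => y) => exact: cont_id
    | (fun y => @?a y + @?b y) => apply: (@cont_add _ a b); cont
    | (fun y => - @?a y) => apply: (@cont_opp _ a); cont
    | (fun y => @?a y * @?b y) => apply: (@cont_mul _ a b); cont
    | (fun y => expR (@?a y)) => apply: (@cont_expR _ a); cont
    | (fun y => cos (@?a y)) => apply: (@cont_cos _ a); cont
    | (fun y => sin (@?a y)) => apply: (@cont_sin _ a); cont
    | (fun y => `|@?a y|) => apply: (@cont_normr _ a); cont
    | (fun y => @?a y `^ _) => apply: (@cont_powR _ a); [try assumption|cont]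
    | (fun y => (@?a y)^-1) => apply: (@cont_inv _ a); [try assumption|cont]
    | (fun y => @?a y ^+ 2) => apply: (@cont_mul _ a a); cont
    | _ => try assumption
    end
  | |- _ => idtac
  end.

(** * The Gamma function and the Riemann-Liouville kernels *)

Section PowerKernel.
Variable R : realType.
Local Notation mu := (@lebesgue_measure R).
Implicit Types (f g : R -> R).

Lemma powR_subr1 (r z : R) : 0 < r -> r `^ (z - 1) = r `^ z / r.
Proof.
by move=> r0; rewrite powRB ?powRr1 ?ltW// (gt_eqF r0) implybT.
Qed.

Lemma powRDgt0 (r y z : R) : 0 < r -> r `^ (y + z) = r `^ y * r `^ z.
Proof. by move=> r0; rewrite powRD// (gt_eqF r0) implybT. Qed.

Lemma onposZ (c : R) f : onpos (fun t => c * f t) = (fun t => c * onpos f t).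
Proof. by apply/funext => t; rewrite /onpos; case: ifP; rewrite ?mulr0. Qed.

(** The derivative of - 1 / (z (1 + r^z)): a dominating function that behaves like r^{z-1} at 0 and
    r^{-z-1} at infinity, and whose integrability is immediate from its bounded primitive. *)
Definition algebraic_decay (z r : R) : R := r `^ (z - 1) / (1 + r `^ z) ^+ 2.

Let den_gt0 (z r : R) : 0 < 1 + r `^ z.
Proof. by rewrite ltr_wpDr// powR_ge0. Qed.

Lemma algebraic_decay_ge0 (z r : R) : 0 <= algebraic_decay z r.
Proof. by rewrite divr_ge0 ?powR_ge0// exprn_ge0// ltW. Qed.

Lemma continuous_algebraic_decay (z r : R) : 0 < r ->
  {for r, continuous (algebraic_decay z)}.
Proof.
by move=> r0; rewrite /algebraic_decay; cont; rewrite // expf_neq0// gt_eqF.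
Qed.

Lemma L1_algebraic_decay (z : R) : 0 < z -> L1 (onpos (algebraic_decay z)).
Proof.
move=> z0; apply: (@L1_onpos_primitive _ _ (fun r => - z^-1 * (1 + r `^ z)^-1) z^-1).
- by move=> t _; exact: algebraic_decay_ge0.
- by move=> t; exact: continuous_algebraic_decay.
- move=> t t0.
  have d : is_derive t 1 (fun r : R => 1 + r `^ z) (0 + z * t `^ (z - 1) * 1).
    by apply: der_add (der_cst _ _) _; exact: der_powR (der_id _).
  apply: der_eq (der_scale _ (der_inv _ d)) _; first by rewrite gt_eqF.
  rewrite /algebraic_decay; field; rewrite !gt_eqF//=; exact: den_gt0.
- move=> t t0; rewrite normrM normrN !gtr0_norm ?invr_gt0//.
  by rewrite ler_piMr ?invr_ge0 ?(ltW z0)// invf_le1// lerDl powR_ge0.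
Qed.

(** With u = c r / z, the inequality ln u < u reads r^z < (z / c)^z e^{c r}, which is where the
    constant comes from. *)
Lemma powR_le_expR (z c : R) : 0 <= z -> 0 < c ->
  exists2 C, 0 < C & forall r : R, 0 < r -> r `^ z <= C * expR (c * r).
Proof.
rewrite le_eqVlt => /predU1P[<-|z0] c0.
  exists 1 => // r r0; rewrite powRr0 mul1r.
  by rewrite -expR0 ler_expR mulr_ge0 ?ltW.
exists (expR (z * ln (z / c))) => [|r r0]; first exact: expR_gt0.
rewrite /powR gt_eqF// -expRD ler_expR.
have -> : ln r = ln (z / c) + ln (c * r / z).
  rewrite -lnM ?posrE ?divr_gt0 ?mulr_gt0//; congr ln; field.
  by rewrite !gt_eqF.
rewrite mulrDr lerD2l -ler_pdivlMl// [leRHS]mulrC.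
by apply/ltW/ln_sublinear; rewrite divr_gt0// mulr_gt0.
Qed.

(** Half of the exponent bounds 1 + r^z, so the whole exponential absorbs (1 + r^z)^2 and leaves a
    multiple of [algebraic_decay]. *)
Lemma L1_powR_expR (z c : R) : 0 < z -> 0 < c ->
  L1 (onpos (fun r => r `^ (z - 1) * expR (- (c * r)))).
Proof.
move=> z0 c0; have c20 : 0 < c / 2 by rewrite divr_gt0.
have [C C0 hC] := powR_le_expR (ltW z0) c20.
apply: (@L1_onpos_le _ _ (fun r => (1 + C) ^+ 2 * algebraic_decay z r)).
- by move=> t t0; cont.
- move=> t t0; rewrite ger0_norm ?mulr_ge0 ?powR_ge0 ?expR_ge0//.
  rewrite /algebraic_decay mulrCA ler_wpM2l ?powR_ge0//.
  rewrite ler_pdivlMr ?exprn_gt0// expRN ler_pdivrMl ?expR_gt0//.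
  have -> : expR (c * t) = expR (c / 2 * t) ^+ 2.
    by rewrite expr2 -expRD; congr expR; lra.
  have C1 : 0 <= 1 + C by rewrite addr_ge0// ltW.
  rewrite -exprMn lerXn2r ?nnegrE ?mulr_ge0 ?expR_ge0 ?(ltW (den_gt0 _ _))//.
  rewrite mulrDr mulr1 (mulrC _ C) lerD ?hC//.
  by rewrite (le_trans _ (expR_ge1Dx _))// lerDl mulr_ge0// ltW.
- by rewrite onposZ; exact/L1Z/L1_algebraic_decay.
Qed.

Lemma GammaE (z : R) :
  Gamma z = \int[mu]_t onpos (fun t => t `^ (z - 1) * expR (- t)) t.
Proof. by rewrite /Gamma Rintegral_onpos. Qed.

Lemma L1_Gamma (z : R) : 0 < z ->
  L1 (onpos (fun t => t `^ (z - 1) * expR (- t))).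
Proof.
move=> /L1_powR_expR /(_ ltr01); congr L1; apply/funext => t.
by rewrite /onpos mul1r.
Qed.

Lemma ge_Rintegral_itv f (c a b : R) : a <= b -> 0 <= c -> L1 f ->
  (forall x, 0 <= f x) -> (forall x, a <= x <= b -> c <= f x) ->
  c * (b - a) <= \int[mu]_x f x.
Proof.
move=> ab c0 fL f0 cf.
have <- : \int[mu]_x ((cst c) \_ `[a, b]) x = c * (b - a).
  rewrite -Rintegral_mkcond Rintegral_cst//; congr (_ * _).
  transitivity (fine (lebesgue_measure [set` `[a, b]])) => //.
  rewrite lebesgue_measure_itv/= lte_fin; case: ltgtP ab => // -> _.
  by rewrite subrr.
apply: le_Rintegral => //.
- rewrite -restrict_EFin; apply: (integrable_mkcond _ _).1 => //.
  apply: continuous_compact_integrable; first exact: segment_compact.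
  by apply: continuous_subspaceT => ?; exact: cvg_cst.
- move=> x _; rewrite patchE; case: ifPn => // /set_mem /=.
  by rewrite in_itv/=; exact: cf.
Qed.

(** The part of Euler's integral over [r, r + 1] alone. As r is free, this replaces Stirling's
    formula: Gamma outgrows every geometric sequence. *)
Lemma Gamma_ge (z r : R) : 0 < z -> 0 < r ->
  r `^ z / (r + 1) * expR (- (r + 1)) <= Gamma z.
Proof.
move=> z0 r0; rewrite GammaE.
rewrite -[leLHS]mulr1 -[X in _ * X](addrK r) (addrC 1 r).
apply: ge_Rintegral_itv; [by rewrite lerDl| |exact: L1_Gamma| |].
- by rewrite !mulr_ge0 ?powR_ge0 ?expR_ge0 ?invr_ge0 ?addr_ge0 ?ltW.
- move=> x; rewrite /onpos; case: ifP => // _.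
  by rewrite mulr_ge0 ?powR_ge0 ?expR_ge0.
- move=> x /andP[rx xr]; have x0 : 0 < x := lt_le_trans r0 rx.
  have h0 (y u : R) : 0 < u -> 0 <= y `^ z / u.
    by move=> u0; rewrite divr_ge0 ?powR_ge0 ?(ltW u0).
  rewrite onposE// powR_subr1// ler_pM ?expR_ge0 ?h0 ?addr_gt0//.
    rewrite ler_pM ?powR_ge0 ?invr_ge0 ?addr_ge0 ?(ltW r0)//.
      by rewrite ge0_ler_powR ?nnegrE ?(ltW z0) ?(ltW r0) ?(ltW x0).
    by rewrite lef_pV2 ?posrE// addr_gt0.
  by rewrite ler_expR lerN2.
Qed.

Lemma Gamma_gt0 (z : R) : 0 < z -> 0 < Gamma z.
Proof.
move=> z0; apply: lt_le_trans (Gamma_ge z0 ltr01).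
by rewrite mulr_gt0 ?expR_gt0 ?divr_gt0 ?powR_gt0.
Qed.

(** The Riemann-Liouville kernel: convolution with it is the fractional integral of order z. *)
Definition power_kernel (z : R) : R -> R :=
  onpos (fun t => (Gamma z)^-1 * t `^ (z - 1)).

Lemma power_kernel_ge0 (z t : R) : 0 < z -> 0 <= power_kernel z t.
Proof.
move=> z0; rewrite /power_kernel /onpos; case: ifP => // _.
by rewrite mulr_ge0 ?powR_ge0// invr_ge0 ltW// Gamma_gt0.
Qed.

Lemma power_kernel0 (z t : R) : t <= 0 -> power_kernel z t = 0.
Proof. by move=> t0; rewrite /power_kernel onpos0. Qed.

Lemma measurable_power_kernel (z : R) : measurable_fun setT (power_kernel z).
Proof. by apply: measurable_onpos => t t0; cont. Qed.

Lemma power_kernel_scale (z c t : R) : 0 < c ->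
  power_kernel z (c * t) = c `^ (z - 1) * power_kernel z t.
Proof.
move=> c0; rewrite /power_kernel /onpos pmulr_rgt0//; case: ifP => t0.
  by rewrite powRM ?ltW// mulrCA.
by rewrite mulr0.
Qed.

Lemma power_kernel_laplace (z p : R) : 0 < z -> 0 < p ->
  L1 (fun t => expR (- (p * t)) * power_kernel z t) /\
  \int[mu]_t (expR (- (p * t)) * power_kernel z t) = p `^ (- z).
Proof.
move=> z0 p0.
pose h : R -> R := onpos (fun t => t `^ (z - 1) * expR (- t)).
have E : (fun t => expR (- (p * t)) * power_kernel z t) =
    (fun t => (p `^ (1 - z) / Gamma z) * h (p * t + 0)).
  apply/funext => t; rewrite addr0 /h /power_kernel /onpos pmulr_rgt0//.
  case: ifP => t0; last by rewrite !mulr0.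
  rewrite powRM ?ltW//.
  have -> : p `^ (1 - z) = (p `^ (z - 1))^-1 by rewrite -powRN opprB.
  have : p `^ (z - 1) != 0 by rewrite gt_eqF// powR_gt0.
  have : Gamma z != 0 by rewrite gt_eqF// Gamma_gt0.
  by move=> *; field; apply/andP.
rewrite E; split; first by apply/L1Z/(L1_affine _ p0)/L1_Gamma.
rewrite RintegralZl//; last exact: L1_affine (L1_Gamma z0).
rewrite Rintegral_affine//; last exact: L1_Gamma.
have -> : p `^ (- z) = p `^ (1 - z) / p.
  by rewrite -powR_subr1// addrAC subrr add0r.
rewrite -GammaE; have G0 : Gamma z != 0 by rewrite gt_eqF// Gamma_gt0.
by field; rewrite G0 gt_eqF.
Qed.

End PowerKernel.

(** * Convolution *)

Section Convolution.
Variable R : realType.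
Local Notation mu := (@lebesgue_measure R).
Implicit Types (f g h : R -> R).

Lemma L1_rsub (t : R) f : L1 f -> L1 (fun s => f (t - s)).
Proof.
move=> /L1_oppr/(L1_shift (- t)); congr L1; apply/funext => s /=.
by rewrite opprD opprK addrC.
Qed.

Lemma Rintegral_rsub (t : R) f : L1 f ->
  \int[mu]_s f (t - s) = \int[mu]_s f s.
Proof.
move=> fL; rewrite -[RHS](Rintegral_oppr fL).
rewrite -[RHS](Rintegral_shift (- t) (L1_oppr fL)).
by apply: eq_Rintegral => s _; rewrite opprD opprK addrC.
Qed.

Lemma measurable_for_continuous f : (forall t, {for t, continuous f}) ->
  measurable_fun setT f.
Proof. by move=> cf; apply: continuous_measurable_fun => t; exact: cf. Qed.

Definition conv f g (t : R) : R := \int[mu]_s (f (t - s) * g s).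

Lemma measurable_conv_integrand f g (e : R -> R) : measurable_fun setT f ->
  measurable_fun setT g -> measurable_fun setT e ->
  measurable_fun setT (fun z : R * R => e z.1 * (f (z.1 - z.2) * g z.2)).
Proof.
move=> mf mg me; apply: measurable_funM.
  by apply: measurableT_comp => //; exact: measurable_fst.
apply: measurable_funM.
  apply: measurableT_comp => //; apply: measurable_funB.
    exact: measurable_fst.
  exact: measurable_snd.
by apply: measurableT_comp => //; exact: measurable_snd.
Qed.

(** [e] stands for a real exponential or for the real or imaginary part of a complex one. Such parts
    are not multiplicative, so the factorisation of e (t + s) is left to the callers and only the
    bound on [e] is assumed. *)
Lemma laplace_conv (sigma : R) (e f g : R -> R) :
  measurable_fun setT e -> measurable_fun setT f -> measurable_fun setT g ->
  (forall t, `|e t| <= expR (- (sigma * t))) ->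
  L1 (fun t => expR (- (sigma * t)) * f t) ->
  L1 (fun t => expR (- (sigma * t)) * g t) ->
  (forall t, L1 (fun s => f (t - s) * g s)) ->
  L1 (fun t => e t * conv f g t) /\
  \int[mu]_t (e t * conv f g t) =
    \int[mu]_s \int[mu]_t (e (t + s) * (f t * g s)).
Proof.
move=> me mf mg ew fL gL fgL.
pose w t := expR (- (sigma * t)).
pose F (z : R * R) := e z.1 * (f (z.1 - z.2) * g z.2).
pose G s := `|w s * g s| * \int[mu]_t `|w t * f t|.
have bF t s : `|F (t, s)| <= `|w s * g s| * `|w (t - s) * f (t - s)|.
  have -> : `|w s * g s| * `|w (t - s) * f (t - s)| =
      w t * `|f (t - s) * g s|.
    rewrite !normrM !(ger0_norm (expR_ge0 _)) mulrACA -expRD mulrC.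
    by rewrite (mulrC `|g s|) mulrC; congr (expR _ * _); ring.
  by rewrite /F/= normrM ler_wpM2r.
have wfL s : L1 (fun t => `|w s * g s| * `|w (t - s) * f (t - s)|).
  by apply: L1Z; exact: (L1_shift (- s) (L1_normr fL)).
have mF : measurable_fun setT F by exact: measurable_conv_integrand.
have FL s : L1 (fun t => F (t, s)).
  apply: L1_le (wfL s) => // ; apply: measurable_funM => //.
  apply: measurable_funM => //; apply: measurableT_comp => //.
  by rewrite /=; apply: measurable_funB; [exact: measurable_id|exact: measurable_cst].
have GL : L1 G.
  rewrite /G; under eq_fun do rewrite mulrC.
  by apply/L1Z/L1_normr.
have FG s : \int[mu]_t `|F (t, s)| <= G s.
  rewrite /G -(Rintegral_shift (- s) (L1_normr fL)) -RintegralZl//; last first.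
    exact: (L1_shift (- s) (L1_normr fL)).
  apply: le_Rintegral => //; [exact: L1_normr (FL s)|exact: wfL].
have [L1x _ E] := fubini_line mF FL GL FG.
have cE t : \int[mu]_s F (t, s) = e t * conv f g t.
  by rewrite /F/= RintegralZl//; exact: fgL.
split.
  by move: L1x; congr L1; apply/funext.
under eq_Rintegral do rewrite -cE.
rewrite E; apply: eq_Rintegral => s _.
rewrite -(Rintegral_shift s (FL s)); apply: eq_Rintegral => t _.
by rewrite /F/= addrK.
Qed.

(** The two singularities, at 0 and 1, are separated at 1/2: on either side one factor is bounded
    and the other is integrable, as its product with e^{-t} is. *)
Lemma power_kernel_conv_L1_1 (a b : R) : 0 < a -> 0 < b ->
  L1 (fun s => power_kernel a (1 - s) * power_kernel b s).
Proof.
move=> a0 b0.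
pose w (z t : R) : R := expR (- (1 * t)) * power_kernel z t.
have wL (z : R) : 0 < z -> L1 (w z).
  by move=> z0; exact: (power_kernel_laplace z0 ltr01).1.
have le2 (z t : R) : 0 < z -> 2^-1 <= t <= 1 -> power_kernel z t <= 2 / Gamma z.
  move=> z0 /andP[t1 t2]; have t0 : 0 < t by rewrite (lt_le_trans _ t1).
  rewrite /power_kernel onposE// mulrC ler_wpM2r ?invr_ge0 ?(ltW (Gamma_gt0 z0))//.
  rewrite powR_subr1// ler_pdivrMr//; apply: (@le_trans _ _ 1); last by lra.
  have -> : 1 = (1 : R) `^ z by rewrite powR1.
  by rewrite ge0_ler_powR ?nnegrE ?(ltW z0) ?(ltW t0).
have pw (z t : R) : 0 < z -> t <= 1 -> power_kernel z t <= expR 1 * w z t.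
  move=> z0 t1; rewrite /w mulrA -expRD ler_peMl ?power_kernel_ge0//.
  by rewrite (le_trans _ (expR_ge1Dx _))//; lra.
have pk0 (z t : R) : 0 < z -> 0 <= power_kernel z t.
  exact: power_kernel_ge0.
have w0 (z t : R) : 0 < z -> 0 <= w z t.
  by move=> z0; rewrite mulr_ge0 ?expR_ge0 ?pk0.
have c0 (z : R) : 0 < z -> 0 <= 2 / Gamma z * expR 1.
  by move=> z0; rewrite mulr_ge0 ?expR_ge0// divr_ge0// ltW// Gamma_gt0.
apply: (@L1_le _ _ (fun s => (2 / Gamma a * expR 1) * w b s +
                           (2 / Gamma b * expR 1) * w a (1 - s))).
- apply: measurable_funM; last exact: measurable_power_kernel.
  apply: measurableT_comp; first exact: measurable_power_kernel.
  by apply: measurable_funB => //; exact: measurable_cst.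
- move=> s; rewrite ger0_norm ?mulr_ge0 ?pk0//.
  have [s0|s0] := leP s 0.
    by rewrite [X in _ * X]power_kernel0// mulr0 addr_ge0// mulr_ge0 ?c0 ?w0.
  have [s1|s1] := leP 1 s.
    by rewrite power_kernel0 ?mul0r ?subr_le0// addr_ge0// mulr_ge0 ?c0 ?w0.
  have A0 : 0 <= 2 / Gamma a * expR 1 * w b s by rewrite mulr_ge0 ?c0 ?w0.
  have B0 : 0 <= 2 / Gamma b * expR 1 * w a (1 - s).
    by rewrite mulr_ge0 ?c0 ?w0.
  have [s2|s2] := leP s 2^-1.
    apply: (@le_trans _ _ (2 / Gamma a * expR 1 * w b s)); last by rewrite lerDl.
    rewrite -mulrA; apply: ler_pM; [exact: pk0|exact: pk0| |].
    - by apply: le2 => //; apply/andP; split; lra.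
    - by apply: pw => //; lra.
  apply: (@le_trans _ _ (2 / Gamma b * expR 1 * w a (1 - s))); last by rewrite lerDr.
  rewrite mulrC -mulrA; apply: ler_pM; [exact: pk0|exact: pk0| |].
  - by apply: le2 => //; apply/andP; split; lra.
  - by apply: pw => //; lra.
- by apply: L1D; apply: L1Z; [exact: wL|apply: L1_rsub; exact: wL].
Qed.

Let scale_integrand (a b t u : R) : 0 < t ->
  power_kernel a (t - t * u) * power_kernel b (t * u) =
  t `^ (a + b - 1) / t * (power_kernel a (1 - u) * power_kernel b u).
Proof.
move=> t0; rewrite -{1}(mulr1 t) -mulrBr !power_kernel_scale// mulrACA.
congr (_ * _); rewrite !powR_subr1// powRDgt0//; field; rewrite gt_eqF//.
Qed.

Lemma power_kernel_conv_L1 (a b t : R) : 0 < a -> 0 < b ->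
  L1 (fun s => power_kernel a (t - s) * power_kernel b s).
Proof.
move=> a0 b0; have [t0|t0] := ltP 0 t; last first.
  rewrite (_ : (fun _ => _) = (fun=> 0)); first exact: L10.
  apply/funext => s; have [s0|s0] := leP s 0.
    by rewrite [X in _ * X]power_kernel0 ?mulr0.
  by rewrite power_kernel0 ?mul0r//; lra.
have it0 : 0 < t^-1 by rewrite invr_gt0.
have := L1_affine 0 it0 (L1Z (t `^ (a + b - 1) / t) (power_kernel_conv_L1_1 a0 b0)).
congr L1; apply/funext => s; rewrite addr0 -scale_integrand//.
by rewrite mulVKf ?gt_eqF.
Qed.

(** By homogeneity the two sides are proportional. The constant, a Beta integral, need not be
    computed: the Laplace transforms of all kernels at p = 1 equal 1. *)
Lemma power_kernel_conv (a b : R) : 0 < a -> 0 < b ->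
  conv (power_kernel a) (power_kernel b) = power_kernel (a + b).
Proof.
move=> a0 b0; have ab0 : 0 < a + b by rewrite addr_gt0.
pose B := \int[mu]_s (power_kernel a (1 - s) * power_kernel b s).
have E t : conv (power_kernel a) (power_kernel b) t =
    (B * Gamma (a + b)) * power_kernel (a + b) t.
  rewrite /conv; have [t0|t0] := ltP 0 t; last first.
    rewrite [X in _ = _ * X]power_kernel0// mulr0.
    rewrite (_ : (fun s => _) = (fun=> 0)) ?Rintegral_cst ?mul0r//.
    apply/funext => s; have [s0|s0] := leP s 0.
      by rewrite [X in _ * X]power_kernel0 ?mulr0.
    by rewrite power_kernel0 ?mul0r//; lra.
  have h := power_kernel_conv_L1 t a0 b0.
  apply: (@mulfI _ t^-1); first by rewrite invr_neq0 ?gt_eqF.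
  rewrite -(Rintegral_affine 0 t0 h).
  under eq_Rintegral do rewrite addr0 scale_integrand//.
  rewrite RintegralZl//; last exact: power_kernel_conv_L1_1.
  rewrite -/B /power_kernel onposE//; field.
  by rewrite !gt_eqF// Gamma_gt0.
have me : measurable_fun [set: R] (fun t : R => expR (- (1 * t))).
  by apply: measurable_for_continuous => t; cont.
have eb t : `|expR (- (1 * t)) : R| <= expR (- (1 * t)) by rewrite ger0_norm ?expR_ge0.
have [_ L] := laplace_conv me (measurable_power_kernel a)
  (measurable_power_kernel b) eb (power_kernel_laplace a0 ltr01).1
  (power_kernel_laplace b0 ltr01).1 (fun t => power_kernel_conv_L1 t a0 b0).
have {}L : B * Gamma (a + b) = 1.
  move: L; under eq_Rintegral do rewrite E mulrCA.
  rewrite RintegralZl//; last exact: (power_kernel_laplace ab0 ltr01).1.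
  rewrite (power_kernel_laplace ab0 ltr01).2 powR1 mulr1 => ->.
  under eq_Rintegral => s _.
    under eq_Rintegral => t _ do
      rewrite mulrDr opprD expRD mulrACA mulrC.
    rewrite RintegralZl//; last exact: (power_kernel_laplace a0 ltr01).1.
    rewrite (power_kernel_laplace a0 ltr01).2 powR1 mulr1.
    over.
  by rewrite (power_kernel_laplace b0 ltr01).2 powR1.
by apply/funext => t; rewrite E L mul1r.
Qed.

(** Associativity of convolution by Fubini. The inner convolution is required only at r < t, since
    the outer kernel vanishes beyond. *)
Lemma conv_power_kernelA (a b t : R) h : 0 < a -> 0 < b ->
  measurable_fun setT h ->
  L1 (fun s => power_kernel (a + b) (t - s) * h s) ->
  (forall r, r < t -> L1 (fun s => power_kernel b (r - s) * h s)) ->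
  L1 (fun r => power_kernel a (t - r) * conv (power_kernel b) h r) /\
  conv (power_kernel a) (conv (power_kernel b) h) t =
    conv (power_kernel (a + b)) h t.
Proof.
move=> a0 b0 mh hab hb.
pose F (z : R * R) :=
  power_kernel a (t - z.1) * (power_kernel b (z.1 - z.2) * h z.2).
pose G s := `|power_kernel (a + b) (t - s) * h s|.
have pk s : L1 (fun r => power_kernel a (t - r) * power_kernel b (r - s)).
  have := L1_shift (- s) (power_kernel_conv_L1 (t - s) a0 b0).
  by congr L1; apply/funext => r; congr (power_kernel a _ * _); ring.
have ipk s : \int[mu]_r (power_kernel a (t - r) * power_kernel b (r - s)) =
    power_kernel (a + b) (t - s).
  rewrite -(power_kernel_conv a0 b0) /conv.
  rewrite -(Rintegral_shift (- s) (power_kernel_conv_L1 (t - s) a0 b0)).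
  by apply: eq_Rintegral => r _; congr (power_kernel a _ * _); ring.
have mF : measurable_fun setT F.
  apply: (@measurable_conv_integrand (power_kernel b) h
    (fun r => power_kernel a (t - r))) => //; first exact: measurable_power_kernel.
  apply: measurableT_comp; first exact: measurable_power_kernel.
  by apply: measurable_funB => //; exact: measurable_cst.
have FL s : L1 (fun r => F (r, s)).
  have := L1Z (h s) (pk s); congr L1; apply/funext => r; rewrite /F/=; ring.
have FG s : \int[mu]_r `|F (r, s)| <= G s.
  rewrite /G normrM ger0_norm ?power_kernel_ge0 ?addr_gt0// -ipk mulrC.
  rewrite -RintegralZl//; last exact: pk.
  apply: le_Rintegral => //.
  - exact: L1_normr (FL s).
  - exact: L1Z.
  - move=> r _; rewrite /F/= !normrM !(ger0_norm (power_kernel_ge0 _ _))//.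
    by rewrite mulrA mulrC.
have [L1x _ E] := fubini_line mF FL (L1_normr hab) FG.
have cE r : \int[mu]_s F (r, s) = power_kernel a (t - r) * conv (power_kernel b) h r.
  have [rt|tr] := ltP r t; first by rewrite /F/= RintegralZl//; exact: hb.
  rewrite power_kernel0 ?subr_le0// mul0r -[RHS](mul0r (fine (mu setT))).
  rewrite -Rintegral_cst//; apply: eq_Rintegral => s _.
  by rewrite /F/= power_kernel0 ?subr_le0// mul0r.
split; first by move: L1x; congr L1; apply/funext.
rewrite {1}/conv; under eq_Rintegral do rewrite -cE.
rewrite E /conv; apply: eq_Rintegral => s _.
rewrite -ipk mulrC -RintegralZl//; last exact: pk.
apply: eq_Rintegral => r _.
by rewrite /F/=; ring.
Qed.

End Convolution.

(** * The Caputo derivative as a convolution *)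

Section CaputoPrimitive.
Variable R : realType.
Local Notation mu := (@lebesgue_measure R).
Implicit Types (f g h F : R -> R).

(** A second derivative is integrable on bounded intervals only, so convolutions use its truncation
    at a time beyond the one of interest. *)
Definition truncate (T : R) f : R -> R := f \_ `]0, T[.

Lemma truncateE (T : R) f s : 0 < s < T -> truncate T f s = f s.
Proof. by move=> sT; rewrite /truncate patchE mem_set//= in_itv. Qed.

Lemma truncate_eq0 (T : R) f s : ~~ (0 < s < T) -> truncate T f s = 0.
Proof.
move=> sT; rewrite /truncate patchE memNset//= in_itv/=.
exact/negP.
Qed.

Lemma L1_truncateP (T : R) f :
  L1 (truncate T f) <-> mu.-integrable `]0, T[ (EFin \o f).
Proof. by rewrite /L1 /truncate -restrict_EFin -integrable_mkcond. Qed.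

Lemma Rintegral_truncate (T : R) f :
  \int[mu]_(s in `]0, T[) f s = \int[mu]_s truncate T f s.
Proof. by rewrite Rintegral_mkcond. Qed.

(** Integrability of the derivative up to 0 extends the primitive continuously to 0; this is what
    gives f' its limit at 0. *)
Lemma primitive_cvg_at_right f F (T : R) : 0 < T ->
  L1 (truncate T f) ->
  (forall s : R, 0 < s <= T -> {for s, continuous f}) ->
  (forall s : R, 0 < s <= T -> is_derive s 1 F (f s)) ->
  F x @[x --> 0^'+] --> F T - \int[mu]_s truncate T f s.
Proof.
move=> T0 fL cf dF; apply/cvg_at_rightP => u [u0 cu].
pose fn n : R -> R := truncate T f \_ `[u n, T[.
have [| | | |_ cI] := @dominated_cvg_line _ fn (truncate T f)
    (fun x => `|truncate T f x|).
- move=> n; apply/(measurable_restrictT _ _).1; first exact: measurable_itv.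
  exact: measurable_funTS (L1_measurable fL).
- move=> x; apply: cvg_near_cst.
  have [xT|xT] := boolP (0 < x < T); last first.
    by near=> n; rewrite /fn patchE truncate_eq0//; case: ifP.
  have /andP[x0 x1] := xT.
  near=> n; rewrite /fn patchE mem_set//= in_itv/= x1 andbT ltW//.
  by near: n; exact: (cvgr_lt _ cu).
- by move=> n x; rewrite /fn patchE; case: ifP => //; rewrite normr0.
- exact: L1_normr.
have {cI} : F T - \int[mu]_x fn n x @[n --> \oo] -->
    F T - \int[mu]_s truncate T f s.
  by apply: cvgB => //; exact: cvg_cst.
apply: cvg_trans; apply: near_eq_cvg; near=> n.
have uT : u n < T by near: n; exact: (cvgr_lt _ cu).
have [|||iF EF] := @FTC2_closed _ f F (u n) T => //.
- by move=> x /andP[ux xT]; apply: dF; rewrite xT (lt_le_trans (u0 n)).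
- by move=> x /andP[ux xT]; apply: cf; rewrite xT (lt_le_trans (u0 n)).
rewrite /fn -Rintegral_mkcond.
have -> : \int[mu]_(x in `[u n, T[) truncate T f x = F T - F (u n).
  rewrite -[RHS]/(fine (_%:E)) -EF -[RHS]/(\int[mu]_(x in `[u n, T]) f x).
  rewrite -Rintegral_itv_bndo_bndc; last first.
    by apply: integrableS iF => //; apply: subset_itvl; rewrite bnd_simp.
  apply: eq_Rintegral => x; rewrite inE/= in_itv/= => /andP[ux xT].
  by rewrite truncateE// xT (lt_le_trans (u0 n)).
by rewrite opprB addrC subrK.
Unshelve. all: end_near. Qed.

(** Integration by parts, in the form of the fundamental theorem applied to - t^z e^{-t}, which
    vanishes at both ends. *)
Lemma Gamma_succ (z : R) : 0 < z -> Gamma (z + 1) = z * Gamma z.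
Proof.
move=> z0; have z10 : 0 < z + 1 by rewrite addr_gt0.
have [C C0 hC] := @powR_le_expR R z 2^-1 (ltW z0) (ltac:(by [])).
pose f (t : R) := t `^ (z + 1 - 1) * expR (- t) - z * (t `^ (z - 1) * expR (- t)).
have fE : onpos f = (fun t =>
    onpos (fun t => t `^ (z + 1 - 1) * expR (- t)) t -
    z * onpos (fun t => t `^ (z - 1) * expR (- t)) t).
  by apply/funext => t; rewrite /onpos; case: ifP; rewrite ?mulr0 ?subr0.
have fL : L1 (onpos f).
  by rewrite fE; apply: L1B; [exact: L1_Gamma|apply: L1Z; exact: L1_Gamma].
have : \int[mu]_t onpos f t = 0 - 0.
  apply: (@Rintegral_onpos_primitive _ _ (fun t => - (t `^ z * expR (- t)))) => //.
  - by move=> t t0; rewrite /f; cont.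
  - move=> t t0; apply: der_eq (der_opp (der_mul (der_powR z t0 (der_id t))
      (der_expR (der_opp (der_id t))))) _.
    by rewrite /f addrK; ring.
  - rewrite -[X in _ --> X]oppr0; apply: cvgN; rewrite -[X in _ --> X](mul0r (expR (- 0))).
    apply: cvgM; first exact: powR_cvg0.
    apply: cvg_at_right_filter.
    by have : {for (0:R), continuous (fun t => expR (- t))} by cont.
  - rewrite -[X in _ --> X]oppr0; apply: cvgN.
    apply: (@squeeze_cvgr _ _ _ _ (cst 0) (fun t => C * expR (- (2^-1 * t)))).
    + near=> t; have t0 : 0 < t by near: t; exact: nbhs_pinfty_gt.
      rewrite mulr_ge0 ?powR_ge0 ?expR_ge0//=.
      apply: le_trans (ler_wpM2r (expR_ge0 _) (hC t t0)) _.
      by rewrite -mulrA -expRD; apply: ler_wpM2l; [exact: ltW|rewrite ler_expR; lra].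
    + exact: cvg_cst.
    + rewrite -[X in _ --> X](mulr0 C); apply: cvgM; first exact: cvg_cst.
      have h : (2^-1 * t : R) @[t --> +oo] --> +oo by apply: gt0_cvgMry => //; exact: cvg_id.
      exact: (cvg_comp _ _ h (@cvgr_expR R)).
rewrite fE RintegralB//; [|exact: L1_Gamma|apply: L1Z; exact: L1_Gamma].
rewrite RintegralZl//; last exact: L1_Gamma.
by rewrite -!GammaE subr0 => /eqP; rewrite subr_eq0 => /eqP.
Unshelve. all: end_near. Qed.

Lemma Gamma1 : Gamma 1 = 1 :> R.
Proof.
rewrite GammaE -[RHS]opprK -[RHS]sub0r.
apply: (@Rintegral_onpos_primitive R (fun t => t `^ (1 - 1) * expR (- t))
  (fun t => - expR (- t)) (- 1) 0).
- exact: L1_Gamma.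
- by move=> t t0; cont.
- move=> t t0; apply: der_eq (der_opp (der_expR (der_opp (der_id t)))) _.
  by rewrite subrr powRr0; ring.
- apply: cvgN; apply: cvg_at_right_filter.
  have : {for (0:R), continuous (fun t => expR (- t))} by cont.
  by rewrite /prop_for/continuous_at oppr0 expR0.
- by rewrite -[X in _ --> X]oppr0; apply: cvgN; exact: cvgr_expR.
Qed.

Lemma Gamma2 : Gamma 2 = 1 :> R.
Proof. by rewrite (Gamma_succ ltr01) Gamma1 mulr1. Qed.

Lemma power_kernel2 (t : R) : 0 < t -> power_kernel 2 t = t.
Proof.
move=> t0; rewrite /power_kernel onposE// Gamma2 invr1 mul1r.
by rewrite (_ : 2 - 1 = 1) ?powRr1 ?ltW//; lra.
Qed.

(** On the first half of ]0, r[ the kernel is bounded and [h] is integrable; on the second half [h]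
    is bounded and the kernel is integrable. *)
Lemma power_kernel_conv_bounded (z r M : R) h : 0 < z -> measurable_fun setT h ->
  (forall s, s <= 0 -> h s = 0) ->
  L1 (truncate r h) -> (forall s, r / 2 <= s < r -> `|h s| <= M) ->
  L1 (fun s => power_kernel z (r - s) * h s).
Proof.
move=> z0 mh h0 hL hM.
pose w (u : R) := expR (- (1 * u)) * power_kernel z u : R.
have wL : L1 w := (power_kernel_laplace z0 ltr01).1.
(* Bound of the kernel on [r / 2, r]. As z - 1 may have either sign, numerator and denominator of
   u^z / u are bounded separately. *)
pose C := (Gamma z)^-1 * (r `^ z / (r / 2)).
apply: (@L1_le _ _ (fun s => C * `|truncate r h s| +
    (`|M| * expR r) * w (r - s))).
- apply: measurable_funM => //.
  apply: measurableT_comp; first exact: measurable_power_kernel.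
  by apply: measurable_funB => //; exact: measurable_cst.
- have Gz := Gamma_gt0 z0.
  move=> s; rewrite normrM ger0_norm ?power_kernel_ge0//.
  have B0 : 0 <= `|M| * expR r * w (r - s).
    by rewrite !mulr_ge0 ?expR_ge0 ?power_kernel_ge0.
  have [s0|s0] := leP s 0.
    rewrite h0// normr0 mulr0 truncate_eq0 ?normr0 ?mulr0 ?add0r//.
    by rewrite ltNge s0.
  have [sr|sr] := leP r s.
    rewrite power_kernel0 ?subr_le0// mul0r truncate_eq0 ?normr0 ?mulr0 ?add0r//.
    by rewrite s0/= -leNgt.
  have r0 : 0 < r := lt_trans s0 sr.
  have C0 : 0 <= C.
    by rewrite /C !mulr_ge0 ?invr_ge0 ?powR_ge0 ?(ltW Gz) ?mulr_ge0 ?(ltW r0)// invr_ge0.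
  rewrite truncateE ?s0//.
  have [s2|s2] := ltP s (r / 2).
    apply: (@le_trans _ _ (C * `|h s|)); last by rewrite lerDl.
    rewrite ler_wpM2r// /C /power_kernel onposE ?subr_gt0//.
    have rs0 : 0 < r - s by rewrite subr_gt0.
    rewrite ler_wpM2l ?invr_ge0 ?(ltW Gz)// powR_subr1//.
    apply: ler_pM; rewrite ?powR_ge0 ?invr_ge0 ?(ltW rs0)//.
      by rewrite ge0_ler_powR ?nnegrE ?(ltW z0) ?(ltW rs0) ?(ltW r0)//; lra.
    by rewrite lef_pV2 ?posrE//; lra.
  apply: (@le_trans _ _ (`|M| * expR r * w (r - s))); last first.
    by rewrite lerDr mulr_ge0.
  rewrite mulrC -mulrA; apply: ler_pM; rewrite ?power_kernel_ge0//.
    by rewrite (le_trans (hM s _)) ?ler_norm// s2.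
  rewrite /w mulrA -expRD ler_peMl ?power_kernel_ge0//.
  by rewrite (le_trans _ (expR_ge1Dx _))//; lra.
- apply: L1D; first by apply: L1Z; exact: L1_normr.
  by apply: L1Z; exact: L1_rsub.
Qed.

(** At r < T the kernel sees f'' on ]0, r[ only, so truncating at T does not affect the value. Near
    r continuity bounds f'', while near 0 it is merely integrable. *)
Lemma caputo_conv (alpha T r : R) f : 1 < alpha -> alpha < 2 ->
  caputo_differentiable f -> 0 < T -> r < T ->
  L1 (fun s => power_kernel (2 - alpha) (r - s) * truncate T f^`(2)%classic s) /\
  conv (power_kernel (2 - alpha)) (truncate T f^`(2)%classic) r = onpos (caputo alpha f) r.
Proof.
move=> a1 a2 [cf df f2L] T0 rT.
have b0 : 0 < 2 - alpha by lra.
have c2 (s : R) : 0 < s -> {for s, continuous f^`(2)%classic} by move=> /df[].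
pose h := truncate T f^`(2)%classic.
have pos_h s : s <= 0 -> h s = 0 by move=> s0; rewrite /h truncate_eq0// ltNge s0.
have hLT : L1 h by apply/L1_truncateP; exact: f2L.
have mh := L1_measurable hLT.
have pkL : L1 (fun s => power_kernel (2 - alpha) (r - s) * h s).
  have [M hM] : exists M : R, forall s, r / 2 <= s < r -> `|h s| <= M.
    have [r0|r0] := ltP 0 r; last first.
      by exists 0 => s /andP[_ sr]; rewrite pos_h ?normr0//; lra.
    have [| |c _ cM] := @EVT_max R (fun s => `|f^`(2)%classic s|) (r / 2) r.
    - lra.
    - apply: continuous_in_subspaceT => x /[!inE]/=.
      rewrite in_itv/= => /andP[x1 _]; apply: cont_normr; apply: c2; lra.
    exists `|f^`(2)%classic c| => s /andP[s1 s2].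
    rewrite /h truncateE; last by apply/andP; split; lra.
    by apply: cM; rewrite in_itv/= s1 ltW.
  apply: (power_kernel_conv_bounded b0 mh pos_h _ hM).
  apply: L1_le (L1_normr hLT) => [|x].
    apply/(measurable_restrictT _ _).1; first exact: measurable_itv.
    exact: measurable_funTS.
  by rewrite /truncate patchE; case: ifP => //; rewrite normr0.
split=> //.
have [r0|r0] := ltP 0 r; last first.
  rewrite onpos0// /conv -[RHS](mul0r (fine (mu setT))) -Rintegral_cst//.
  apply: eq_Rintegral => s _; rewrite -/h; have [s0|s0] := leP s 0; first by rewrite pos_h ?mulr0.
  by rewrite power_kernel0 ?mul0r//; lra.
rewrite onposE// /caputo Rintegral_truncate /conv.
have G0 : Gamma (2 - alpha) != 0 by rewrite gt_eqF// Gamma_gt0.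
have E s : truncate r (fun s => (r - s) `^ (1 - alpha) * f^`(2)%classic s) s =
    Gamma (2 - alpha) * (power_kernel (2 - alpha) (r - s) * h s).
  have [sr|sr] := boolP (0 < s < r); last first.
    rewrite truncate_eq0//; have [s0|s0] := leP s 0.
      by rewrite -/h pos_h ?mulr0.
    by rewrite power_kernel0 ?mul0r ?mulr0// subr_le0 leNgt; move: sr; rewrite s0.
  have /andP[s0 s1] := sr.
  rewrite /h !truncateE//; last by rewrite s0 (lt_trans s1 rT).
  rewrite /power_kernel onposE ?subr_gt0// !mulrA mulfV// mul1r.
  by congr (_ `^ _ * _); ring.
under [in RHS]eq_Rintegral do rewrite E.
by rewrite RintegralZl ?mulrA ?mulVf ?mul1r//; exact: pkL.
Qed.

(** The kernels of orders alpha and 2 - alpha convolve to that of order 2, so the fractional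
    integral of D^alpha f is the integral of (t - s) f''(s), the remainder of Taylor's formula at
    order one. *)
Lemma caputo_primitive (alpha : R) f g : 1 < alpha -> alpha < 2 ->
  caputo_differentiable f -> (forall t : R, 0 < t -> caputo alpha f t = g t) ->
  exists2 f1 : R, f^`()%classic @ 0^'+ --> f1 &
    forall t : R, 0 < t -> f t = f 0 + f1 * t + conv (power_kernel alpha) (onpos g) t.
Proof.
move=> a1 a2 dcf Dfg; have [cf df f2L] := dcf.
have b0 : 0 < 2 - alpha by lra. have a0 : 0 < alpha by lra.
have der1 (s : R) : 0 < s -> is_derive s 1 f (f^`()%classic s).
  by move=> /df[d _ _]; rewrite derive1E; exact: DeriveDef.
have der2 (s : R) : 0 < s -> is_derive s 1 f^`()%classic (f^`(2)%classic s).
  by move=> /df[_ d _]; rewrite /= derive1E; exact: DeriveDef.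
have c2 (s : R) : 0 < s -> {for s, continuous f^`(2)%classic} by move=> /df[].
have f20 : f x @[x --> 0^'+] --> f 0 by have [_] := (continuous_within_itvcyP 0 f).1 cf.
have hL (T : R) : 0 < T -> L1 (truncate T f^`(2)%classic).
  by move=> T0; apply/L1_truncateP; exact: f2L.
pose f1 := f^`()%classic 1 - \int[mu]_s truncate 1 f^`(2)%classic s.
have cf1 : f^`()%classic @ 0^'+ --> f1.
  apply: (@primitive_cvg_at_right f^`(2)%classic f^`()%classic 1 ltr01 (hL 1 ltr01)).
  - by move=> s /andP[s0 _]; exact: c2.
  - by move=> s /andP[s0 _]; exact: der2.
exists f1 => // t t0.
pose T := t + 1; pose h := truncate T f^`(2)%classic.
have T0 : 0 < T by rewrite /T; lra.
have pos_h s : s <= 0 -> h s = 0 by move=> s0; rewrite /h truncate_eq0// ltNge s0.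
have hLT : L1 h := hL T T0.
have mh := L1_measurable hLT.
have conv_h r : r < T -> conv (power_kernel (2 - alpha)) h r = onpos g r.
  move=> rT; have [_ ->] := caputo_conv a1 a2 dcf T0 rT.
  by rewrite /onpos; case: ifP => // r0; rewrite Dfg.
have tT : t < T by rewrite /T; lra.
(* A primitive of [k], equal to f(t) at t and tending to t f'(0) + f(0) at 0. *)
pose F s := (t - s) * f^`()%classic s + f s.
pose k s := (t - s) * f^`(2)%classic s.
have E2 s : power_kernel 2 (t - s) * h s = truncate t k s.
  have [st|st] := boolP (0 < s < t); last first.
    rewrite [RHS]truncate_eq0//; have [s0|s0] := leP s 0.
      by rewrite pos_h ?mulr0.
    by rewrite power_kernel0 ?mul0r ?mulr0// subr_le0 leNgt; move: st; rewrite s0.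
  have /andP[s0 s1] := st.
  rewrite /h !truncateE//; last by rewrite s0 (lt_trans s1 tT).
  by rewrite power_kernel2// subr_gt0.
have kL : L1 (truncate t k).
  apply: L1_le (L1Z t (L1_normr hLT)).
    rewrite -(funext E2); apply: measurable_funM => //.
    apply: measurableT_comp; first exact: measurable_power_kernel.
    by apply: measurable_funB => //; exact: measurable_cst.
  move=> s; have [st|st] := boolP (0 < s < t); last first.
    by rewrite truncate_eq0// normr0 mulr_ge0// ltW.
  have /andP[s0 s1] := st.
  rewrite /h !truncateE//; last by rewrite s0 (lt_trans s1 tT).
  by rewrite /k normrM ler_wpM2r// ger0_norm; lra.
have dF (s : R) : 0 < s -> is_derive s 1 F (k s).
  move=> s0; apply: der_eq (der_add (der_mul (der_sub (der_cst s t) (der_id s))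
    (der2 s s0)) (der1 s s0)) _.
  by rewrite /k; ring.
have FL : F x @[x --> 0^'+] --> F t - \int[mu]_s truncate t k s.
  apply: (@primitive_cvg_at_right k F t t0 kL) => s /andP[s0 _]; last exact: dF.
  by rewrite /k; cont; exact: c2.
have FL' : F x @[x --> 0^'+] --> (t - 0) * f1 + f 0.
  apply: cvgD => //; apply: cvgM => //; apply: cvgB; first exact: cvg_cst.
  by apply: cvg_at_right_filter; exact: cvg_id.
have E3 : F t - \int[mu]_s truncate t k s = (t - 0) * f1 + f 0.
  exact: (cvg_unique _ FL FL').
have aE : alpha + (2 - alpha) = 2 by ring.
have [_ EA] := @conv_power_kernelA R alpha (2 - alpha) t h a0 b0 mh
  (ltac:(rewrite aE (funext E2); exact: kL))
  (fun r rt => (caputo_conv a1 a2 dcf T0 (lt_trans rt tT)).1).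
have -> : conv (power_kernel alpha) (onpos g) t = \int[mu]_s truncate t k s.
  transitivity (conv (power_kernel 2) h t); last by apply: eq_Rintegral.
  move: EA; rewrite aE => <-.
  apply: eq_Rintegral => s _; have [sT|sT] := ltP s T; first by rewrite conv_h.
  by rewrite power_kernel0 ?mul0r//; lra.
by move: E3; rewrite /F subrr mul0r add0r subr0 => /eqP; rewrite subr_eq => /eqP->; ring.
Qed.
End CaputoPrimitive.

(** * Polar calculus and rotation of rays *)

Section RayIntegral.
Variable R : realType.
Local Notation mu := (@lebesgue_measure R).

(** Cauchy's theorem in real form: [q] is both the angular derivative of [P] and the radial
    derivative of [Q], so the angular derivative of the integral of [P] is the difference of the
    limits of [Q], which is zero. *)
Lemma ray_integral_const (P Q q : R -> R -> R) (dom : R -> R) (u v a b : R) :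
  u < a < v -> u < b < v ->
  (forall r x : R, 0 < r -> u < x < v -> is_derive x 1 (P r) (q r x)) ->
  (forall r x : R, 0 < r -> u < x < v -> is_derive r 1 (Q ^~ x) (q r x)) ->
  (forall r x : R, 0 < r -> u < x < v -> {for r, continuous (q ^~ x)}) ->
  (forall r x : R, 0 < r -> u < x < v -> {for r, continuous (P ^~ x)}) ->
  (forall r x : R, 0 < r -> u < x < v -> `|q r x| <= dom r) ->
  (forall r x : R, 0 < r -> u < x < v -> `|P r x| <= dom r) ->
  L1 (onpos dom) ->
  (forall x, u < x < v -> Q ^~ x @ 0^'+ --> (0 : R)) ->
  (forall x, u < x < v -> Q ^~ x @ +oo --> (0 : R)) ->
  \int[mu]_r onpos (P ^~ a) r = \int[mu]_r onpos (P ^~ b) r.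
Proof.
move=> ua ub dP dQ cq cP qdom Pdom domL Q0 Qoo.
have PL x : u < x < v -> L1 (onpos (P ^~ x)).
  move=> ux; apply: L1_onpos_le domL => [t t0|t t0]; first exact: cP.
  exact: Pdom.
have qL x : u < x < v -> L1 (onpos (q ^~ x)).
  move=> ux; apply: L1_onpos_le domL => [t t0|t t0]; first exact: cq.
  exact: qdom.
pose F (x : R) := \int[mu]_r onpos (P ^~ x) r.
have FE : F = fun x => \int[mu]_(r in `]0, +oo[) P r x.
  by apply/funext => x; rewrite Rintegral_onpos.
have dF (x : R) : u < x < v -> is_derive x 1 F 0.
  move=> ux.
  have dP1 (r y : R) : 0 < r -> u < y < v -> partial1of2 (fun z s => P s z) y r = q r y.
    move=> r0 uy; rewrite partial1of2E.
    exact: (@derive_val _ _ _ _ _ _ _ (dP r y r0 uy)).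
  (* Differentiation under the integral requires a bound that is nonnegative everywhere, whereas
     [dom] is controlled for r > 0 only. *)
  pose G (r : R) := Num.max 0 (dom r).
  have h1 : forall y : R, `]u, v[%classic y ->
      mu.-integrable `]0, +oo[ (EFin \o (fun r => P r y)).
    by move=> y; rewrite /= in_itv/= => uy; apply/L1_onposP; exact: PL.
  have h2 : forall y r : R, `]u, v[%classic y -> `]0, +oo[%classic r ->
      derivable (fun z => P r z) y 1.
    move=> y r; rewrite /= !in_itv/= andbT => uy r0.
    by have [] := dP r y r0 uy.
  have h3 (r : R) : 0 <= G r by rewrite /G le_max lexx.
  have h4 : mu.-integrable `]0, +oo[ (EFin \o G).
    apply/L1_onposP; apply: L1_le (L1_normr domL).
      have -> : onpos G = fun r => Num.max 0 (onpos dom r).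
        by apply/funext => r; rewrite /onpos; case: ifP => //; rewrite maxxx.
      by apply: measurable_maxr => //; exact: L1_measurable.
    move=> r; rewrite !normr_onpos; apply: onpos_le => y y0.
    by rewrite /G ger0_norm ?le_max ?lexx// ge_max normr_ge0 ler_norm.
  have h5 : forall y r : R, `]u, v[%classic y -> `]0, +oo[%classic r ->
      `|partial1of2 (fun z s => P s z) y r| <= G r.
    move=> y r; rewrite /= !in_itv/= andbT => uy r0.
    by rewrite dP1// le_max qdom ?orbT.
  have Ix : `]u, v[%classic x by rewrite /= in_itv.
  have m0 : measurable (`]0, +oo[ : set R) by exact: measurable_itv.
  have D := @derivable_under_integral R _ (measurableTypeR R) mu
    (fun z s => P s z) _ m0 x u v Ix h1 h2 G h3 h4 h5.
  have E := @differentiation_under_integral R _ (measurableTypeR R) mu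
    (fun z s => P s z) _ m0 x u v Ix h1 h2 G h3 h4 h5.
  rewrite FE; have : \int[mu]_(r in `]0, +oo[) (partial1of2 (fun z s => P s z)^~ r) x = 0.
    transitivity (\int[mu]_(r in `]0, +oo[) q r x).
      apply: eq_Rintegral => r; rewrite inE/= in_itv/= andbT => r0.
      exact: dP1.
    rewrite Rintegral_onpos -[RHS](subrr 0).
    apply: (@Rintegral_onpos_primitive R (q ^~ x) (Q ^~ x) 0 0 (qL x ux)).
    - by move=> r r0; exact: cq.
    - by move=> r r0; exact: dQ.
    - exact: Q0.
    - exact: Qoo.
  move=> E0; rewrite E0 in E.
  by apply: (DeriveDef D); rewrite -derive1E; exact: E.
suff h (x y : R) : u < x < v -> u < y < v -> x <= y -> F x = F y.
  by case: (leP a b) => [ab|/ltW ba]; [exact: h|apply/esym; exact: h].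
move=> /andP[ux xv] /andP[uy yv]; rewrite le_eqVlt => /predU1P[->//|xy].
have [||c _] := @MVT R F (fun=> 0) x y xy.
- move=> z; rewrite in_itv/= => /andP[z1 z2]; apply: dF.
  by rewrite (lt_trans ux z1) (lt_trans z2 yv).
- apply: continuous_in_subspaceT => z /[!inE]/=; rewrite in_itv/= => /andP[z1 z2].
  apply: der_continuous (dF z _).
  by rewrite (lt_le_trans ux z1) (le_lt_trans z2 yv).
by rewrite mul0r => /eqP; rewrite subr_eq0 => /eqP.
Qed.

End RayIntegral.

(** * Complex functions in polar coordinates and their Cauchy-Riemann equations *)

Section PolarCalculus.
Variable R : realType.
Local Notation Re := (@complex.Re R).
Local Notation Im := (@complex.Im R).
Local Notation normc := (@ComplexField.Normc.normc R).
Local Notation "x %:C" := (real_complex R x).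
Implicit Types (z w : R[i]).

Lemma ReD z w : Re (z + w) = Re z + Re w. Proof. by case: z; case: w. Qed.
Lemma ImD z w : Im (z + w) = Im z + Im w. Proof. by case: z; case: w. Qed.
Lemma ReN z : Re (- z) = - Re z. Proof. by case: z. Qed.
Lemma ImN z : Im (- z) = - Im z. Proof. by case: z. Qed.
Lemma ReM z w : Re (z * w) = Re z * Re w - Im z * Im w.
Proof. by case: z; case: w. Qed.
Lemma ImM z w : Im (z * w) = Re z * Im w + Im z * Re w.
Proof. by case: z => a b; case: w. Qed.
Lemma ReV z : Re z^-1 = Re z / (Re z ^+ 2 + Im z ^+ 2).
Proof. by case: z. Qed.
Lemma ImV z : Im z^-1 = - (Im z / (Re z ^+ 2 + Im z ^+ 2)).
Proof. by case: z. Qed.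
Lemma ReVM z : Re z^-1 = Re z / (Re z * Re z + Im z * Im z).
Proof. by rewrite ReV !expr2. Qed.
Lemma ImVM z : Im z^-1 = - (Im z / (Re z * Re z + Im z * Im z)).
Proof. by rewrite ImV !expr2. Qed.
Lemma ReR (a : R) : Re a%:C = a. Proof. by []. Qed.
Lemma ImR (a : R) : Im a%:C = 0. Proof. by []. Qed.

Definition ReIm := (ReD, ImD, ReN, ImN, ReM, ImM, ReR, ImR).

Lemma eqcP z w : Re z = Re w -> Im z = Im w -> z = w.
Proof. by case: z => a b; case: w => c d /= -> ->. Qed.

Lemma sqr_normc z : normc z ^+ 2 = Re z ^+ 2 + Im z ^+ 2.
Proof. by case: z => a b /=; rewrite sqr_sqrtr// addr_ge0 ?sqr_ge0. Qed.

Lemma normc_ge0 z : 0 <= normc z.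
Proof. by case: z => a b; exact: sqrtr_ge0. Qed.

Lemma normcM z w : normc (z * w) = normc z * normc w.
Proof. exact: ComplexField.Normc.normcM. Qed.

Lemma normcV z : normc z^-1 = (normc z)^-1.
Proof. exact: ComplexField.Normc.normcV. Qed.

Lemma normc_eq0 z : (normc z == 0) = (z == 0).
Proof.
apply/eqP/eqP => [/ComplexField.Normc.eq0_normc//|->].
exact: ComplexField.Normc.normc0.
Qed.

Lemma normc_gt0 z : z != 0 -> 0 < normc z.
Proof. by move=> z0; rewrite lt_def normc_eq0 z0 normc_ge0. Qed.

Lemma le_normcD z w : normc (z + w) <= normc z + normc w.
Proof. exact: le_normcD. Qed.

Lemma normcN z : normc (- z) = normc z.
Proof. by case: z => a b /=; rewrite !sqrrN. Qed.

Lemma normcR (a : R) : normc a%:C = `|a|.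
Proof. by rewrite /= expr0n addr0 sqrtr_sqr. Qed.

Lemma normc_Re z : `|Re z| <= normc z.
Proof.
case: z => a b /=; rewrite -sqrtr_sqr ler_wsqrtr// lerDl; exact: sqr_ge0.
Qed.

Lemma normc_Im z : `|Im z| <= normc z.
Proof.
case: z => a b /=; rewrite -sqrtr_sqr ler_wsqrtr// lerDr; exact: sqr_ge0.
Qed.

Lemma normc_le_ReIm z : normc z <= `|Re z| + `|Im z|.
Proof.
rewrite -[leLHS]ger0_norm ?normc_ge0// -ler_sqr ?nnegrE ?addr_ge0//.
rewrite -normrX ger0_norm ?sqr_ge0// sqr_normc sqrrD !real_normK ?num_real//.
by rewrite addrAC lerDl mulrn_wge0// mulr_ge0.
Qed.

Definition cis (x : R) : R[i] := (cos x +i* sin x)%C.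

Lemma cisD x y : cis (x + y) = cis x * cis y.
Proof. by apply: eqcP; rewrite !ReIm /= ?cosD ?sinD; ring. Qed.

Lemma cis0 : cis 0 = 1.
Proof. by rewrite /cis cos0 sin0. Qed.

Lemma normc_cis x : normc (cis x) = 1.
Proof. by rewrite /= cos2Dsin2 sqrtr1. Qed.

Lemma cis_neq0 x : cis x != 0.
Proof. by rewrite -normc_eq0 normc_cis oner_eq0. Qed.

Lemma cisN x : cis (- x) = (cis x)^-1.
Proof. by apply: (mulIf (cis_neq0 x)); rewrite -cisD addNr cis0 mulVf ?cis_neq0. Qed.

(** The power of exponent a on the Riemann surface of the logarithm: the angle is a coordinate and
    is not recovered from the complex number, so that there is no cut. *)
Definition polar_powR (a r x : R) : R[i] := (r `^ a)%:C * cis (a * x).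

Lemma normc_polar_powR a r x : normc (polar_powR a r x) = r `^ a.
Proof. by rewrite /polar_powR normcM normc_cis mulr1 normcR ger0_norm ?powR_ge0. Qed.

Lemma polar_powRD a b r x : 0 < r ->
  polar_powR (a + b) r x = polar_powR a r x * polar_powR b r x.
Proof.
by move=> r0; rewrite /polar_powR powRDgt0// mulrDl cisD rmorphM mulrACA.
Qed.

Definition ccont (f : R -> R[i]) (r : R) :=
  {for r, continuous (fun y => Re (f y))} /\
  {for r, continuous (fun y => Im (f y))}.

(* The variable is r e^{ix}, and the derivative is taken with respect to r: by
   the Cauchy-Riemann equations d/dx = i r d/dr. *)
Definition polar_derive (F F' : R -> R -> R[i]) (r x : R) :=
  [/\ is_derive r 1 (fun y => Re (F y x)) (Re (F' r x)),
      is_derive r 1 (fun y => Im (F y x)) (Im (F' r x)),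
      is_derive x 1 (fun y => Re (F r y)) (- (r * Im (F' r x))),
      is_derive x 1 (fun y => Im (F r y)) (r * Re (F' r x)) &
      ccont (F' ^~ x) r].

Lemma cont_ext (f g : R -> R) r : f =1 g -> {for r, continuous g} ->
  {for r, continuous f}.
Proof. by move=> /funext ->. Qed.

Lemma der_ext (f g : R -> R) (r a : R) : f =1 g -> is_derive r 1 g a ->
  is_derive r 1 f a.
Proof. by move=> /funext ->. Qed.

Lemma ccont_mul f g r : ccont f r -> ccont g r -> ccont (fun y => f y * g y) r.
Proof.
move=> [f1 f2] [g1 g2]; split.
- by apply: cont_ext (fun y => ReM _ _) _; cont.
- by apply: cont_ext (fun y => ImM _ _) _; cont.
Qed.

Lemma ccont_add f g r : ccont f r -> ccont g r -> ccont (fun y => f y + g y) r.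
Proof.
move=> [f1 f2] [g1 g2]; split.
- by apply: cont_ext (fun y => ReD _ _) _; cont.
- by apply: cont_ext (fun y => ImD _ _) _; cont.
Qed.

Lemma ccont_opp f r : ccont f r -> ccont (fun y => - f y) r.
Proof.
move=> [f1 f2]; split.
- by apply: cont_ext (fun y => ReN _) _; cont.
- by apply: cont_ext (fun y => ImN _) _; cont.
Qed.

Lemma ccont_cst (c : R[i]) r : ccont (fun=> c) r.
Proof. by split; cont. Qed.

Lemma sqrD_neq0 z : z != 0 -> Re z * Re z + Im z * Im z != 0.
Proof.
by move=> z0; rewrite -!expr2 -sqr_normc expf_neq0// normc_eq0.
Qed.

Lemma ccont_inv f r : f r != 0 -> ccont f r -> ccont (fun y => (f y)^-1) r.
Proof.
move=> /sqrD_neq0 f0 [f1 f2]; split.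
- by apply: cont_ext (fun y => ReVM _) _; cont.
- by apply: cont_ext (fun y => ImVM _) _; cont.
Qed.

Lemma ccont_real (f : R -> R) r : {for r, continuous f} -> ccont (fun y => (f y)%:C) r.
Proof. by move=> cf; split; rewrite /=; cont. Qed.

Lemma polar_derive_ccont F F' r x : polar_derive F F' r x -> ccont (F ^~ x) r.
Proof. by case=> d1 d2 _ _ _; split; [exact: der_continuous d1|exact: der_continuous d2]. Qed.

Lemma polar_derive_mul F G F' G' r x :
  polar_derive F F' r x -> polar_derive G G' r x ->
  polar_derive (fun y t => F y t * G y t)
    (fun y t => F' y t * G y t + F y t * G' y t) r x.
Proof.
move=> dF dG; have cF := polar_derive_ccont dF; have cG := polar_derive_ccont dG.
case: dF dG => [f1 f2 f3 f4 f5] [g1 g2 g3 g4 g5]; split.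
- apply: der_ext (fun y => ReM _ _) _.
  by apply: der_eq (der_sub (der_mul f1 g1) (der_mul f2 g2)) _; rewrite !ReIm; ring.
- apply: der_ext (fun y => ImM _ _) _.
  by apply: der_eq (der_add (der_mul f1 g2) (der_mul f2 g1)) _; rewrite !ReIm; ring.
- apply: der_ext (fun y => ReM _ _) _.
  by apply: der_eq (der_sub (der_mul f3 g3) (der_mul f4 g4)) _; rewrite !ReIm; ring.
- apply: der_ext (fun y => ImM _ _) _.
  by apply: der_eq (der_add (der_mul f3 g4) (der_mul f4 g3)) _; rewrite !ReIm; ring.
- by apply: ccont_add; exact: ccont_mul.
Qed.

Lemma polar_derive_inv F F' r x : F r x != 0 -> polar_derive F F' r x ->
  polar_derive (fun y t => (F y t)^-1)
    (fun y t => - (F' y t * ((F y t)^-1 * (F y t)^-1))) r x.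
Proof.
move=> F0 dF; have cF := polar_derive_ccont dF.
have n0 := sqrD_neq0 F0; case: dF => [f1 f2 f3 f4 f5].
have n0' : Re (F r x) ^+ 2 + Im (F r x) ^+ 2 != 0 by rewrite !expr2.
split.
- apply: der_ext (fun y => ReVM _) _.
  apply: der_eq (der_mul f1 (der_inv _ (der_add (der_mul f1 f1) (der_mul f2 f2)))) _.
    exact: n0.
  by rewrite !ReIm ReV ImV !expr2; field.
- apply: der_ext (fun y => ImVM _) _.
  apply: der_eq (der_opp (der_mul f2 (der_inv _ (der_add (der_mul f1 f1) (der_mul f2 f2))))) _.
    exact: n0.
  by rewrite !ReIm ReV ImV !expr2; field.
- apply: der_ext (fun y => ReVM _) _.
  apply: der_eq (der_mul f3 (der_inv _ (der_add (der_mul f3 f3) (der_mul f4 f4)))) _.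
    exact: n0.
  by rewrite !ReIm ReV ImV !expr2; field.
- apply: der_ext (fun y => ImVM _) _.
  apply: der_eq (der_opp (der_mul f4 (der_inv _ (der_add (der_mul f3 f3) (der_mul f4 f4))))) _.
    exact: n0.
  by rewrite !ReIm ReV ImV !expr2; field.
- apply: ccont_opp; apply: ccont_mul f5 _.
  by apply: ccont_mul; exact: ccont_inv.
Qed.

Lemma polar_derive_powR a r x : 0 < r ->
  polar_derive (polar_powR a) (fun y t => (a / y)%:C * polar_powR a y t) r x.
Proof.
move=> r0; rewrite /polar_powR.
have dr : is_derive r 1 (fun y : R => y `^ a) (a / r * r `^ a).
  apply: der_eq (der_powR a r0 (der_id r)) _.
  by rewrite powR_subr1//; ring.
have dx : is_derive x 1 (fun y : R => a * y) a.
  by apply: der_eq (der_scale a (der_id x)) _; rewrite mulr1.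
have rn0 : r != 0 by rewrite gt_eqF.
split.
- under eq_fun do rewrite !ReIm /=.
  apply: der_eq (der_sub (der_mul dr (der_cst r (cos (a * x))))
    (der_cst r (0 * sin (a * x)))) _.
  by rewrite !ReIm /=; field.
- under eq_fun do rewrite !ReIm /=.
  apply: der_eq (der_add (der_mul dr (der_cst r (sin (a * x))))
    (der_cst r (0 * cos (a * x)))) _.
  by rewrite !ReIm /=; field.
- under eq_fun do rewrite !ReIm /=.
  apply: der_eq (der_sub (der_scale (r `^ a) (der_cos dx)) (der_scale 0 (der_sin dx))) _.
  by rewrite !ReIm /=; field.
- under eq_fun do rewrite !ReIm /=.
  apply: der_eq (der_add (der_scale (r `^ a) (der_sin dx)) (der_scale 0 (der_cos dx))) _.
  by rewrite !ReIm /=; field.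
- apply: ccont_mul; first by apply: ccont_real; cont.
  by apply: ccont_mul; [apply: ccont_real; cont|exact: ccont_cst].
Qed.

Lemma polar_derive_addcst c F F' r x : polar_derive F F' r x ->
  polar_derive (fun y t => F y t + c) F' r x.
Proof.
case=> f1 f2 f3 f4 f5; split => //.
- apply: der_ext (fun y => ReD _ _) _.
  by apply: der_eq (der_add f1 (der_cst _ _)) _; rewrite addr0.
- apply: der_ext (fun y => ImD _ _) _.
  by apply: der_eq (der_add f2 (der_cst _ _)) _; rewrite addr0.
- apply: der_ext (fun y => ReD _ _) _.
  by apply: der_eq (der_add f3 (der_cst _ _)) _; rewrite addr0.
- apply: der_ext (fun y => ImD _ _) _.
  by apply: der_eq (der_add f4 (der_cst _ _)) _; rewrite addr0.
Qed.

Lemma polar_derive_opp F F' r x : polar_derive F F' r x ->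
  polar_derive (fun y t => - F y t) (fun y t => - F' y t) r x.
Proof.
case=> f1 f2 f3 f4 f5; split.
- apply: der_ext (fun y => ReN _) _.
  by apply: der_eq (der_opp f1) _; rewrite ReN.
- apply: der_ext (fun y => ImN _) _.
  by apply: der_eq (der_opp f2) _; rewrite ImN.
- apply: der_ext (fun y => ReN _) _.
  by apply: der_eq (der_opp f3) _; rewrite ImN; ring.
- apply: der_ext (fun y => ImN _) _.
  by apply: der_eq (der_opp f4) _; rewrite ReN; ring.
- exact: ccont_opp.
Qed.

End PolarCalculus.

(** * Complex-valued integrals and Cauchy's theorem for rays *)

Section ComplexLaplace.
Variable R : realType.
Local Notation mu := (@lebesgue_measure R).
Local Notation Re := (@complex.Re R).
Local Notation Im := (@complex.Im R).
Local Notation normc := (@ComplexField.Normc.normc R).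
Local Notation "x %:C" := (real_complex R x).

Lemma ReRM (a : R) (z : R[i]) : Re (a%:C * z) = a * Re z.
Proof. by rewrite ReM /= mul0r subr0. Qed.
Lemma ImRM (a : R) (z : R[i]) : Im (a%:C * z) = a * Im z.
Proof. by rewrite ImM /= mul0r addr0. Qed.

Definition cL1 (f : R -> R[i]) :=
  L1 (fun t => Re (f t)) /\ L1 (fun t => Im (f t)).

Definition cint (f : R -> R[i]) : R[i] :=
  (\int[mu]_t Re (f t) +i* \int[mu]_t Im (f t))%C.

Lemma cL1Z (c : R[i]) f : cL1 f -> cL1 (fun t => c * f t).
Proof.
move=> [f1 f2]; split.
- under eq_fun do rewrite ReM.
  by apply: L1B; exact: L1Z.
- under eq_fun do rewrite ImM.
  by apply: L1D; exact: L1Z.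
Qed.

Lemma cintZ (c : R[i]) f : cL1 f -> cint (fun t => c * f t) = c * cint f.
Proof.
move=> [f1 f2]; apply: eqcP; rewrite ?ReM ?ImM /cint /=.
- under eq_Rintegral do rewrite ReM.
  by rewrite RintegralB ?RintegralZl//; exact: L1Z.
- under eq_Rintegral do rewrite ImM.
  by rewrite RintegralD ?RintegralZl//; exact: L1Z.
Qed.

Lemma cL1D f g : cL1 f -> cL1 g -> cL1 (fun t => f t + g t).
Proof.
move=> [f1 f2] [g1 g2]; split.
- by under eq_fun do rewrite ReD; exact: L1D.
- by under eq_fun do rewrite ImD; exact: L1D.
Qed.

Lemma cintD f g : cL1 f -> cL1 g ->
  cint (fun t => f t + g t) = cint f + cint g.
Proof.
move=> [f1 f2] [g1 g2]; apply: eqcP; rewrite ?ReD ?ImD /cint /=.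
- by under eq_Rintegral do rewrite ReD; rewrite RintegralD.
- by under eq_Rintegral do rewrite ImD; rewrite RintegralD.
Qed.

Lemma eq_cint f g : f =1 g -> cint f = cint g.
Proof. by move=> /funext ->. Qed.

Lemma cL1_le (f : R -> R[i]) (g : R -> R) :
  measurable_fun setT (fun t => Re (f t)) ->
  measurable_fun setT (fun t => Im (f t)) ->
  (forall t, normc (f t) <= g t) -> L1 g -> cL1 f.
Proof.
move=> m1 m2 fg gL; split.
- by apply: L1_le gL => // t; exact: le_trans (normc_Re _) (fg t).
- by apply: L1_le gL => // t; exact: le_trans (normc_Im _) (fg t).
Qed.

Lemma normc_cint_le (f : R -> R[i]) (g : R -> R) : cL1 f -> L1 g ->
  (forall t, normc (f t) <= g t) -> normc (cint f) <= 2 * \int[mu]_t g t.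
Proof.
move=> [f1 f2] gL fg; apply: le_trans (normc_le_ReIm _) _.
rewrite mulrDl mul1r; apply: lerD => /=.
- apply: le_trans (le_normr_Rintegral measurableT f1) _.
  apply: le_Rintegral => //; first exact: L1_normr.
  by move=> t _; exact: le_trans (normc_Re _) (fg t).
- apply: le_trans (le_normr_Rintegral measurableT f2) _.
  apply: le_Rintegral => //; first exact: L1_normr.
  by move=> t _; exact: le_trans (normc_Im _) (fg t).
Qed.

Definition onposc (f : R -> R[i]) : R -> R[i] := fun t => if 0 < t then f t else 0.

Lemma Re_onposc f t : Re (onposc f t) = onpos (fun x => Re (f x)) t.
Proof. by rewrite /onposc /onpos; case: ifP. Qed.

Lemma Im_onposc f t : Im (onposc f t) = onpos (fun x => Im (f x)) t.
Proof. by rewrite /onposc /onpos; case: ifP. Qed.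

Lemma cL1_onposc_le (f : R -> R[i]) (g : R -> R) :
  (forall t : R, 0 < t -> ccont f t) ->
  (forall t : R, 0 < t -> normc (f t) <= g t) -> L1 (onpos g) -> cL1 (onposc f).
Proof.
move=> cf fg; apply: cL1_le.
- under eq_fun do rewrite Re_onposc.
  by apply: measurable_onpos => t t0; case: (cf t t0).
- under eq_fun do rewrite Im_onposc.
  by apply: measurable_onpos => t t0; case: (cf t t0).
- move=> t; rewrite /onposc /onpos; case: ifP => [/fg//|_].
  by rewrite ComplexField.Normc.normc0.
Qed.

(** On a ray, F dr / r is F ds / s. The polar Cauchy-Riemann equations say that the angular
    derivative of F / r is i dF/dr, and the bound r [dom] r on F removes the boundary terms. *)
Lemma ray_cint_const (F F' : R -> R -> R[i]) (dom : R -> R) (u v a b : R) :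
  u < a < v -> u < b < v ->
  (forall r x : R, 0 < r -> u < x < v -> polar_derive F F' r x) ->
  (forall r x : R, 0 < r -> u < x < v -> normc (F' r x) <= dom r) ->
  (forall r x : R, 0 < r -> u < x < v -> normc (F r x) <= r * dom r) ->
  L1 (onpos dom) ->
  (fun r => r * dom r) @ 0^'+ --> (0 : R) ->
  (fun r => r * dom r) @ +oo --> (0 : R) ->
  cint (onposc (fun r => (r^-1)%:C * F r a)) =
  cint (onposc (fun r => (r^-1)%:C * F r b)).
Proof.
move=> ua ub dF F'd Fd domL d0 doo.
have Fto0 (part : R[i] -> R) (x : R) : (forall z, `|part z| <= normc z) -> u < x < v ->
    (fun r => part (F r x)) @ 0^'+ --> (0 : R) /\
    (fun r => part (F r x)) @ +oo --> (0 : R).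
  move=> hp ux.
  have B r : 0 < r -> - (r * dom r) <= part (F r x) <= r * dom r.
    by move=> r0; rewrite -ler_norml (le_trans (hp _))// Fd.
  split.
  - apply: (@squeeze_cvgr _ _ _ _ (fun r => - (r * dom r)) (fun r => r * dom r)) => //;
      last by rewrite -[X in _ --> X]oppr0; exact: cvgN.
    by near=> r; apply: B; near: r; exact: nbhs_right_gt.
  - apply: (@squeeze_cvgr _ _ _ _ (fun r => - (r * dom r)) (fun r => r * dom r)) => //;
      last by rewrite -[X in _ --> X]oppr0; exact: cvgN.
    by near=> r; apply: B; near: r; exact: nbhs_pinfty_gt.
have cFr r x : 0 < r -> u < x < v -> ccont (F ^~ x) r.
  by move=> r0 ux; exact: polar_derive_ccont (dF r x r0 ux).
have rV r x : 0 < r -> u < x < v -> normc ((r^-1)%:C * F r x) <= dom r.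
  move=> r0 ux; rewrite normcM normcR gtr0_norm ?invr_gt0// ler_pdivrMl//.
  exact: Fd.
have cV r x : 0 < r -> u < x < v -> ccont (fun y => (y^-1)%:C * F y x) r.
  move=> r0 ux; apply: ccont_mul (cFr r x r0 ux); apply: ccont_real.
  by apply: (@cont_inv R (fun y => y)); [rewrite gt_eqF|cont].
apply: eqcP => /=.
- under eq_Rintegral do rewrite Re_onposc.
  under [RHS]eq_Rintegral do rewrite Re_onposc.
  apply: (@ray_integral_const R (fun r x => Re ((r^-1)%:C * F r x))
    (fun r x => - Im (F r x)) (fun r x => - Im (F' r x)) dom u v a b ua ub) => //.
  + move=> r x r0 ux; have [_ _ d _ _] := dF r x r0 ux.
    apply: der_ext (fun y => ReRM _ _) _; apply: der_eq (der_scale r^-1 d) _.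
    by rewrite mulrN mulKf ?gt_eqF.
  + by move=> r x r0 ux; have [_ d _ _ _] := dF r x r0 ux; exact: der_opp d.
  + move=> r x r0 ux; have [_ _ _ _ [_ c]] := dF r x r0 ux; exact: cont_opp c.
  + by move=> r x r0 ux; case: (cV r x r0 ux).
  + by move=> r x r0 ux; rewrite normrN (le_trans (normc_Im _))// F'd.
  + by move=> r x r0 ux; rewrite (le_trans (normc_Re _))// rV.
  + by move=> x ux; rewrite -[X in _ --> X]oppr0; apply: cvgN; case: (Fto0 Im x (@normc_Im R) ux).
  + by move=> x ux; rewrite -[X in _ --> X]oppr0; apply: cvgN; case: (Fto0 Im x (@normc_Im R) ux).
- under eq_Rintegral do rewrite Im_onposc.
  under [RHS]eq_Rintegral do rewrite Im_onposc.
  apply: (@ray_integral_const R (fun r x => Im ((r^-1)%:C * F r x))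
    (fun r x => Re (F r x)) (fun r x => Re (F' r x)) dom u v a b ua ub) => //.
  + move=> r x r0 ux; have [_ _ _ d _] := dF r x r0 ux.
    apply: der_ext (fun y => ImRM _ _) _; apply: der_eq (der_scale r^-1 d) _.
    by rewrite mulKf ?gt_eqF.
  + by move=> r x r0 ux; have [d _ _ _ _] := dF r x r0 ux.
  + by move=> r x r0 ux; have [_ _ _ _ [c _]] := dF r x r0 ux.
  + by move=> r x r0 ux; case: (cV r x r0 ux).
  + by move=> r x r0 ux; rewrite (le_trans (normc_Re _))// F'd.
  + by move=> r x r0 ux; rewrite (le_trans (normc_Im _))// rV.
  + by move=> x ux; case: (Fto0 Re x (@normc_Re R) ux).
  + by move=> x ux; case: (Fto0 Re x (@normc_Re R) ux).
Unshelve. all: end_near. Qed.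

Lemma powR_expR_cvg0 (z c : R) : 0 < z -> 0 < c ->
  (fun r => r `^ z * expR (- (c * r))) @ 0^'+ --> (0 : R) /\
  (fun r => r `^ z * expR (- (c * r))) @ +oo --> (0 : R).
Proof.
move=> z0 c0; split.
  rewrite -[X in _ --> X](mul0r (expR (- (c * 0)))).
  apply: cvgM; first exact: powR_cvg0.
  apply: cvg_at_right_filter.
  by have : {for (0:R), continuous (fun t => expR (- (c * t)))} by cont.
have c20 : 0 < c / 2 by rewrite divr_gt0.
have [C C0 hC] := powR_le_expR (ltW z0) c20.
apply: (@squeeze_cvgr _ _ _ _ (cst 0) (fun t => C * expR (- (c / 2 * t)))).
- near=> t; have t0 : 0 < t by near: t; exact: nbhs_pinfty_gt.
  rewrite mulr_ge0 ?powR_ge0 ?expR_ge0//=.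
  apply: le_trans (ler_wpM2r (expR_ge0 _) (hC t t0)) _.
  rewrite -(mulrA C); apply: ler_wpM2l; first exact: ltW.
  by rewrite -expRD ler_expR; lra.
- exact: cvg_cst.
- rewrite -[X in _ --> X](mulr0 C); apply: cvgM; first exact: cvg_cst.
  have h : (c / 2 * t : R) @[t --> +oo] --> +oo by apply: gt0_cvgMry => //; exact: cvg_id.
  exact: (cvg_comp _ _ h (@cvgr_expR R)).
Unshelve. all: end_near. Qed.

Definition cexp (z : R[i]) : R[i] := (expR (Re z))%:C * cis (Im z).

Lemma cexpD z w : cexp (z + w) = cexp z * cexp w.
Proof. by rewrite /cexp ReD ImD expRD cisD rmorphM mulrACA. Qed.

Lemma normc_cexp z : normc (cexp z) = expR (Re z).
Proof. by rewrite /cexp normcM normc_cis mulr1 normcR ger0_norm ?expR_ge0. Qed.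

Definition ray (r x : R) : R[i] := r%:C * cis x.

Lemma polar_derive_cexp_ray (r x : R) : 0 < r ->
  polar_derive (fun y t => cexp (- ray y t))
    (fun y t => - (cis t * cexp (- ray y t))) r x.
Proof.
move=> r0; have dr : is_derive r 1 (fun y : R => - (y * cos x)) (- cos x).
  by apply: der_eq (der_opp (der_mul (der_id r) (der_cst _ _))) _; ring.
have dr' : is_derive r 1 (fun y : R => - (y * sin x)) (- sin x).
  by apply: der_eq (der_opp (der_mul (der_id r) (der_cst _ _))) _; ring.
have dx : is_derive x 1 (fun y : R => - (r * cos y)) (r * sin x).
  by apply: der_eq (der_opp (der_scale r (der_cos (der_id x)))) _; ring.
have dx' : is_derive x 1 (fun y : R => - (r * sin y)) (- (r * cos x)).
  by apply: der_eq (der_opp (der_scale r (der_sin (der_id x)))) _; ring.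
have E y t : cexp (- ray y t) = (expR (- (y * cos t)))%:C * cis (- (y * sin t)).
  by rewrite /cexp ReN ImN /ray ReRM ImRM.
have ER y t : Re (cexp (- ray y t)) = expR (- (y * cos t)) * cos (- (y * sin t)).
  by rewrite E ReRM.
have EI y t : Im (cexp (- ray y t)) = expR (- (y * cos t)) * sin (- (y * sin t)).
  by rewrite E ImRM.
split.
- apply: der_ext (fun y => ER _ _) _.
  apply: der_eq (der_mul (der_expR dr) (der_cos dr')) _.
  by rewrite ReN (ReM (cis x)) ER EI /=; ring.
- apply: der_ext (fun y => EI _ _) _.
  apply: der_eq (der_mul (der_expR dr) (der_sin dr')) _.
  by rewrite ImN (ImM (cis x)) ER EI /=; ring.
- apply: der_ext (fun y => ER _ _) _.
  apply: der_eq (der_mul (der_expR dx) (der_cos dx')) _.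
  by rewrite ImN (ImM (cis x)) ER EI /=; ring.
- apply: der_ext (fun y => EI _ _) _.
  apply: der_eq (der_mul (der_expR dx) (der_sin dx')) _.
  by rewrite ReN (ReM (cis x)) ER EI /=; ring.
- apply: ccont_opp; apply: ccont_mul; first exact: ccont_cst.
  split; [apply: cont_ext (fun y => ER _ _) _|apply: cont_ext (fun y => EI _ _) _]; cont.
Qed.

(** Euler's integral may be taken over any ray of the open right half plane, by rotation to the
    positive axis. *)
Lemma Gamma_ray (z x : R) : 0 < z -> - (pi / 2) < x < pi / 2 ->
  cint (onposc (fun r => (r^-1)%:C * (polar_powR z r x * cexp (- ray r x)))) =
  (Gamma z)%:C.
Proof.
move=> z0 /andP[x1 x2].
(* Midway between |x| and pi / 2, so that cos is bounded below by cos v > 0 on the whole sector of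
   the rotation. *)
pose v := (`|x| + pi / 2) / 2.
have xv : `|x| < v by have : `|x| < pi / 2 by [rewrite ltr_norml x1]; rewrite /v; lra.
have v2 : v < pi / 2 by have : `|x| < pi / 2 by [rewrite ltr_norml x1]; rewrite /v; lra.
have v0 : 0 < v := le_lt_trans (normr_ge0 x) xv.
pose c := cos v.
have c0 : 0 < c by apply: cos_gt0_pihalf; rewrite v2 andbT; lra.
have cosx y : - v < y < v -> c <= cos y.
  move=> /andP[y1 y2]; rewrite -(cos_norm y).
  have yv : `|y| < v by rewrite ltr_norml y1.
  rewrite /c ltW// ltr_cos// ?in_itv/= ?normr_ge0/= ?(ltW v0)//=; move: yv v2; have := @pi_gt0 R; lra.
(* The radial derivative costs (z + r) r^{z-1} and the function divided by r costs r^{z-1}, both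
   times the exponential; the sum bounds both. *)
pose dom r := (z + 1 + r) * (r `^ (z - 1) * expR (- (c * r))).
have domE r : 0 < r -> r * dom r =
    (z + 1) * (r `^ z * expR (- (c * r))) + r `^ (z + 1) * expR (- (c * r)).
  move=> r0; rewrite /dom powR_subr1// powRDgt0// powRr1 ?ltW//; field.
  by rewrite gt_eqF.
have z10 : 0 < z + 1 by rewrite addr_gt0.
have domL : L1 (onpos dom).
  have := L1D (L1Z (z + 1) (L1_powR_expR z0 c0)) (L1_powR_expR z10 c0).
  congr L1; apply/funext => r; rewrite /onpos; case: ifP => r0; last by rewrite mulr0 addr0.
  rewrite /dom addrK powR_subr1//; field; by rewrite gt_eqF.
have [A1 A2] := powR_expR_cvg0 z0 c0.
have [B1 B2] := powR_expR_cvg0 z10 c0.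
have d0 : (fun r => r * dom r) @ 0^'+ --> (0 : R).
  have : (z + 1) * (r `^ z * expR (- (c * r))) + r `^ (z + 1) * expR (- (c * r)) @[r --> 0^'+] -->
    (z + 1) * 0 + (0 : R) by apply: cvgD => //; apply: cvgM => //; exact: cvg_cst.
  rewrite mulr0 addr0; apply: cvg_trans; apply: near_eq_cvg; near=> r.
  by apply/esym/domE; near: r; exact: nbhs_right_gt.
have doo : (fun r => r * dom r) @ +oo --> (0 : R).
  have : (z + 1) * (r `^ z * expR (- (c * r))) + r `^ (z + 1) * expR (- (c * r)) @[r --> +oo] -->
    (z + 1) * 0 + (0 : R) by apply: cvgD => //; apply: cvgM => //; exact: cvg_cst.
  rewrite mulr0 addr0; apply: cvg_trans; apply: near_eq_cvg; near=> r.
  by apply/esym/domE; near: r; exact: nbhs_pinfty_gt.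
have nE r y : 0 < r -> - v < y < v -> normc (cexp (- ray r y)) <= expR (- (c * r)).
  move=> r0 yv; rewrite normc_cexp ReN /ray ReRM ler_expR lerN2 mulrC.
  by apply: ler_wpM2l; [exact: ltW|exact: cosx].
have -> : (Gamma z)%:C = cint (onposc (fun r => (r^-1)%:C * (polar_powR z r 0 * cexp (- ray r 0)))).
  have E r : onposc (fun r => (r^-1)%:C * (polar_powR z r 0 * cexp (- ray r 0))) r =
      (onpos (fun t => t `^ (z - 1) * expR (- t)) r)%:C.
    rewrite /onposc /onpos; case: ifP => // r0.
    rewrite /polar_powR mulr0 cis0 mulr1 /ray cis0 mulr1 /cexp ReN ImN /= oppr0 cis0 mulr1.
    by rewrite -!rmorphM powR_subr1// mulrA (mulrC r^-1).
  rewrite (eq_cint E); apply: eqcP => /=; first by rewrite GammaE.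
  by rewrite Rintegral_cst// mul0r.
apply: (@ray_cint_const (fun r y => polar_powR z r y * cexp (- ray r y))
  (fun r y => (z / r)%:C * polar_powR z r y * cexp (- ray r y) +
     polar_powR z r y * - (cis y * cexp (- ray r y))) dom (- v) v) => //.
- by move: xv; rewrite ltr_norml.
- by rewrite v0 oppr_lt0 v0.
- move=> r y r0 yv; apply: polar_derive_mul.
    exact: polar_derive_powR.
  exact: polar_derive_cexp_ray.
- move=> r y r0 yv.
  have := nE r y r0 yv; move: (cexp (- ray r y)) => e he.
  have := normc_polar_powR z r y; move: (polar_powR z r y) => p hp.
  apply: le_trans (le_normcD _ _) _; rewrite mulrN normcN !normcM normc_cis mul1r.
  rewrite hp normcR gtr0_norm ?divr_gt0//.
  apply: (@le_trans _ _ ((z / r * r `^ z + r `^ z) * expR (- (c * r)))).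
    rewrite mulrDl; apply: lerD; apply: ler_wpM2l => //; rewrite ?powR_ge0//.
    by rewrite mulr_ge0 ?powR_ge0// ltW// divr_gt0.
  rewrite /dom powR_subr1// mulrA ler_wpM2r ?expR_ge0//.
  have := powR_ge0 r z; have : 0 < r^-1 by rewrite invr_gt0.
  have : r * r^-1 = 1 by rewrite mulfV// gt_eqF.
  by nra.
- move=> r y r0 yv; rewrite (normcM (polar_powR z r y)) normc_polar_powR domE//.
  apply: (@le_trans _ _ (r `^ z * expR (- (c * r)))).
    by rewrite ler_wpM2l ?powR_ge0 ?nE.
  have h1 : 0 <= r `^ z * expR (- (c * r)) by rewrite mulr_ge0 ?powR_ge0 ?expR_ge0.
  have h2 : 0 <= r `^ (z + 1) * expR (- (c * r)) by rewrite mulr_ge0 ?powR_ge0 ?expR_ge0.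
  by nra.
Unshelve. all: end_near. Qed.

End ComplexLaplace.

(** * Laplace transform *)

Section LaplaceTransform.
Variable R : realType.
Local Notation mu := (@lebesgue_measure R).
Local Notation Re := (@complex.Re R).
Local Notation Im := (@complex.Im R).
Local Notation normc := (@ComplexField.Normc.normc R).
Local Notation "x %:C" := (real_complex R x).
Implicit Types (f g : R -> R) (s : R[i]).

Lemma realcM (a b : R) : (a * b)%:C = a%:C * b%:C.
Proof. exact: rmorphM. Qed.

Lemma Re_cint h : Re (cint h) = \int[mu]_t Re (h t). Proof. by []. Qed.
Lemma Im_cint h : Im (cint h) = \int[mu]_t Im (h t). Proof. by []. Qed.

Definition laplace_integrand f s (t : R) : R[i] := (f t)%:C * cexp (- (s * t%:C)).

Definition claplace f s : R[i] := cint (laplace_integrand f s).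

Lemma Re_cexp (z : R[i]) : Re (cexp z) = expR (Re z) * cos (Im z).
Proof. by rewrite /cexp ReRM. Qed.

Lemma Im_cexp (z : R[i]) : Im (cexp z) = expR (Re z) * sin (Im z).
Proof. by rewrite /cexp ImRM. Qed.

Lemma ReMR s (t : R) : Re (s * t%:C) = Re s * t.
Proof. by rewrite mulrC ReRM mulrC. Qed.

Lemma ImMR s (t : R) : Im (s * t%:C) = Im s * t.
Proof. by rewrite mulrC ImRM mulrC. Qed.

Lemma ccont_laplace_exp s (t : R) : ccont (fun t => cexp (- (s * t%:C))) t.
Proof.
have ER y : Re (cexp (- (s * y%:C))) = expR (- (Re s * y)) * cos (- (Im s * y)).
  by rewrite Re_cexp ReN ImN ReMR ImMR.
have EI y : Im (cexp (- (s * y%:C))) = expR (- (Re s * y)) * sin (- (Im s * y)).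
  by rewrite Im_cexp ReN ImN ReMR ImMR.
by split; [apply: cont_ext (fun y => ER _) _|apply: cont_ext (fun y => EI _) _]; cont.
Qed.

Lemma normc_laplace_exp s (t : R) : normc (cexp (- (s * t%:C))) = expR (- (Re s * t)).
Proof. by rewrite normc_cexp ReN ReMR. Qed.

Lemma normc_laplace_integrand f s t :
  normc (laplace_integrand f s t) = `|expR (- (Re s * t)) * f t|.
Proof.
rewrite /laplace_integrand normcM normc_laplace_exp normcR normrM mulrC.
by rewrite (ger0_norm (expR_ge0 _)).
Qed.

Lemma cL1_laplace f s : measurable_fun setT f ->
  L1 (fun t => expR (- (Re s * t)) * f t) -> cL1 (laplace_integrand f s).
Proof.
move=> mf fL; have cE t := ccont_laplace_exp s t.
apply: (@cL1_le _ _ (fun t => `|expR (- (Re s * t)) * f t|)).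
- under eq_fun do rewrite /laplace_integrand ReRM.
  apply: measurable_funM => //; apply: measurable_for_continuous => t.
  by case: (cE t).
- under eq_fun do rewrite /laplace_integrand ImRM.
  apply: measurable_funM => //; apply: measurable_for_continuous => t.
  by case: (cE t).
- by move=> t; rewrite normc_laplace_integrand.
- exact: L1_normr.
Qed.

Lemma claplaceD f g s : cL1 (laplace_integrand f s) -> cL1 (laplace_integrand g s) ->
  cL1 (laplace_integrand (fun t => f t + g t) s) /\
  claplace (fun t => f t + g t) s = claplace f s + claplace g s.
Proof.
move=> fL gL.
have E t : laplace_integrand (fun t => f t + g t) s t =
    laplace_integrand f s t + laplace_integrand g s t.
  by rewrite /laplace_integrand rmorphD mulrDl.
split; first by rewrite (funext E); exact: cL1D.
by rewrite /claplace (eq_cint E) cintD.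
Qed.

Lemma claplaceZ (c : R) f s : cL1 (laplace_integrand f s) ->
  cL1 (laplace_integrand (fun t => c * f t) s) /\
  claplace (fun t => c * f t) s = c%:C * claplace f s.
Proof.
move=> fL.
have E t : laplace_integrand (fun t => c * f t) s t = c%:C * laplace_integrand f s t.
  by rewrite /laplace_integrand rmorphM mulrA.
split; first by rewrite (funext E); exact: cL1Z.
by rewrite /claplace (eq_cint E) cintZ.
Qed.

Lemma claplace_conv f g s : measurable_fun setT f -> measurable_fun setT g ->
  L1 (fun t => expR (- (Re s * t)) * f t) ->
  L1 (fun t => expR (- (Re s * t)) * g t) ->
  (forall t, L1 (fun r => f (t - r) * g r)) ->
  cL1 (laplace_integrand (conv f g) s) /\
  claplace (conv f g) s = claplace f s * claplace g s.
Proof.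
move=> mf mg fL gL fgL.
pose e t := cexp (- (s * t%:C)).
have cE t : ccont e t := ccont_laplace_exp s t.
have m1 : measurable_fun setT (fun t => Re (e t)).
  by apply: measurable_for_continuous => t; case: (cE t).
have m2 : measurable_fun setT (fun t => Im (e t)).
  by apply: measurable_for_continuous => t; case: (cE t).
have b1 t : `|Re (e t)| <= expR (- (Re s * t)).
  by rewrite (le_trans (normc_Re _))// normc_laplace_exp.
have b2 t : `|Im (e t)| <= expR (- (Re s * t)).
  by rewrite (le_trans (normc_Im _))// normc_laplace_exp.
have [L1r Er] := laplace_conv m1 mf mg b1 fL gL fgL.
have [L1i Ei] := laplace_conv m2 mf mg b2 fL gL fgL.
have eD t u : e (t + u) = e t * e u.
  by rewrite /e rmorphD mulrDr opprD cexpD.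
have RE t : Re (laplace_integrand (conv f g) s t) = Re (e t) * conv f g t.
  by rewrite /laplace_integrand ReRM mulrC.
have IE t : Im (laplace_integrand (conv f g) s t) = Im (e t) * conv f g t.
  by rewrite /laplace_integrand ImRM mulrC.
split; first by split; [under eq_fun do rewrite RE|under eq_fun do rewrite IE].
have fC := cL1_laplace mf fL; have gC := cL1_laplace mg gL.
have inner u : cint (fun t => (g u)%:C * (laplace_integrand f s t * e u)) =
    claplace f s * laplace_integrand g s u.
  transitivity (cint (fun t => (laplace_integrand g s u) * laplace_integrand f s t)).
    apply: eq_cint => t; rewrite /laplace_integrand -/(e t) -/(e u).
    by move: (e t) (e u) => a b; ring.
  by rewrite cintZ// mulrC.
have innerR u : \int[mu]_t (Re (e (t + u)) * (f t * g u)) =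
    Re (claplace f s * laplace_integrand g s u).
  rewrite -inner Re_cint; apply: eq_Rintegral => t _.
  rewrite ReRM /laplace_integrand -/(e t) eD.
  by move: (e t) (e u) => a b; rewrite -mulrA ReRM; ring.
have innerI u : \int[mu]_t (Im (e (t + u)) * (f t * g u)) =
    Im (claplace f s * laplace_integrand g s u).
  rewrite -inner Im_cint; apply: eq_Rintegral => t _.
  rewrite ImRM /laplace_integrand -/(e t) eD.
  by move: (e t) (e u) => a b; rewrite -mulrA ImRM; ring.
rewrite -[RHS]cintZ//; apply: eqcP; rewrite /claplace ?Re_cint ?Im_cint.
- under eq_Rintegral do rewrite RE.
  by rewrite Er; apply: eq_Rintegral => u _; rewrite innerR.
- under eq_Rintegral do rewrite IE.
  by rewrite Ei; apply: eq_Rintegral => u _; rewrite innerI.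
Qed.

Lemma Re_ray_gt0 (r x : R) : 0 < r -> - (pi / 2) < x < pi / 2 -> 0 < Re (ray r x).
Proof. by move=> r0 xp; rewrite /ray ReRM mulr_gt0//; exact: cos_gt0_pihalf. Qed.

(** Scaling the time by r turns the transform at angle x into Euler's integral over the ray of angle
    x. *)
Lemma claplace_power_kernel (z r x : R) : 0 < z -> 0 < r ->
  - (pi / 2) < x < pi / 2 ->
  cL1 (laplace_integrand (power_kernel z) (ray r x)) /\
  claplace (power_kernel z) (ray r x) = polar_powR (- z) r x.
Proof.
move=> z0 r0 xp; have s0 := Re_ray_gt0 r0 xp.
split.
  apply: cL1_laplace; first exact: measurable_power_kernel.
  exact: (power_kernel_laplace z0 s0).1.
pose h : R -> R[i] :=
  onposc (fun y => (y^-1)%:C * (polar_powR z y x * cexp (- ray y x))).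
have c0 : 0 < cos x by exact: cos_gt0_pihalf.
have hL : cL1 h.
  apply: (@cL1_onposc_le _ _ (fun y => y `^ (z - 1) * expR (- (cos x * y)))).
  - move=> t t0; apply: ccont_mul.
      by apply: ccont_real; apply: (@cont_inv R (fun y => y)); [rewrite gt_eqF|cont].
    apply: ccont_mul.
      exact: polar_derive_ccont (polar_derive_powR z x t0).
    exact: polar_derive_ccont (polar_derive_cexp_ray x t0).
  - move=> t t0; rewrite normcM normcR gtr0_norm ?invr_gt0//.
    rewrite (normcM (polar_powR z t x)) normc_polar_powR normc_cexp ReN /ray ReRM.
    by rewrite powR_subr1// mulrA (mulrC t^-1) (mulrC (cos x)).
  - exact: L1_powR_expR.
have hI : cint h = (Gamma z)%:C := Gamma_ray z0 xp.
pose c : R[i] := ((Gamma z)^-1 * (r `^ (1 - z)))%:C * cis (- (z * x)).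
have E t : laplace_integrand (power_kernel z) (ray r x) t = c * h (r * t + 0).
  rewrite /laplace_integrand /h /power_kernel /onposc /onpos addr0 pmulr_rgt0//.
  case: ifP => t0; last by rewrite mulr0 mul0r.
  have -> : ray (r * t) x = ray r x * t%:C.
    by rewrite /ray realcM; ring.
  rewrite /c /polar_powR cisN.
  have rt0 : r * t != 0 by rewrite mulf_neq0 ?gt_eqF.
  have -> : (Gamma z)^-1 * t `^ (z - 1) =
    (Gamma z)^-1 * r `^ (1 - z) * ((r * t)^-1 * (r * t) `^ z).
    rewrite [X in _ = _ * X]mulrC -powR_subr1 ?mulr_gt0// powRM ?ltW//.
    rewrite -mulrA (mulrA (r `^ _)) -powRDgt0//.
    by rewrite (_ : 1 - z + (z - 1) = 0) ?powRr0 ?mul1r//; ring.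
  move: (cexp _) => e; rewrite !realcM.
  have cancelw (a1 a2 a3 a4 w : R[i]) : w != 0 ->
      a1 * a2 * (a3 * a4) * e = a1 * a2 / w * (a3 * (a4 * w * e)).
    by move=> w0; field.
  exact/cancelw/cis_neq0.
rewrite /claplace (eq_cint E).
have hrL : cL1 (fun t => h (r * t + 0)).
  by case: hL => h1 h2; split; [exact: (L1_affine 0 r0 h1)|exact: (L1_affine 0 r0 h2)].
rewrite cintZ//.
have -> : cint (fun t => h (r * t + 0)) = (r^-1)%:C * cint h.
  case: hL => h1 h2; apply: eqcP; rewrite ?ReRM ?ImRM /=.
  - by rewrite (Rintegral_affine 0 r0 h1).
  - by rewrite (Rintegral_affine 0 r0 h2).
rewrite hI /c /polar_powR mulNr.
have -> : r `^ (- z) = (Gamma z)^-1 * r `^ (1 - z) * r^-1 * Gamma z.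
  rewrite (_ : r `^ (- z) = r `^ (1 - z) / r); last first.
    by rewrite -powR_subr1//; congr (_ `^ _); ring.
  field; rewrite !gt_eqF//; exact: Gamma_gt0.
by rewrite !realcM; ring.
Qed.

Lemma L1_exp_bounded f (M sigma a : R) : sigma < a ->
  (forall t, 0 < t -> {for t, continuous f}) ->
  (forall t, 0 < t -> `|f t| <= M * expR (sigma * t)) ->
  L1 (fun t => expR (- (a * t)) * onpos f t).
Proof.
move=> sa cf fM.
have -> : (fun t => expR (- (a * t)) * onpos f t) =
    onpos (fun t => expR (- (a * t)) * f t).
  by apply/funext => t; rewrite /onpos; case: ifP; rewrite ?mulr0.
apply: (@L1_onpos_le _ _ (fun t => M * (t `^ (1 - 1) * expR (- ((a - sigma) * t))))).
- by move=> t t0; cont; exact: cf.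
- move=> t t0; rewrite subrr powRr0 mul1r normrM ger0_norm ?expR_ge0// mulrC.
  apply: le_trans (ler_wpM2r (expR_ge0 _) (fM t t0)) _.
  by rewrite -mulrA -expRD mulrBl opprB addrC.
- by rewrite onposZ; apply: L1Z; apply: L1_powR_expR; rewrite ?subr_gt0.
Qed.

Lemma power_kernel_conv_exp_bounded f (z M sigma : R) : 0 < z -> 0 <= M ->
  (forall t, 0 < t -> {for t, continuous f}) ->
  (forall t, 0 < t -> `|f t| <= M * expR (sigma * t)) ->
  forall t, L1 (fun r => power_kernel z (t - r) * onpos f r).
Proof.
move=> z0 M0 cf fM t.
have mf := measurable_onpos cf.
apply: (@power_kernel_conv_bounded _ z t (M * expR (`|sigma| * t))) => //.
- by move=> s s0; rewrite onpos0.
- have ss : sigma < sigma + 1 by rewrite ltrDl.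
  have := L1Z (expR (`|sigma + 1| * `|t|)) (L1_normr (L1_exp_bounded ss cf fM)).
  apply: L1_le.
    apply/(measurable_restrictT _ _).1; first exact: measurable_itv.
    exact: measurable_funTS.
  move=> s; have [st|st] := boolP (0 < s < t); last first.
    by rewrite truncate_eq0// normr0 mulr_ge0 ?expR_ge0.
  rewrite truncateE// normrM mulrA ler_peMl// ger0_norm ?expR_ge0// -expRD.
  rewrite -expR0 ler_expR; case/andP: st => s0 s1.
  rewrite subr_ge0 (le_trans (ler_norm _))// normrM ler_wpM2l//.
  by rewrite !gtr0_norm ?ltW// (lt_trans s0 s1).
- move=> s /andP[s1 s2]; rewrite /onpos; case: ifP => s0; last first.
    by rewrite normr0 mulr_ge0 ?expR_ge0.
  apply: le_trans (fM s s0) _; apply: ler_wpM2l => //; rewrite ler_expR.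
  apply: le_trans (ler_norm _) _; rewrite normrM ler_wpM2l// gtr0_norm//.
  exact: ltW.
Qed.

Lemma power_kernel1 (t : R) : 0 < t -> power_kernel 1 t = 1.
Proof.
by move=> t0; rewrite /power_kernel onposE// Gamma1 invr1 mul1r subrr powRr0.
Qed.

(** The formula of [caputo_primitive] is transformed term by term: 1, t and the convolution kernel
    are power kernels of orders 1, 2 and alpha. Working with the integrated equation avoids any
    growth condition on f' and f''. *)
Lemma claplace_caputo (alpha M sigma f1 r x : R) f g : 1 < alpha -> alpha < 2 ->
  caputo_differentiable f -> (forall t : R, 0 < t -> caputo alpha f t = g t) ->
  f^`()%classic @ 0^'+ --> f1 ->
  (forall t, 0 < t -> {for t, continuous g}) -> 0 <= M ->
  (forall t, 0 < t -> `|g t| <= M * expR (sigma * t)) ->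
  0 < r -> - (pi / 2) < x < pi / 2 -> sigma < Re (ray r x) ->
  claplace (onpos f) (ray r x) =
    (f 0)%:C * polar_powR (- 1) r x + f1%:C * polar_powR (- 2) r x +
    polar_powR (- alpha) r x * claplace (onpos g) (ray r x).
Proof.
move=> a1 a2 df Dfg cf1 cg M0 gM r0 xp ss.
have [f1' cf1' fE] := caputo_primitive a1 a2 df Dfg.
have E1 : f1' = f1 := cvg_unique _ cf1' cf1.
have a0 : 0 < alpha by lra.
have E : onpos f = (fun t => (f 0 * power_kernel 1 t + f1 * power_kernel 2 t) +
    conv (power_kernel alpha) (onpos g) t).
  apply/funext => t; have [t0|t0] := ltP 0 t.
    by rewrite onposE// power_kernel1// power_kernel2// fE// mulr1 E1.
  rewrite onpos0// !power_kernel0// !mulr0 !add0r.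
  rewrite /conv -[LHS](mul0r (fine (mu setT))) -Rintegral_cst//.
  apply: eq_Rintegral => u _; have [u0|u0] := leP u 0.
    by rewrite onpos0// mulr0.
  by rewrite power_kernel0 ?mul0r//; lra.
have s0 := Re_ray_gt0 r0 xp.
have [cL e] := claplace_conv (measurable_power_kernel alpha) (measurable_onpos cg)
  (power_kernel_laplace a0 s0).1 (L1_exp_bounded ss cg gM)
  (power_kernel_conv_exp_bounded a0 M0 cg gM).
have [k1 e1] := claplace_power_kernel ltr01 r0 xp.
have [k2 e2] := claplace_power_kernel (ltr0Sn R 1) r0 xp.
have [ka ea] := claplace_power_kernel a0 r0 xp.
have [z1 f_1] := claplaceZ (f 0) k1.
have [z2 f_2] := claplaceZ f1 k2.
have [d12 f_12] := claplaceD z1 z2.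
have [d123 f_123] := claplaceD d12 cL.
by rewrite E f_123 f_12 f_1 f_2 e e1 e2 ea.
Qed.

End LaplaceTransform.

(** * Injectivity of the Laplace transform *)

Section LaplaceInjective.
Variable R : realType.
Local Notation mu := (@lebesgue_measure R).
Implicit Types (f g : R -> R).

(* If f t0 > 0, test against powers of a polynomial in e^{-t} that exceeds 1
   near t0 and stays in [0, 1] away from t0. *)
Lemma laplace_le0 f (p0 t0 : R) :
  (forall t : R, 0 < t -> {for t, continuous f}) ->
  L1 (fun t => expR (- (p0 * t)) * onpos f t) ->
  (forall k : nat, \int[mu]_t (expR (- ((p0 + k%:R) * t)) * onpos f t) = 0) ->
  0 < t0 -> f t0 <= 0.
Proof.
move=> cf gL g0 t00; rewrite leNgt; apply/negP => ft0.
pose g t := expR (- (p0 * t)) * onpos f t : R.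
(* The vanishing of the transform at the points p0 + k makes [g] orthogonal to all powers of e^{-t},
   hence to all polynomials in it. *)
have poly0 (Q : {poly R}) : L1 (fun t => Q.[expR (- t)] * g t) /\
    \int[mu]_t (Q.[expR (- t)] * g t) = 0.
  have gk (k : nat) : L1 (fun t => expR (- t) ^+ k * g t) /\
      \int[mu]_t (expR (- t) ^+ k * g t) = 0.
    have E t : expR (- t) ^+ k * g t = expR (- ((p0 + k%:R) * t)) * onpos f t.
      rewrite /g mulrA -expRM_natl -expRD; congr (expR _ * _); ring.
    split; last by under eq_Rintegral do rewrite E; exact: g0.
    apply: L1_le (L1_normr gL).
      apply: measurable_funM; last exact: L1_measurable.
      apply: measurable_for_continuous => t; rewrite /=.
      have c : {for t, continuous (fun t : R => expR (k%:R * - t))} by cont.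
      by apply: cont_ext c => y; rewrite expRM_natl.
    move=> t; have [t0'|t0'] := ltP 0 t; last by rewrite /g onpos0 ?mulr0 ?normr0.
    rewrite -/(g t) normrM ler_piMl// ger0_norm ?exprn_ge0 ?expR_ge0//.
    by rewrite exprn_ile1 ?expR_ge0// -expR0 ler_expR oppr_le0 ltW.
  have sum0 (n : nat) (c : nat -> R) :
      L1 (fun t => (\sum_(i < n) c i * expR (- t) ^+ i) * g t) /\
      \int[mu]_t ((\sum_(i < n) c i * expR (- t) ^+ i) * g t) = 0.
    elim: n => [|n [IH1 IH2]].
      have E t : (\sum_(i < 0) c i * expR (- t) ^+ i) * g t = 0.
        by rewrite big_ord0 mul0r.
      split; first by rewrite (funext E); exact: L10.
      by under eq_Rintegral do rewrite E; rewrite Rintegral_cst// mul0r.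
    have E t : (\sum_(i < n.+1) c i * expR (- t) ^+ i) * g t =
        (\sum_(i < n) c i * expR (- t) ^+ i) * g t + c n * (expR (- t) ^+ n * g t).
      by rewrite big_ord_recr /= mulrDl mulrA.
    have [k1 k2] := gk n; have k3 := L1Z (c n) k1.
    split; first by rewrite (funext E); exact: L1D.
    under eq_Rintegral do rewrite E.
    by rewrite RintegralD// IH2 add0r RintegralZl// k2 mulr0.
  have [s1 s2] := sum0 (size Q) (fun i => Q`_i).
  split; first by move: s1; congr L1; apply/funext => t; rewrite horner_coef.
  by under eq_Rintegral do rewrite horner_coef.
have gt0 : 0 < g t0 by rewrite /g onposE// mulr_gt0 ?expR_gt0.
pose m := g t0 / 2.
have m0 : 0 < m by rewrite divr_gt0.
have cg : {for t0, continuous (fun t => expR (- (p0 * t)) * f t)}.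
  by cont; exact: cf.
have [eta eta0 heta] : exists2 eta : R, 0 < eta & eta < t0 /\
    forall t, `|t - t0| < eta -> m < g t.
  have mg : m < expR (- (p0 * t0)) * f t0.
    by move: (gt0); rewrite /m /g onposE//; lra.
  have := cvgr_gt _ cg _ mg.
  move=> [e /= e0 he]; exists (Num.min e (t0 / 2)).
    by rewrite lt_min e0/= divr_gt0.
  split; first by rewrite gt_min; apply/orP; right; lra.
  move=> t; rewrite lt_min => /andP[te tt].
  have tp : 0 < t by move: tt; rewrite ltr_norml; lra.
  by rewrite /g onposE//; apply: he; rewrite /= distrC.
have [etat0 gm] := heta.
pose x0 := expR (- t0).
pose d := Num.min (x0 - expR (- (t0 + eta))) (expR (- (t0 - eta)) - x0).
have d0 : 0 < d.
  by rewrite lt_min !subr_gt0 /x0 !ltr_expR; apply/andP; split; lra.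
have far t : eta <= `|t - t0| -> d <= `|expR (- t) - x0|.
  rewrite ler_normr => /orP[h|h].
    rewrite distrC ler_normr; apply/orP; left; rewrite ge_min; apply/orP; left.
    by rewrite lerB// ler_expR; lra.
  rewrite ler_normr; apply/orP; left; rewrite ge_min; apply/orP; right.
  by rewrite lerB// ler_expR; lra.
pose eta' := Num.min (eta / 2) (d / 2).
have eta'0 : 0 < eta' by rewrite lt_min !divr_gt0.
have eta'd : eta' <= d / 2 by rewrite ge_min lexx orbT.
have eta'eta : eta' < eta.
  by rewrite gt_min; apply/orP; left; lra.
have near t : 0 < t -> `|t - t0| <= eta' -> `|expR (- t) - x0| <= eta'.
  move=> tp h; apply: le_trans h.
  have lip (a b : R) : 0 < a -> a <= b -> `|expR (- a) - expR (- b)| <= `|a - b|.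
    move=> a0 ab; rewrite ger0_norm; last by rewrite subr_ge0 ler_expR; lra.
    rewrite distrC ger0_norm ?subr_ge0//.
    have e1 : 1 + (a - b) <= expR (a - b) by exact: expR_ge1Dx.
    have e2 : expR (- b) = expR (- a) * expR (a - b) by rewrite -expRD; congr expR; ring.
    have e3 : expR (- a) <= 1 by rewrite -expR0 ler_expR; lra.
    have e4 : 0 < expR (- a) by exact: expR_gt0.
    by rewrite e2; nra.
  have [tt|tt] := leP t t0; first exact: lip.
  by rewrite distrC (distrC t); apply: lip => //; exact: ltW.
have xle1 t : 0 < t -> `|expR (- t) - x0| <= 1.
  move=> tp; have h1 : expR (- t) <= 1 by rewrite -expR0 ler_expR; lra.
  have h2 : x0 <= 1 by rewrite /x0 -expR0 ler_expR; lra.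
  have h3 := expR_gt0 (- t); have h4 : 0 < x0 := expR_gt0 _.
  by rewrite ler_norml; apply/andP; split; lra.
(* For |x - x0| >= d the value is at most 1 - d^2 / 2; for |x - x0| <= d / 2 it is at least 1 + d^2
   / 4; and it is nonnegative because e^{-t} and x0 are both in [0, 1]. *)
pose P : {poly R} := (1 + d ^+ 2 / 2)%:P - ('X - x0%:P) ^+ 2.
have PE t : P.[expR (- t)] = 1 + d ^+ 2 / 2 - `|expR (- t) - x0| ^+ 2.
  by rewrite /P !hornerE real_normK ?num_real// expr2.
pose kappa := 1 + d ^+ 2 / 4.
have kappa1 : 1 < kappa by rewrite /kappa ltrDl divr_gt0// exprn_gt0.
have d2 : 0 < d ^+ 2 by rewrite exprn_gt0.
have P0 t : 0 < t -> 0 <= P.[expR (- t)].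
  move=> tp; rewrite PE; have := xle1 t tp; have := normr_ge0 (expR (- t) - x0).
  by move: `|_| => y y0 y1; have : y ^+ 2 <= 1 by [rewrite expr2; nra]; lra.
(* The integral of P^n g is zero, so |g| may be replaced by P^n g + |g|. This is nonnegative
   everywhere, as P^n is at most 1 wherever g could be negative, and it exceeds kappa^n m near t0;
   letting n grow is a contradiction. *)
have key n : kappa ^+ n * (m * (2 * eta')) <= \int[mu]_t `|g t|.
  have [Pn1 Pn2] := poly0 (P ^+ n).
  have hL : L1 (fun t => (P ^+ n).[expR (- t)] * g t + `|g t|).
    by apply: L1D => //; exact: L1_normr.
  have -> : \int[mu]_t `|g t| = \int[mu]_t ((P ^+ n).[expR (- t)] * g t + `|g t|).
    by rewrite RintegralD// ?Pn2 ?add0r//; exact: L1_normr.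
  have -> : kappa ^+ n * (m * (2 * eta')) =
      kappa ^+ n * m * ((t0 + eta') - (t0 - eta')) by ring.
  have kn0 : 0 <= kappa ^+ n by rewrite exprn_ge0// ltW// (lt_trans ltr01).
  apply: ge_Rintegral_itv => //.
  - by lra.
  - by rewrite mulr_ge0// ltW.
  - move=> t; rewrite horner_exp.
    have [tp|tp] := ltP 0 t; last by rewrite /g onpos0// !mulr0 normr0 addr0.
    have [tf|tn] := ltP `|t - t0| eta.
      rewrite addr_ge0// mulr_ge0 ?exprn_ge0 ?P0//.
      by rewrite ltW// (lt_trans m0)// gm.
    have Pn : 0 <= P.[expR (- t)] ^+ n <= 1.
      rewrite exprn_ge0 ?P0//= exprn_ile1 ?P0// PE.
      have := far t tn; move: `|expR (- t) - x0| => y y1.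
      by have : d ^+ 2 <= y ^+ 2 by [rewrite !expr2; nra]; lra.
    move: (P.[expR (- t)] ^+ n) Pn => y /andP[y0 y1].
    have := ler_norm (- g t); rewrite normrN; have := ler_norm (g t).
    by move: `|g t| (g t) => u v; nra.
  - move=> t /andP[t1 t2]; have tp : 0 < t by lra.
    have tn : `|t - t0| <= eta' by rewrite ler_norml; apply/andP; split; lra.
    rewrite horner_exp; apply: (@le_trans _ _ (P.[expR (- t)] ^+ n * g t)); last first.
      by rewrite lerDl.
    apply: ler_pM => //; [exact: ltW| |].
      rewrite lerXn2r ?nnegrE ?P0// ?(ltW (lt_trans ltr01 kappa1))// PE /kappa.
      have := near t tp tn; have := normr_ge0 (expR (- t) - x0).
      move: `|_| => y y0 y1; have : y <= d / 2 by lra.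
      by move=> y2; have : y ^+ 2 <= d ^+ 2 / 4 by [rewrite !expr2; nra]; lra.
    by rewrite ltW// gm//; exact: le_lt_trans tn eta'eta.
pose I := \int[mu]_t `|g t|.
have c0 : 0 < m * (2 * eta') by rewrite mulr_gt0// mulr_gt0.
have [n hn] : exists n : nat, I / (m * (2 * eta')) < kappa ^+ n.
  have bern n : 1 + n%:R * (kappa - 1) <= kappa ^+ n.
    elim: n => [|n IH]; first by rewrite mul0r addr0.
    rewrite exprS -natr1; have : (0 : R) <= n%:R by [].
    move: IH; move: (kappa ^+ n) (n%:R : R) kappa1 => y u k1 IH u0.
    have : kappa * (1 + u * (kappa - 1)) <= kappa * y.
      by rewrite ler_wpM2l// ltW// (lt_trans ltr01).
    have : 0 <= u * (kappa - 1) * (kappa - 1) by rewrite !mulr_ge0// ltW// subr_gt0.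
    by nra.
  exists (Num.truncn (I / (m * (2 * eta')) / (kappa - 1))).+1.
  apply: lt_le_trans (bern _).
  have := truncnS_gt (I / (m * (2 * eta')) / (kappa - 1)).
  rewrite ltr_pdivrMr ?subr_gt0// => h; apply: lt_trans h _.
  by rewrite ltrDr.
by have := key n; rewrite leNgt -/I -ltr_pdivrMr// hn.
Qed.

Lemma laplace_injective f (p0 : R) :
  (forall t : R, 0 < t -> {for t, continuous f}) ->
  L1 (fun t => expR (- (p0 * t)) * onpos f t) ->
  (forall k : nat, \int[mu]_t (expR (- ((p0 + k%:R) * t)) * onpos f t) = 0) ->
  forall t, 0 < t -> f t = 0.
Proof.
move=> cf fL f0 t t0; apply/eqP; rewrite eq_le (laplace_le0 cf fL f0 t0)/=.
rewrite -oppr_le0.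
have E (p s : R) : expR (- (p * s)) * onpos (fun t => - f t) s =
    - 1 * (expR (- (p * s)) * onpos f s).
  by rewrite /onpos; case: ifP => _; ring.
apply: (@laplace_le0 (fun t => - f t) p0) => //.
- by move=> s s0; cont; exact: cf.
- by rewrite (funext (E p0)); exact: L1Z.
- move=> k; under eq_Rintegral do rewrite E.
  rewrite RintegralZl ?f0 ?mulr0//.
  apply: L1_le (L1_normr fL).
    have -> : (fun t => expR (- ((p0 + k%:R) * t)) * onpos f t) =
        (fun t => expR (- (k%:R * t)) * (expR (- (p0 * t)) * onpos f t)).
      by apply/funext => s; rewrite mulrA -expRD; congr (expR _ * _); ring.
    apply: measurable_funM; last exact: L1_measurable.
    by apply: measurable_for_continuous => s; cont.
  move=> s; rewrite !normrM /onpos; case: ifP => s0; last by rewrite normr0 !mulr0.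
  rewrite ler_wpM2r// !ger0_norm ?expR_ge0// ler_expR lerN2 ler_wpM2r ?(ltW s0)//.
  by rewrite lerDl.
Qed.

End LaplaceInjective.

(** * Cauchy's formula in a sector *)

Section CauchyFormula.
Variable R : realType.
Local Notation mu := (@lebesgue_measure R).
Local Notation Re := (@complex.Re R).
Local Notation Im := (@complex.Im R).
Local Notation normc := (@ComplexField.Normc.normc R).
Local Notation "x %:C" := (real_complex R x).
Implicit Types (H K : R -> R -> R[i]).

Lemma normc_ray (r x : R) : 0 <= r -> normc (ray r x) = r.
Proof. by move=> r0; rewrite /ray normcM normc_cis mulr1 normcR ger0_norm. Qed.

(** By the law of cosines the squared distance is at least r^2 + p^2 - 2 k r p, which equals (1 - k)
    / 2 (r + p)^2 + (1 + k) / 2 (r - p)^2. *)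
Lemma ray_dist (k r x p y : R) : 0 <= r -> 0 <= p -> 0 <= k -> k < 1 -> cos (x - y) <= k ->
  Num.sqrt ((1 - k) / 2) * (r + p) <= normc (ray r x - ray p y).
Proof.
move=> r0 p0 k0 k1 ck.
have c0 : 0 <= (1 - k) / 2 by rewrite divr_ge0// subr_ge0 ltW.
rewrite -[leRHS]ger0_norm ?normc_ge0// -[leLHS]ger0_norm ?mulr_ge0 ?sqrtr_ge0 ?addr_ge0//.
rewrite -ler_sqr ?nnegrE// -!normrX !ger0_norm ?sqr_ge0//.
rewrite exprMn sqr_sqrtr// sqr_normc ReD ImD ReN ImN /ray !ReRM !ImRM /=.
have := cos2Dsin2 x; have := cos2Dsin2 y.
move: ck; rewrite cosB; move: (cos x) (sin x) (cos y) (sin y) => a b c d.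
rewrite !expr2 => ck ey ex.
have rp : 0 <= r * p by rewrite mulr_ge0.
have h1 : r * p * (a * c + b * d) <= r * p * k by rewrite ler_wpM2l.
have -> : (r * a - p * c) * (r * a - p * c) + (r * b - p * d) * (r * b - p * d) =
   r * r * (a * a + b * b) + p * p * (c * c + d * d) - 2 * (r * p * (a * c + b * d)) by ring.
rewrite ex ey !mulr1.
have h2 : 0 <= (r - p) * (r - p) by rewrite -expr2 sqr_ge0.
have h3 : 0 <= k * ((r - p) * (r - p)) by rewrite mulr_ge0.
have h4 : 0 <= (1 + k) / 2 * ((r - p) * (r - p)) by rewrite mulr_ge0// divr_ge0// addr_ge0.
suff : 0 <= r * r + p * p - 2 * (r * p * k) - (1 - k) / 2 * ((r + p) * (r + p)) by lra.
have -> : r * r + p * p - 2 * (r * p * k) - (1 - k) / 2 * ((r + p) * (r + p)) =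
  (1 + k) / 2 * ((r - p) * (r - p)) by field.
exact: h4.
Qed.

Lemma cos_le_away (e v x : R) : 0 < e -> e <= `|x| <= v -> v <= pi -> cos x <= cos e.
Proof.
move=> e0 /andP[ex xv] vp; rewrite -(cos_norm x) leNgt ltr_cos ?in_itv/= -?leNgt//.
- by rewrite normr_ge0 (le_trans xv).
- by rewrite ltW//= (le_trans ex)// (le_trans xv).
Qed.

Lemma cos_lt1 (e : R) : 0 < e <= pi -> cos e < 1.
Proof.
move=> /andP[e0 ep]; rewrite -cos0 ltr_cos ?in_itv/= ?lexx ?pi_ge0//.
by rewrite ltW.
Qed.

Lemma polar_powR1 (r x : R) : 0 <= r -> polar_powR 1 r x = ray r x.
Proof. by move=> r0; rewrite /polar_powR powRr1// mul1r. Qed.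

(** For 0 < z < 1 this is r^{z-1} up to 1 and 1/r beyond. The first branch is integrable at 0; the
    second becomes integrable at infinity with one more factor 1/(1 + r), supplied by the Cauchy
    kernel. *)
Definition ray_bound (z r : R) : R := Num.min (r `^ (z - 1)) r^-1.

Lemma ray_bound_ge0 (z r : R) : 0 < r -> 0 <= ray_bound z r.
Proof. by move=> r0; rewrite le_min powR_ge0 invr_ge0 ltW. Qed.

(** With w = r^z, the constant 4 comes from (1 + w)^2 <= 4 for r <= 1 and (1 + w)^2 <= 4 w^2 for r >
    1. *)
Lemma ray_bound_decay (z r : R) : 0 < z -> z < 1 -> 0 < r ->
  ray_bound z r / (1 + r) <= 4 * algebraic_decay z r.
Proof.
move=> z0 z1 r0; rewrite /algebraic_decay.
have w0 := powR_gt0 z r0; have w1 := powR_gt0 (z - 1) r0.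
rewrite mulrA ler_pdivrMr ?addr_gt0// mulrAC ler_pdivlMr ?exprn_gt0 ?addr_gt0//.
have [r1|r1] := leP r 1.
  have h : r `^ z <= 1.
    have -> : 1 = (1 : R) `^ z by rewrite powR1.
    by rewrite ge0_ler_powR ?nnegrE ?(ltW z0) ?(ltW r0).
  have : ray_bound z r <= r `^ (z - 1) by rewrite ge_min lexx.
  have := ray_bound_ge0 z r0.
  move: (ray_bound z r) (r `^ (z - 1)) (r `^ z) w0 w1 h => b u w w0 w1 h b0 bu.
  have : (1 + w) ^+ 2 <= 4 by rewrite expr2; nra.
  have : 0 <= (1 + w) ^+ 2 by rewrite sqr_ge0.
  by move: ((1 + w) ^+ 2) => q q0 q4; nra.
have h : 1 <= r `^ z.
  have -> : 1 = (1 : R) `^ z by rewrite powR1.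
  by rewrite ge0_ler_powR ?nnegrE ?(ltW z0) ?(ltW r0) ?(ltW r1).
have hr : r `^ z <= r.
  rewrite -[leRHS]powRr1 ?(ltW r0)//; apply: ler_powR; exact: ltW.
have : ray_bound z r <= r^-1 by rewrite ge_min lexx orbT.
have := ray_bound_ge0 z r0.
rewrite powR_subr1//.
have ri : r * r^-1 = 1 by rewrite mulfV// gt_eqF.
have ri0 : 0 < r^-1 by rewrite invr_gt0.
move: (ray_bound z r) (r `^ z) w0 h hr => b w w0 h hr b0 bu.
have e : (1 + w) ^+ 2 <= 4 * (w * w) by rewrite expr2; nra.
have e0 : 0 <= (1 + w) ^+ 2 by rewrite sqr_ge0.
have e1 : b * (1 + w) ^+ 2 <= r^-1 * (4 * (w * w)) by apply: ler_pM.
apply: le_trans e1 _.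
have -> : r^-1 * (4 * (w * w)) = 4 * (w * r^-1) * w by ring.
have -> : 4 * (w / r) * (1 + r) = 4 * (w * r^-1) * (1 + r) by [].
by apply: ler_wpM2l; [rewrite !mulr_ge0// ltW|lra].
Qed.

Lemma invr_cvg_at_right : (fun r : R => r^-1) @ +oo --> (0 : R)^'+.
Proof.
move=> P [e /= e0 he].
suff : \forall r \near +oo, P (r^-1 : R) by [].
near=> r.
have r0 : 0 < r by near: r; exact: nbhs_pinfty_gt.
apply: he; rewrite /= ?invr_gt0// sub0r normrN gtr0_norm ?invr_gt0//.
rewrite -[e]invrK ltf_pV2 ?posrE ?invr_gt0//.
by near: r; apply: nbhs_pinfty_gt; exact: num_real.
Unshelve. all: end_near. Qed.

Lemma decay_cvg0 (z : R) : 0 < z ->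
  (fun r => r * algebraic_decay z r) @ 0^'+ --> (0 : R) /\
  (fun r => r * algebraic_decay z r) @ +oo --> (0 : R).
Proof.
move=> z0.
have E r : 0 < r -> 0 <= r * algebraic_decay z r <= r `^ z.
  move=> r0; rewrite mulr_ge0 ?algebraic_decay_ge0 ?(ltW r0)//=.
  rewrite /algebraic_decay powR_subr1// mulrA mulrCA mulfV ?gt_eqF// mulr1.
  have w0 := powR_ge0 r z; rewrite ler_pdivrMr ?exprn_gt0 ?ltr_wpDr//.
  by move: (r `^ z) w0 => w w0; rewrite expr2; nra.
have E' r : 0 < r -> 0 <= r * algebraic_decay z r <= r^-1 `^ z.
  move=> r0; rewrite mulr_ge0 ?algebraic_decay_ge0 ?(ltW r0)//=.
  rewrite /algebraic_decay powR_subr1// mulrA mulrCA mulfV ?gt_eqF// mulr1.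
  have -> : r^-1 `^ z = (r `^ z)^-1.
    by rewrite -[in LHS]powR_inv1 ?(ltW r0)// -powRrM mulN1r powRN.
  have w0 := powR_gt0 z r0; rewrite ler_pdivrMr ?exprn_gt0 ?addr_gt0//.
  rewrite mulrC ler_pdivlMr//.
  by move: (r `^ z) w0 => w w0; rewrite expr2; nra.
split.
- apply: (@squeeze_cvgr _ _ _ _ (cst 0) (fun r => r `^ z)).
  + by near=> r; apply: E; near: r; exact: nbhs_right_gt.
  + exact: cvg_cst.
  + exact: powR_cvg0.
- apply: (@squeeze_cvgr _ _ _ _ (cst 0) (fun r => r^-1 `^ z)).
  + by near=> r; apply: E'; near: r; exact: nbhs_pinfty_gt.
  + exact: cvg_cst.
  + exact: (cvg_comp _ _ invr_cvg_at_right (powR_cvg0 z0)).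
Unshelve. all: end_near. Qed.

(** Analyticity in the sector |x| < v together with size. Bounding r H' by the same function as H
    makes the class stable under sums and products, and under inverses when H is bounded below. *)
Definition sector_bound (v : R) (f : R -> R) H := exists H' (C : R), 0 <= C /\
  forall r x : R, 0 < r -> - v < x < v ->
  [/\ polar_derive H H' r x, normc (H r x) <= C * f r &
      r * normc (H' r x) <= C * f r].

Lemma polar_derive_ray (r x : R) : 0 < r -> polar_derive (@ray R) (fun y t => cis t) r x.
Proof.
move=> r0; split; rewrite /ray.
- apply: der_ext (fun y => ReRM _ _) _.
  by apply: der_eq (der_mul (der_id r) (der_cst r (cos x))) _; rewrite /=; ring.
- apply: der_ext (fun y => ImRM _ _) _.
  by apply: der_eq (der_mul (der_id r) (der_cst r (sin x))) _; rewrite /=; ring.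
- apply: der_ext (fun y => ReRM _ _) _.
  apply: der_eq (@der_scale _ r (fun y => Re (cis y)) x (- sin x) (is_derive_cos x)) _.
  by rewrite /= mulrN.
- apply: der_ext (fun y => ImRM _ _) _.
- exact: ccont_cst.
Qed.

(* With s = ray r x this is H(s) s / (p - s) / r: on a ray, ds = (s / r) dr. *)
Definition cauchy_integrand H (p r x : R) : R[i] :=
  (r^-1)%:C * (H r x * (ray r x * (p%:C - ray r x)^-1)).

Lemma normc_cauchy_integrand H (p r x : R) : 0 < r ->
  normc (cauchy_integrand H p r x) = normc (H r x) / normc (p%:C - ray r x).
Proof.
move=> r0; rewrite /cauchy_integrand (normcM (r^-1)%:C) (normcM (H r x)) (normcM (ray r x)).
rewrite normcV (normc_ray _ (ltW r0)) normcR gtr0_norm ?invr_gt0// mulrCA.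
by rewrite mulKf ?gt_eqF.
Qed.

Lemma pole_dist (e v p : R) : 0 < e -> e < v -> v < pi -> 0 < p ->
  exists2 k, 0 < k & forall r x, 0 < r -> e <= `|x| <= v ->
    k * (r + p) <= normc (p%:C - ray r x).
Proof.
move=> e0 ev vp p0.
have pE : p%:C = ray p 0 by rewrite /ray cis0 mulr1.
(* [ray_dist] needs a nonnegative k, while cos e is negative when e exceeds pi / 2. *)
pose k := Num.max 0 (cos e).
have k1 : k < 1.
  by rewrite gt_max ltr01 cos_lt1// e0 ltW// (lt_trans ev).
exists (Num.sqrt ((1 - k) / 2)); first by rewrite sqrtr_gt0 divr_gt0// subr_gt0.
move=> r x r0 ex; rewrite -normcN opprB pE.
apply: ray_dist => //; rewrite ?(ltW r0) ?(ltW p0)//.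
  by rewrite le_max lexx.
rewrite subr0 le_max; apply/orP; right.
by apply: (cos_le_away e0 ex); exact: ltW.
Qed.

(** The radial derivative of H(s) s / (p - s), with y = s, w = 1 / (p - s) and c = e^{ix}
    abstracted. *)
Lemma resolvent_derive_le (h h' y w c : R[i]) (r : R) : normc y = r -> normc c = 1 ->
  normc (h' * (y * w) + h * (c * w + y * - (- c * (w * w)))) <=
  normc h' * (r * normc w) + normc h * (normc w * (1 + r * normc w)).
Proof.
move=> yr c1; have r0 : 0 <= r by rewrite -yr normc_ge0.
apply: le_trans (le_normcD _ _) _; rewrite !normcM yr lerD2l.
apply: ler_wpM2l; first exact: normc_ge0.
apply: le_trans (le_normcD _ _) _.
by rewrite mulNr opprK !normcM c1 yr !mul1r mulrDr mulr1 (mulrCA r).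
Qed.

(** The rotation stays at angles above half of the smaller one, so it never meets the pole p and
    [pole_dist] controls the Cauchy kernel uniformly. *)
Lemma cauchy_integral_const (z v p a b : R) H : 0 < z -> z < 1 -> 0 < p ->
  v < pi -> sector_bound v (ray_bound z) H -> 0 < a < v -> 0 < b < v ->
  cint (onposc (fun r => cauchy_integrand H p r a)) =
  cint (onposc (fun r => cauchy_integrand H p r b)).
Proof.
move=> z0 z1 p0 vp [H' [C [C0 hH]]] /andP[a0 av] /andP[b0 bv].
pose e := Num.min a b / 2.
have e0 : 0 < e by rewrite divr_gt0// lt_min a0.
have ea : e < a by have : Num.min a b <= a by [rewrite ge_min lexx]; rewrite /e; lra.
have eb : e < b by have : Num.min a b <= b by [rewrite ge_min lexx orbT]; rewrite /e; lra.
have ev : e < v := lt_trans ea av.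
have [k k0 hk] := pole_dist e0 ev vp p0.
(* Since (1 + 1/p) (r + p) >= 1 + r, the bound 1 / (k (r + p)) becomes D / (1 + r). *)
pose D := (1 + p^-1) * k^-1.
have pi0 : 0 < p^-1 by rewrite invr_gt0.
have ki0 : 0 < k^-1 by rewrite invr_gt0.
have D0 : 0 < D by rewrite mulr_gt0// addr_gt0.
pose W r x := (p%:C - ray r x)^-1.
pose S r x := ray r x * W r x.
have exv x : e < x < v -> e <= `|x| <= v.
  by move=> /andP[ex xv]; rewrite gtr0_norm ?(lt_trans e0)// !ltW.
have pole r x : 0 < r -> e < x < v -> p%:C - ray r x != 0.
  move=> r0 ex; rewrite -normc_eq0 gt_eqF// (lt_le_trans _ (hk r x r0 (exv x ex)))//.
  by rewrite mulr_gt0// addr_gt0.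
have Wb r x : 0 < r -> e < x < v -> normc (W r x) <= D / (1 + r).
  move=> r0 ex; rewrite /W normcV.
  have h1 := hk r x r0 (exv x ex).
  have rp0 : 0 < r + p by rewrite addr_gt0.
  apply: (@le_trans _ _ (k * (r + p))^-1).
    by rewrite lef_pV2 ?posrE// ?mulr_gt0// (lt_le_trans _ h1)// mulr_gt0.
  have -> : D / (1 + r) = k^-1 * ((1 + p^-1) / (1 + r)) by rewrite /D; ring.
  rewrite invfM; apply: ler_wpM2l; first exact: ltW.
  rewrite ler_pdivlMr ?addr_gt0// mulrC ler_pdivrMr//.
  have : p^-1 * p = 1 by rewrite mulVf// gt_eqF.
  have : 0 < r * p^-1 by rewrite mulr_gt0.
  by nra.
clearbody D.
have rr1 (r : R) : 0 < r -> r / (1 + r) <= 1.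
  by move=> r0; rewrite ler_pdivrMr ?addr_gt0// mul1r lerDr.
pose W' r x := - (- cis x * (W r x * W r x)).
have dW r x : 0 < r -> e < x < v -> polar_derive W W' r x.
  move=> r0 ex; apply: (@polar_derive_inv R (fun r x => p%:C - ray r x) (fun _ t => - cis t)).
    exact: pole.
  have := polar_derive_addcst p%:C (polar_derive_opp (polar_derive_ray x r0)).
  by under eq_fun do under eq_fun do rewrite addrC.
pose G r x := H r x * S r x.
pose G' r x := H' r x * S r x + H r x * (cis x * W r x + ray r x * W' r x).
have vx x : e < x < v -> - v < x < v.
  by move=> /andP[ex ->]; rewrite andbT; lra.
pose dom (r : R) : R := (C * (D + D + D * D)) * (4 * algebraic_decay z r).
have Cb (r : R) : 0 < r -> 0 <= C * ray_bound z r.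
  by move=> r0; rewrite mulr_ge0// ray_bound_ge0.
have E r x : onposc (fun r => cauchy_integrand H p r x) r =
    onposc (fun r => (r^-1)%:C * G r x) r by [].
rewrite (eq_cint (E^~ a)) (eq_cint (E^~ b)).
apply: (@ray_cint_const R G G' dom e v) => //.
- by rewrite ea av.
- by rewrite eb bv.
- move=> r x r0 ex; have [d1 _ _] := hH r x r0 (vx x ex).
  exact: (@polar_derive_mul R H S H' (fun y t => cis t * W y t + ray y t * W' y t) r x d1
    (@polar_derive_mul R (@ray R) W (fun _ t => cis t) W' r x (polar_derive_ray x r0)
      (dW r x r0 ex))).
- move=> r x r0 ex; have [_ b1 b2] := hH r x r0 (vx x ex).
  have w1 := Wb r x r0 ex.
  have w0 := normc_ge0 (W r x).
  apply: le_trans (resolvent_derive_le _ _ _ (normc_ray x (ltW r0)) (normc_cis x)) _.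
  have rw : r * normc (W r x) <= D.
    apply: (@le_trans _ _ (D * (r / (1 + r)))); last by rewrite ler_piMr ?(ltW D0) ?rr1.
    by rewrite mulrCA ler_wpM2l ?(ltW r0).
  have t1 : normc (H' r x) * (r * normc (W r x)) <= C * ray_bound z r * (D / (1 + r)).
    by rewrite mulrA (mulrC _ r); apply: ler_pM; rewrite ?mulr_ge0 ?normc_ge0 ?(ltW r0).
  have t2 : normc (H r x) * (normc (W r x) * (1 + r * normc (W r x))) <=
      C * ray_bound z r * (D / (1 + r) * (1 + D)).
    have h0 : 0 <= 1 + r * normc (W r x) by rewrite addr_ge0// mulr_ge0// ltW.
    apply: ler_pM; rewrite ?normc_ge0 ?mulr_ge0//.
    by apply: ler_pM => //; rewrite lerD2l.
  apply: le_trans (lerD t1 t2) _.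
  have -> : C * ray_bound z r * (D / (1 + r)) + C * ray_bound z r * (D / (1 + r) * (1 + D)) =
    C * (D + D + D * D) * (ray_bound z r / (1 + r)) by ring.
  apply: ler_wpM2l; last exact: (ray_bound_decay z0 z1 r0).
  by move: (D) (ltW D0) => d d0; rewrite mulr_ge0// !addr_ge0 ?mulr_ge0.
- move=> r x r0 ex; have [_ b1 _] := hH r x r0 (vx x ex).
  have := normc_ray x (ltW r0); rewrite /G /S; move: (ray r x) => y yr.
  rewrite (normcM (H r x)) (normcM y) yr mulrCA; apply: ler_wpM2l; first exact: ltW.
  apply: (@le_trans _ _ (C * ray_bound z r * (D / (1 + r)))).
    by apply: ler_pM; rewrite ?normc_ge0 ?Wb.
  have -> : C * ray_bound z r * (D / (1 + r)) = C * D * (ray_bound z r / (1 + r)) by ring.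
  rewrite /dom; apply: ler_pM; rewrite ?(ray_bound_decay z0 z1 r0)//.
  + by rewrite mulr_ge0 ?(ltW D0).
  + by rewrite divr_ge0 ?ray_bound_ge0// addr_ge0// ltW.
  + by move: (D) (ltW D0) => d d0; rewrite ler_wpM2l// -addrA lerDl addr_ge0 ?mulr_ge0.
- rewrite /dom; have := L1Z (C * (D + D + D * D) * 4) (L1_algebraic_decay z0).
  congr L1; apply/funext => r; rewrite /onpos; case: ifP => _; last by rewrite mulr0.
  exact/esym/(mulrA (C * (D + D + D * D)) 4 (algebraic_decay z r)).
- have [h _] := decay_cvg0 z0.
  have dE r : r * dom r = C * (D + D + D * D) * 4 * (r * algebraic_decay z r).
    by rewrite /dom; move: (algebraic_decay z r) => y; ring.
  rewrite (funext dE) -[X in _ --> X](mulr0 (C * (D + D + D * D) * 4)).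
  by apply: cvgM => //; exact: cvg_cst.
- have [_ h] := decay_cvg0 z0.
  have dE r : r * dom r = C * (D + D + D * D) * 4 * (r * algebraic_decay z r).
    by rewrite /dom; move: (algebraic_decay z r) => y; ring.
  rewrite (funext dE) -[X in _ --> X](mulr0 (C * (D + D + D * D) * 4)).
  by apply: cvgM => //; exact: cvg_cst.
Qed.

End CauchyFormula.

(** * Limit of the Cauchy integral on the positive axis *)

Section CauchyFormulaReal.
Variable R : realType.
Local Notation mu := (@lebesgue_measure R).
Local Notation Re := (@complex.Re R).
Local Notation Im := (@complex.Im R).
Local Notation normc := (@ComplexField.Normc.normc R).
Local Notation "x %:C" := (real_complex R x).
Implicit Types (H K : R -> R -> R[i]).

Lemma mean_value_le (f f' : R -> R) (a b M : R) :
  (forall y, Num.min a b <= y <= Num.max a b -> is_derive y 1 f (f' y)) ->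
  (forall y, Num.min a b <= y <= Num.max a b -> `|f' y| <= M) ->
  `|f b - f a| <= M * `|b - a|.
Proof.
wlog ab : a b / a <= b => [hw df bf|].
  have [ab|/ltW ba] := leP a b; first exact: hw.
  by rewrite distrC (distrC b); apply: hw => // y; rewrite minC maxC; [exact: df|exact: bf].
rewrite (min_idPl ab) (max_idPr ab) => df bf.
have [c cab ->] : exists2 c : R, c \in `[a, b] & f b - f a = f' c * (b - a).
  apply: MVT_segment => // [x|].
    by rewrite in_itv/= => /andP[ax xb]; apply: df; rewrite !ltW.
  apply: derivable_within_continuous => x; rewrite in_itv/= => xab.
  by have [] := df x xab.
by rewrite normrM ler_wpM2r// bf//; rewrite in_itv in cab.
Qed.

(** Mean value theorem along a radius and along an arc: L bounds the radial derivative and M the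
    angular one. The factor 2 accounts for real and imaginary parts. *)
Lemma polar_lipschitz H H' (a b r q x y L M : R) : 0 < a ->
  a <= r <= b -> a <= q <= b -> 
  (forall t s : R, a <= t <= b -> Num.min x y <= s <= Num.max x y ->
    polar_derive H H' t s /\ normc (H' t s) <= L /\ t * normc (H' t s) <= M) ->
  normc (H r x - H q y) <= 2 * (L * `|r - q| + M * `|x - y|).
Proof.
move=> a0 ra qa hH.
have -> : H r x - H q y = (H r x - H q x) + (H q x - H q y) by rewrite addrA subrK.
have xx : Num.min x y <= x <= Num.max x y by rewrite ge_min le_max lexx.
have sub t : Num.min q r <= t <= Num.max q r -> a <= t <= b.
  move=> /andP[t1 t2]; move: ra qa => /andP[r1 r2] /andP[q1 q2].
  by rewrite (le_trans _ t1) ?le_min ?q1// (le_trans t2)// ge_max q2.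
have A (part part' : R[i] -> R) (hp : forall z, `|part z| <= normc z) t :
    a <= t <= b -> `|part (H' t x)| <= L.
  by move=> ta; have [_ [h _]] := hH t x ta xx; exact: le_trans (hp _) h.
have q0 : 0 < q by move: qa => /andP[qa _]; exact: lt_le_trans qa.
rewrite mulrDr; apply: le_trans (le_normcD _ _) _; apply: lerD.
- apply: le_trans (normc_le_ReIm _) _; rewrite ReD ImD ReN ImN.
  rewrite mulrDl mul1r; apply: lerD.
  + apply: (@mean_value_le (fun t => Re (H t x)) (fun t => Re (H' t x))) => t tqr.
      by have [[]] := hH t x (sub t tqr) xx.
    by have [_ [h _]] := hH t x (sub t tqr) xx; exact: le_trans (normc_Re _) h.
  + apply: (@mean_value_le (fun t => Im (H t x)) (fun t => Im (H' t x))) => t tqr.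
      by have [[]] := hH t x (sub t tqr) xx.
    by have [_ [h _]] := hH t x (sub t tqr) xx; exact: le_trans (normc_Im _) h.
- apply: le_trans (normc_le_ReIm _) _; rewrite ReD ImD ReN ImN.
  rewrite mulrDl mul1r; apply: lerD.
  + apply: (@mean_value_le (fun t => Re (H q t)) (fun t => - (q * Im (H' q t)))) => t.
      by rewrite minC maxC => tqr; have [[]] := hH q t qa tqr.
    rewrite minC maxC normrN normrM (gtr0_norm q0) => tqr; have [_ [_ h]] := hH q t qa tqr.
    by apply: le_trans h; rewrite ler_wpM2l ?normc_Im ?(ltW q0).
  + apply: (@mean_value_le (fun t => Im (H q t)) (fun t => q * Re (H' q t))) => t.
      by rewrite minC maxC => tqr; have [[]] := hH q t qa tqr.
    rewrite minC maxC normrM (gtr0_norm q0) => tqr; have [_ [_ h]] := hH q t qa tqr.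
    by apply: le_trans h; rewrite ler_wpM2l ?normc_Re ?(ltW q0).
Qed.

Lemma sin_ge_linear (x : R) : 0 <= x <= 1 -> cos 1 * x <= sin x.
Proof.
move=> /andP[x0 x1].
have [c] : exists2 c : R, c \in `[0, x] & sin x - sin 0 = cos c * (x - 0).
  by apply: MVT_segment => //; apply: continuous_subspaceT => y; exact: continuous_sin.
rewrite in_itv/= sin0 !subr0 => /andP[c0 cx] ->.
apply: ler_wpM2r => //; have p2 := @pi_ge2 R.
by rewrite leNgt ltr_cos ?in_itv/= -?leNgt; lra.
Qed.

Lemma algebraic_decay_ge (z a b r : R) : 0 < z -> 0 < a -> a <= r <= b ->
  a `^ z / b / (1 + b `^ z) ^+ 2 <= algebraic_decay z r.
Proof.
move=> z0 a0 /andP[ar rb]; have r0 := lt_le_trans a0 ar; have b0 := lt_le_trans r0 rb.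
rewrite /algebraic_decay powR_subr1//.
have h1 : a `^ z <= r `^ z by rewrite ge0_ler_powR ?nnegrE ?(ltW a0) ?(ltW z0) ?(ltW r0).
have h2 : r `^ z <= b `^ z by rewrite ge0_ler_powR ?nnegrE ?(ltW b0) ?(ltW z0) ?(ltW r0).
have p1 := powR_gt0 z r0.
have q r' : 0 < r' -> 0 < (1 + r' `^ z) ^+ 2 by move=> ?; rewrite exprn_gt0// addr_gt0// powR_gt0.
apply: ler_pM; rewrite ?divr_ge0 ?powR_ge0 ?invr_ge0 ?(ltW b0) ?sqr_ge0//.
  by apply: ler_pM => //; rewrite ?powR_ge0 ?invr_ge0 ?(ltW b0)// lef_pV2.
rewrite lef_pV2 ?posrE ?q// ler_sqr ?nnegrE ?lerD2l// addr_ge0// powR_ge0//.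
Qed.

Lemma normc_pole_ge (p r x : R) : 0 <= p -> 0 <= r ->
  `|r - p| <= normc (p%:C - ray r x) /\ r * sin x <= normc (p%:C - ray r x).
Proof.
move=> p0 r0; have nr := normc_ray x r0; have np : normc p%:C = p by rewrite normcR ger0_norm.
split.
  have h1 := le_normcD (p%:C - ray r x) (ray r x).
  have h2 := le_normcD (ray r x - p%:C) p%:C.
  rewrite subrK nr np in h1; rewrite subrK nr np -normcN opprB in h2.
  by rewrite ler_norml; lra.
apply: le_trans (normc_Im _); rewrite ImD ImN /ray ImRM /= add0r normrN.
exact: ler_norm.
Qed.

Lemma ccont_subl (c : R[i]) (f : R -> R[i]) (r : R) : ccont f r -> ccont (fun y => c - f y) r.
Proof.
by move=> cf; exact: (@ccont_add R (fun=> c) (fun y => - f y) r (ccont_cst c r) (ccont_opp cf)).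
Qed.

(* As the ray approaches the real axis, the zero of K at p compensates the pole,
   so that the integrands remain dominated. *)
Lemma cauchy_integral_real (z v p phi : R) K : 0 < z -> z < 1 -> 0 < p ->
  v < pi -> sector_bound v (ray_bound z) K ->
  (forall r : R, 0 < r -> Im (K r 0) = 0) -> K p 0 = 0 -> 0 < phi < v ->
  Im (cint (onposc (fun r => cauchy_integrand K p r phi))) = 0.
Proof.
move=> z0 z1 p0 vp hS realK K0 phiv.
have [K' [C [C0 hK]]] := hS.
have v0 : 0 < v by move: phiv => /andP[]; exact: lt_trans.
(* The angles stay inside the sector, and below 1 so that [sin_ge_linear] applies. *)
pose x0 := Num.min (v / 2) 1.
have x00 : 0 < x0 by rewrite lt_min divr_gt0/=.
have x01 : x0 <= 1 by rewrite ge_min lexx orbT.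
have x0v : x0 < v by have : x0 <= v / 2 by [rewrite ge_min lexx]; lra.
pose x_ (n : nat) : R := x0 * n.+1%:R^-1.
have xb n : 0 < x_ n <= x0.
  by rewrite mulr_gt0 ?invr_gt0//= ler_piMr ?(ltW x00)// invf_le1 ?ler1n.
have xv n : 0 < x_ n < v by have /andP[-> h] := xb n; exact: le_lt_trans h x0v.
have vx n : - v < x_ n < v by have /andP[h ->] := xv n; rewrite andbT; lra.
have zv : - v < 0 < v by rewrite oppr_lt0 v0.
have x_0 : x_ n @[n --> \oo] --> (0 : R).
  rewrite -[X in _ --> X](mulr0 x0); apply: cvgM; first exact: cvg_cst.
  exact: cvg_harmonic.
have nz n r : 0 < r -> p%:C - ray r (x_ n) != 0.
  move=> r0; rewrite -normc_eq0 gt_eqF//; have [_ h] := normc_pole_ge (x_ n) (ltW p0) (ltW r0).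
  apply: lt_le_trans h; rewrite mulr_gt0// sin_gt0_pi//.
  by have /andP[-> h] := xv n; exact: lt_trans h vp.
pose g n (r : R) : R := Im (onposc (fun r => cauchy_integrand K p r (x_ n)) r).
have cray (r x : R) : 0 < r -> ccont (ray r) x.
  move=> r0; have [_ _ d3 d4 _] := polar_derive_ray x r0.
  by split; [exact: der_continuous d3|exact: der_continuous d4].
have mg n : measurable_fun setT (g n).
  rewrite /g; under eq_fun do rewrite Im_onposc.
  apply: measurable_onpos => r r0.
  have [d _ _] := hK r (x_ n) r0 (vx n).
  have cK := polar_derive_ccont d; have cR := polar_derive_ccont (polar_derive_ray (x_ n) r0).
  suff [] : ccont (fun r => cauchy_integrand K p r (x_ n)) r by [].
  apply: ccont_mul.
    by apply: ccont_real; apply: (@cont_inv R (fun y => y)); [rewrite gt_eqF|cont].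
  apply: ccont_mul; first exact: cK.
  apply: ccont_mul; first exact: cR.
  exact: (@ccont_inv R (fun r => p%:C - ray r (x_ n)) r (nz n r r0) (ccont_subl p%:C cR)).
(* At r = p the denominator of the limit is zero. Removing this null set makes convergence and
   domination hold at every point. *)
pose f n : R -> R := g n \_ ([set: R] `\ p).
have fE n r : f n r = if r == p then 0 else g n r.
  rewrite /f patchE; have [->|rp] := eqVneq r p.
    by rewrite memNset//= => -[_ /(_ erefl)].
  by rewrite mem_set//; split=> //; exact/eqP.
have fg n : \int[mu]_r f n r = \int[mu]_r g n r.
  rewrite -Rintegral_mkcond /Rintegral integral_setD1//; first by apply: measurableD.
  by apply/measurable_EFinP; apply: measurable_funS (mg n).
(* On [p/2, 2 p], [polar_lipschitz] between (r, x_n) and the zero (p, 0) gives |K| <= B1 |p - s|,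
   because |r - p| and a multiple of x_n are at most |p - s|. Elsewhere |p - s| >= m (1 + r).
   Dividing by [a0], a lower bound of [algebraic_decay] on [p/2, 2 p], merges both cases into one
   domination. *)
pose L := C * (2 / p * (2 / p)); pose M := C * (2 / p).
pose B1 := 2 * (L + M * (2 / p / cos 1)).
pose m := Num.min 1 p / 3.
pose a0 := (p / 2) `^ z / (2 * p) / (1 + (2 * p) `^ z) ^+ 2.
pose B := B1 / a0 + 4 * (C / m).
have c1 := @cos1_gt0 R.
have L0 : 0 <= L by rewrite mulr_ge0// mulr_ge0// divr_ge0// ltW.
have M0 : 0 <= M by rewrite mulr_ge0// divr_ge0// ltW.
have B10 : 0 <= B1 by rewrite mulr_ge0// addr_ge0// mulr_ge0// !divr_ge0// ltW.
have m0 : 0 < m by rewrite divr_gt0// lt_min ltr01.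
have a00 : 0 < a0.
  have p2 : 0 < 2 * p by rewrite mulr_gt0.
  apply: divr_gt0; first by apply: divr_gt0 => //; apply: powR_gt0; rewrite divr_gt0.
  by apply: exprn_gt0; apply: addr_gt0 => //; exact: powR_gt0.
have rbV (t : R) : 0 < t -> ray_bound z t <= t^-1 by move=> _; rewrite ge_min lexx orbT.
have dom n r : 0 < r -> r != p -> `|Im (cauchy_integrand K p r (x_ n))| <= B * algebraic_decay z r.
  move=> r0 rp; apply: le_trans (normc_Im _) _.
  have [_ b1 _] := hK r (x_ n) r0 (vx n).
  have [P1 P2] := normc_pole_ge (x_ n) (ltW p0) (ltW r0).
  have P0 : 0 < normc (p%:C - ray r (x_ n)) by rewrite normc_gt0 ?nz.
  rewrite normc_cauchy_integrand//.
  have ad0 := algebraic_decay_ge0 z r.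
  rewrite ler_pdivrMr//.
  have [near|far] := boolP (p / 2 <= r <= 2 * p).
    have p2 : 0 < p / 2 by rewrite divr_gt0.
    have pp : p / 2 <= p <= 2 * p by lra.
    have := @polar_lipschitz K K' (p / 2) (2 * p) r p (x_ n) 0 L M p2 near pp.
    rewrite K0 !subr0 => lip; apply: le_trans (lip _) _ => {lip}.
      move=> t s /andP[t1 t2]; have /andP[y1 y2] := xv n.
      rewrite (min_idPr (ltW y1)) (max_idPl (ltW y1)) => /andP[s1 s2].
      have t0 : 0 < t by lra.
      have sv : - v < s < v by apply/andP; lra.
      have [d _ b2] := hK t s t0 sv.
      have ti : t^-1 <= 2 / p.
        by rewrite -[2 / p]invrK invf_div lef_pV2 ?posrE//.
      have b3 : C * ray_bound z t <= M by rewrite ler_wpM2l// (le_trans (rbV t t0)).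
      split=> //; split; last exact: le_trans b3.
      have tp : 1 <= t * (2 / p) by rewrite mulrA ler_pdivlMr//; lra.
      have tL : t * L = M * (t * (2 / p)) by rewrite /L /M; move: (2 / p) => w; ring.
      by rewrite -(ler_pM2l t0) (le_trans b2)// (le_trans b3)// tL ler_peMr.
    have /andP[y1 y2] := xb n.
    have y3 : x_ n <= 2 / p / cos 1 * normc (p%:C - ray r (x_ n)).
      apply: le_trans (_ : _ <= 2 / p / cos 1 * (r * (cos 1 * x_ n))) _; last first.
        rewrite ler_wpM2l ?divr_ge0 ?(ltW c1) ?(ltW p0)// (le_trans _ P2)// ler_wpM2l ?(ltW r0)//.
        by apply: sin_ge_linear; rewrite (ltW y1) (le_trans y2).
      have -> : 2 / p / cos 1 * (r * (cos 1 * x_ n)) = (r / (p / 2)) * x_ n.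
        by field; rewrite !gt_eqF.
      by rewrite ler_peMl ?(ltW y1)// ler_pdivlMr// mul1r; case/andP: near.
    rewrite (gtr0_norm y1).
    apply: (@le_trans _ _ (B1 * normc (p%:C - ray r (x_ n)))).
      rewrite /B1 -mulrA; apply: ler_wpM2l => //; rewrite mulrDl; apply: lerD.
        exact: ler_wpM2l.
      by rewrite -(mulrA M); apply: ler_wpM2l.
    apply: ler_wpM2r; first exact: ltW.
    rewrite /B mulrDl; apply: (@le_trans _ _ (B1 / a0 * algebraic_decay z r)).
      rewrite -mulrA; apply: ler_peMr => //; rewrite ler_pdivlMl// mulr1.
      exact: algebraic_decay_ge.
    by rewrite lerDl mulr_ge0// mulr_ge0// divr_ge0// ltW.
  have h : m * (1 + r) <= normc (p%:C - ray r (x_ n)).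
    apply: le_trans P1.
    have h1 : m * (1 + r) <= (r + p) / 3.
      have m1 : m <= 1 / 3 by rewrite ler_pM2r// ge_min lexx.
      have m2 : m <= p / 3 by rewrite ler_pM2r// ge_min lexx orbT.
      by rewrite mulrDr mulr1; nra.
    apply: le_trans h1 _; move: far; rewrite negb_and -!ltNge => /orP[] h2.
      by rewrite ltr0_norm; lra.
    by rewrite gtr0_norm; lra.
  apply: le_trans b1 _.
  have h0 : 0 < 1 + r by rewrite addr_gt0.
  have h1 : C * ray_bound z r <= 4 * (C / m) * algebraic_decay z r * (m * (1 + r)).
    have -> : 4 * (C / m) * algebraic_decay z r * (m * (1 + r)) = C * (4 * algebraic_decay z r * (1 + r)).
      by move: (algebraic_decay z r) => q; field; rewrite gt_eqF.
    by apply: ler_wpM2l => //; rewrite -ler_pdivrMr//; exact: ray_bound_decay.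
  apply: le_trans h1 _; apply: ler_pM => //.
  - by rewrite mulr_ge0// mulr_ge0// divr_ge0// ltW.
  - by rewrite mulr_ge0 ?ltW.
  - by apply: ler_wpM2r => //; rewrite /B lerDr divr_ge0// ltW.
have [||||_ lim] := @dominated_cvg_line R f (fun=> 0) (onpos (fun r => B * algebraic_decay z r)).
- move=> n; apply/(measurable_restrictT _ _).1; first exact: measurableD.
  by apply: measurable_funS (mg n).
- move=> r; rewrite (funext (fE^~ r)).
  case: (eqVneq r p) => [_|rp]; first exact: cvg_cst.
  have gE n : g n r = Im (if 0 < r then cauchy_integrand K p r (x_ n) else 0) by [].
  rewrite (funext gE); case: (boolP (0 < r)) => r0; last exact: cvg_cst.
  have [d _ _] := hK r 0 r0 zv; have [_ _ d3 d4 _] := d.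
  have cK : ccont (K r) 0 by split; [exact: der_continuous d3|exact: der_continuous d4].
  have nz0 : p%:C - ray r 0 != 0.
    rewrite -normc_eq0 gt_eqF//; have [h _] := normc_pole_ge 0 (ltW p0) (ltW r0).
    by apply: lt_le_trans h; rewrite normr_gt0 subr_eq0.
  have [_ c] : ccont (fun x => cauchy_integrand K p r x) 0.
    apply: ccont_mul; first exact: ccont_cst.
    apply: ccont_mul; first exact: cK.
    apply: ccont_mul; first exact: cray.
    exact: (@ccont_inv R (fun x => p%:C - ray r x) 0 nz0 (ccont_subl p%:C (cray r 0 r0))).
  have e : Im (cauchy_integrand K p r 0) = 0.
    rewrite /cauchy_integrand ImRM /ray cis0 mulr1.
    have -> : K r 0 = (Re (K r 0))%:C by apply: eqcP => //=; exact: realK.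
    by rewrite -rmorphB -fmorphV -!rmorphM /= mulr0.
  by rewrite -e; exact: (continuous_cvg _ c x_0).
- move=> n r; rewrite fE; case: ifPn => rp; last first.
    rewrite /g Im_onposc /onpos; case: ifPn => r0; last by rewrite normr0.
    exact: dom.
  rewrite normr0 /onpos; case: ifPn => // r0; rewrite mulr_ge0 ?algebraic_decay_ge0//.
  by apply: addr_ge0; [|apply: mulr_ge0 => //]; apply: divr_ge0 => //; exact: ltW.
- rewrite onposZ; exact/L1Z/L1_algebraic_decay.
have const n : \int[mu]_r f n r = Im (cint (onposc (fun r => cauchy_integrand K p r phi))).
  by rewrite fg (cauchy_integral_const z0 z1 p0 vp hS phiv (xv n)).
move: lim; rewrite Rintegral_cst// mul0r (funext const) => lim.
by move: (Im _) lim => J lim; apply: (cvg_unique _ _ lim) => //; exact: cvg_cst.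
Qed.

End CauchyFormulaReal.

(** * Operations on sector bounds and Cauchy's formula *)

Section SectorBounds.
Variable R : realType.
Local Notation mu := (@lebesgue_measure R).
Local Notation Re := (@complex.Re R).
Local Notation Im := (@complex.Im R).
Local Notation normc := (@ComplexField.Normc.normc R).
Local Notation "x %:C" := (real_complex R x).
Implicit Types (F G H K : R -> R -> R[i]) (f g : R -> R).

Lemma polar_derive_add F G F' G' (r x : R) :
  polar_derive F F' r x -> polar_derive G G' r x ->
  polar_derive (fun y t => F y t + G y t) (fun y t => F' y t + G' y t) r x.
Proof.
case=> f1 f2 f3 f4 f5 [g1 g2 g3 g4 g5]; split.
- apply: der_ext (fun y => ReD _ _) _.
  by apply: der_eq (der_add f1 g1) _; rewrite ReD.
- apply: der_ext (fun y => ImD _ _) _.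
  by apply: der_eq (der_add f2 g2) _; rewrite ImD.
- apply: der_ext (fun y => ReD _ _) _.
  by apply: der_eq (der_add f3 g3) _; rewrite ImD; ring.
- apply: der_ext (fun y => ImD _ _) _.
  by apply: der_eq (der_add f4 g4) _; rewrite ReD; ring.
- exact: ccont_add.
Qed.

Lemma polar_derive_cst (c : R[i]) (r x : R) :
  polar_derive (fun _ _ => c) (fun _ _ => 0) r x.
Proof.
split; rewrite /= ?mulr0 ?oppr0; try exact: der_cst.
exact: ccont_cst.
Qed.

Lemma sector_bound_le (v M : R) f g H : 0 <= M ->
  (forall r : R, 0 < r -> f r <= M * g r) -> sector_bound v f H -> sector_bound v g H.
Proof.
move=> M0 fg [H' [C [C0 hH]]]; exists H', (C * M); split=> [|r x r0 xv]; first exact: mulr_ge0.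
have [d b1 b2] := hH r x r0 xv.
have h : C * f r <= C * M * g r by rewrite -mulrA ler_wpM2l// fg.
by split=> //; exact: le_trans h.
Qed.

Lemma sector_boundD (v : R) f F G : sector_bound v f F -> sector_bound v f G ->
  sector_bound v f (fun r x => F r x + G r x).
Proof.
move=> [F' [C [C0 hF]]] [G' [D [D0 hG]]].
exists (fun r x => F' r x + G' r x), (C + D); split=> [|r x r0 xv]; first exact: addr_ge0.
have [d1 b1 c1] := hF r x r0 xv; have [d2 b2 c2] := hG r x r0 xv.
split; first exact: polar_derive_add.
  by rewrite mulrDl (le_trans (le_normcD _ _))// lerD.
rewrite mulrDl (le_trans _ (lerD c1 c2))// -mulrDr ler_wpM2l ?(ltW r0)//.
exact: le_normcD.
Qed.

Lemma sector_boundM (v : R) f g F G : sector_bound v f F -> sector_bound v g G ->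
  sector_bound v (fun r => f r * g r) (fun r x => F r x * G r x).
Proof.
move=> [F' [C [C0 hF]]] [G' [D [D0 hG]]].
exists (fun r x => F' r x * G r x + F r x * G' r x), (2 * (C * D)).
split=> [|r x r0 xv]; first by rewrite !mulr_ge0.
have [d1 b1 c1] := hF r x r0 xv; have [d2 b2 c2] := hG r x r0 xv.
have f0 : 0 <= C * f r := le_trans (normc_ge0 _) b1.
have g0 : 0 <= D * g r := le_trans (normc_ge0 _) b2.
have fg0 := mulr_ge0 f0 g0.
have E : 2 * (C * D) * (f r * g r) = C * f r * (D * g r) + C * f r * (D * g r) by ring.
rewrite E; split; first exact: polar_derive_mul.
  rewrite normcM (le_trans (ler_pM (normc_ge0 _) (normc_ge0 _) b1 b2))//.
  by rewrite lerDl.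
apply: (@le_trans _ _ (r * normc (F' r x) * normc (G r x) + normc (F r x) * (r * normc (G' r x)))).
  rewrite mulrCA -mulrA -mulrDr ler_wpM2l ?(ltW r0)// -!normcM.
  exact: le_normcD.
by apply: lerD; apply: ler_pM; rewrite ?mulr_ge0 ?normc_ge0 ?(ltW r0).
Qed.

Lemma sector_bound_cst (v : R) (c : R[i]) : sector_bound v (fun=> 1) (fun _ _ => c).
Proof.
exists (fun _ _ => 0), (normc c); split=> [|r x r0 xv]; first exact: normc_ge0.
split; first exact: polar_derive_cst; rewrite mulr1//.
by rewrite ComplexField.Normc.normc0 mulr0 normc_ge0.
Qed.

Lemma sector_boundZ (v : R) f H (c : R[i]) : sector_bound v f H ->
  sector_bound v f (fun r x => c * H r x).
Proof.
move=> hH; apply: sector_bound_le (sector_boundM (sector_bound_cst v c) hH); first exact: ler01.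
by [].
Qed.

Lemma sector_boundV (v k : R) f H : 0 < k -> (forall r : R, 0 < r -> 0 < f r) ->
  (forall r x : R, 0 < r -> - v < x < v -> k * f r <= normc (H r x)) ->
  sector_bound v f H -> sector_bound v (fun r => (f r)^-1) (fun r x => (H r x)^-1).
Proof.
move=> k0 f0 lb [H' [C [C0 hH]]].
exists (fun r x => - (H' r x * ((H r x)^-1 * (H r x)^-1))), (k^-1 + C * (k^-1 * k^-1)).
have ki0 : 0 < k^-1 by rewrite invr_gt0.
split=> [|r x r0 xv]; first by rewrite addr_ge0 ?mulr_ge0 ?(ltW ki0).
have [d b1 b2] := hH r x r0 xv; have l := lb r x r0 xv; have fr := f0 r r0.
have kf : 0 < k * f r by rewrite mulr_gt0.
have n0 : 0 < normc (H r x) := lt_le_trans kf l.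
have h : normc (H r x)^-1 <= k^-1 * (f r)^-1.
  by rewrite normcV -invfM lef_pV2 ?posrE.
have fi : 0 < (f r)^-1 by rewrite invr_gt0.
split.
- by apply: polar_derive_inv d; rewrite -normc_eq0 gt_eqF.
- apply: le_trans h _; apply: ler_wpM2r; first exact: ltW.
  by rewrite lerDl !mulr_ge0// ltW.
- rewrite normcN (normcM (H' r x)) (normcM (H r x)^-1).
  apply: (@le_trans _ _ (C * f r * (k^-1 * (f r)^-1 * (k^-1 * (f r)^-1)))).
    rewrite (mulrA r).
    apply: ler_pM => //; rewrite ?mulr_ge0 ?normc_ge0 ?(ltW r0)//.
    by apply: ler_pM; rewrite ?normc_ge0.
  have -> : C * f r * (k^-1 / f r * (k^-1 / f r)) = C * (k^-1 * k^-1) / f r.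
    by field; rewrite !gt_eqF.
  by apply: ler_wpM2r; [exact: ltW|rewrite lerDr ltW].
Qed.

Lemma sector_bound_powR (v a : R) : sector_bound v (fun r => r `^ a) (polar_powR a).
Proof.
exists (fun y t => (a / y)%:C * polar_powR a y t), (1 + `|a|).
split=> [|r x r0 xv]; first exact: addr_ge0.
have p0 := powR_ge0 r a.
split; first exact: polar_derive_powR.
  by rewrite normc_polar_powR mulrDl mul1r lerDl mulr_ge0.
rewrite (normcM (a / r)%:C) normc_polar_powR normcR normrM normfV (gtr0_norm r0).
rewrite mulrA mulrCA mulfV ?gt_eqF// mulr1 mulrDl mul1r lerDr//.
Qed.

Lemma sector_bound_resolvent (v a k p y : R) : 0 < a -> 0 < p -> 0 <= k -> k < 1 ->
  (forall x : R, - v < x < v -> cos (a * x - y) <= k) ->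
  sector_bound v (fun r => (1 + r `^ a)^-1) (fun r x => (polar_powR a r x - ray p y)^-1).
Proof.
move=> a0 p0 k0 k1 ck.
pose c := Num.sqrt ((1 - k) / 2).
have c0 : 0 < c by rewrite sqrtr_gt0 divr_gt0// subr_gt0.
pose m := Num.min 1 p.
have m0 : 0 < m by rewrite lt_min ltr01.
have m1 : m <= 1 by rewrite ge_min lexx.
have mp : m <= p by rewrite ge_min lexx orbT.
apply: (@sector_boundV v (c * m)); first exact: mulr_gt0.
- by move=> r r0; rewrite addr_gt0// powR_gt0.
- move=> r x r0 xv; have w0 := powR_ge0 r a.
  apply: le_trans (ray_dist w0 (ltW p0) k0 k1 (ck x xv)).
  rewrite -mulrA; apply: ler_wpM2l; first exact: ltW.
  by rewrite mulrDr mulr1 addrC lerD// ler_piMl.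
- apply: sector_boundD.
    apply: sector_bound_le (sector_bound_powR v a); first exact: ler01.
    by move=> r r0; rewrite mul1r lerDr.
  apply: sector_bound_le (sector_bound_cst v (- ray p y)); first exact: ler01.
  by move=> r r0; rewrite mul1r lerDl powR_ge0.
Qed.

Lemma le_ray_bound (z r : R) : 0 < z -> z < 1 -> 0 < r -> (1 + r)^-1 <= ray_bound z r.
Proof.
move=> z0 z1 r0; have h0 : 0 < 1 + r by rewrite addr_gt0.
have h1 : (1 + r)^-1 <= r^-1 by rewrite lef_pV2 ?posrE// lerDr.
rewrite le_min h1 andbT powR_subr1//.
have [r1|/ltW r1] := leP r 1.
  have h : r <= r `^ z.
    rewrite -[leLHS]powRr1 ?(ltW r0)// -[X in _ `^ X](subrK z) powRDgt0// ler_piMl ?powR_ge0//.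
    have {2}-> : 1 = (1 : R) `^ (1 - z) by rewrite powR1.
    by rewrite ge0_ler_powR ?nnegrE ?(ltW r0) ?subr_ge0 ?(ltW z1).
  apply: (@le_trans _ _ 1); first by rewrite invf_le1// lerDl ltW.
  by rewrite ler_pdivlMr// mul1r.
apply: le_trans h1 _; rewrite -[leLHS]mul1r ler_wpM2r ?invr_ge0 ?(ltW r0)//.
have -> : 1 = (1 : R) `^ z by rewrite powR1.
by rewrite ge0_ler_powR ?nnegrE ?(ltW z0) ?(ltW r0).
Qed.

Lemma cL1_cauchy_integrand (z v p x : R) H : 0 < z -> z < 1 -> 0 < p ->
  v < pi -> sector_bound v (ray_bound z) H -> 0 < x < v ->
  cL1 (onposc (fun r => cauchy_integrand H p r x)).
Proof.
move=> z0 z1 p0 vp [H' [C [C0 hH]]] /andP[x0 xv].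
have e0 : 0 < x / 2 by rewrite divr_gt0.
have ev : x / 2 < v by lra.
have [k k0 hk] := pole_dist e0 ev vp p0.
have xb : x / 2 <= `|x| <= v by rewrite gtr0_norm//; apply/andP; lra.
have vx : - v < x < v by apply/andP; lra.
pose m := Num.min 1 p.
have m0 : 0 < m by rewrite lt_min ltr01.
have m1 : m <= 1 by rewrite ge_min lexx.
have mp : m <= p by rewrite ge_min lexx orbT.
have pos r : 0 < r -> 0 < normc (p%:C - ray r x).
  by move=> r0; apply: lt_le_trans (hk r x r0 xb); rewrite mulr_gt0// addr_gt0.
apply: (@cL1_onposc_le _ _ (fun r => C / (k * m) * 4 * algebraic_decay z r)).
- move=> r r0; have [d _ _] := hH r x r0 vx.
  have cH := polar_derive_ccont d; have cR := polar_derive_ccont (polar_derive_ray x r0).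
  apply: ccont_mul.
    by apply: ccont_real; apply: (@cont_inv R (fun y => y)); [rewrite gt_eqF|cont].
  apply: ccont_mul; first exact: cH.
  apply: ccont_mul; first exact: cR.
  have nz : p%:C - ray r x != 0 by rewrite -normc_eq0 gt_eqF ?pos.
  exact: (@ccont_inv R (fun r => p%:C - ray r x) r nz (ccont_subl p%:C cR)).
- move=> r r0; have [_ b1 _] := hH r x r0 vx.
  have P0 := pos r r0; have P1 := hk r x r0 xb.
  rewrite normc_cauchy_integrand//.
  rewrite ler_pdivrMr//; apply: le_trans b1 _.
  have h0 : 0 < 1 + r by rewrite addr_gt0.
  have h1 : m * (1 + r) <= r + p by rewrite mulrDr mulr1 addrC lerD// ler_piMl ?(ltW r0).
  have h2 : C / (k * m) * 4 * algebraic_decay z r * (k * (m * (1 + r))) =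
      C * (4 * algebraic_decay z r * (1 + r)).
    by move: (algebraic_decay z r) => q; field; rewrite !gt_eqF.
  have h3 : 0 <= C / (k * m) * 4 * algebraic_decay z r.
    rewrite mulr_ge0 ?algebraic_decay_ge0// mulr_ge0// divr_ge0//.
    by rewrite mulr_ge0 ?ltW.
  apply: le_trans (ler_wpM2l h3 P1).
  apply: le_trans (_ : _ <= C / (k * m) * 4 * algebraic_decay z r * (k * (m * (1 + r)))) _.
    by rewrite h2; apply: ler_wpM2l => //; rewrite -ler_pdivrMr//; exact: ray_bound_decay.
  by apply: ler_wpM2l => //; rewrite ler_pM2l.
- rewrite onposZ; exact/L1Z/L1_algebraic_decay.
Qed.

Lemma integral_lorentzian (p : R) : 0 < p ->
  L1 (onpos (fun r : R => p / (p ^+ 2 + r ^+ 2))) /\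
  \int[mu]_r onpos (fun r : R => p / (p ^+ 2 + r ^+ 2)) r = pi / 2.
Proof.
move=> p0; have pp (r : R) : 0 < p ^+ 2 + r ^+ 2.
  by rewrite ltr_wpDr ?sqr_ge0// exprn_gt0.
have c (r : R) : {for r, continuous (fun r : R => p / (p ^+ 2 + r ^+ 2))}.
  apply: cont_mul; first by cont.
  by apply: cont_inv; [rewrite gt_eqF|cont].
have d (r : R) : is_derive r 1 (fun y => atan (p^-1 * y)) (p / (p ^+ 2 + r ^+ 2)).
  apply: der_eq (der_comp (is_derive1_atan (p^-1 * r)) (der_scale p^-1 (der_id r))) _.
  rewrite mulr1 exprMn; field; rewrite !gt_eqF ?pp//=.
have l0 : (fun y : R => atan (p^-1 * y)) @ 0^'+ --> (0 : R).
  have h : atan (p^-1 * y)%R @[y --> (0 : R)] --> atan (p^-1 * 0) := der_continuous (d 0).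
  by rewrite mulr0 atan0 in h; exact: cvg_at_right_filter.
have l1 : (fun y : R => atan (p^-1 * y)) @ +oo --> (pi / 2 : R).
  have h : (p^-1 * y)%R @[y --> +oo] --> +oo.
    by apply: gt0_cvgMry; [rewrite invr_gt0|exact: cvg_id].
  exact: (cvg_comp _ _ h (@cvgy_atan R)).
have L : L1 (onpos (fun r : R => p / (p ^+ 2 + r ^+ 2))).
  apply: (@L1_onpos_primitive _ _ (fun y => atan (p^-1 * y)) (pi / 2)) => //.
  - by move=> r _; rewrite divr_ge0 ?ltW.
  - move=> r _; rewrite ltW// ltr_norml atan_ltpi2 andbT.
    by have [/andP[]] := atan_def (p^-1 * r).
split=> //; rewrite -[RHS]subr0.
by apply: (Rintegral_onpos_primitive L).
Qed.

(** The pole is removed by subtracting a multiple of c(s) = (p + 1) / (s + 1), so that the formula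
    is needed for this c only. Its own pole -1 is outside the sector, and it decays like 1 / (1 +
    r), within [ray_bound]. *)
Lemma cauchy_formula (z v p phi : R) H : 0 < z -> z < 1 -> 0 < p ->
  pi / 2 < v -> v < pi -> sector_bound v (ray_bound z) H ->
  (forall r : R, 0 < r -> Im (H r 0) = 0) -> 0 < phi < v ->
  Im (cint (onposc (fun r => cauchy_integrand H p r phi))) = pi * Re (H p 0).
Proof.
move=> z0 z1 p0 pv vp hH realH phiv.
have pi0 := @pi_gt0 R.
have v0 : 0 < v by rewrite (lt_trans _ pv)// divr_gt0.
pose c (r x : R) : R[i] := (p + 1)%:C * (polar_powR 1 r x - ray 1 pi)^-1.
have ray1 : ray 1 pi = (-1 : R)%:C.
  by apply: eqcP; rewrite /ray /= ?cospi ?sinpi; ring.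
have hc : sector_bound v (ray_bound z) c.
  apply: sector_boundZ; apply: (@sector_bound_le v 1 (fun r => (1 + r `^ 1)^-1)) => //.
    by move=> r r0; rewrite mul1r powRr1 ?(ltW r0)// le_ray_bound.
  apply: (@sector_bound_resolvent v 1 (Num.max 0 (- cos v))) => //.
  - rewrite gt_max ltr01 ltrNl -cospi ltr_cos ?in_itv/= ?lexx ?(ltW pi0)//.
    by rewrite !ltW.
  - move=> x /andP[x1 x2]; rewrite mul1r cosB cospi sinpi mulr0 addr0 mulrN1 le_max lerN2.
    apply/orP; right; rewrite -(cos_norm x) leNgt ltr_cos ?in_itv/= ?normr_ge0//=.
    + by rewrite -leNgt ler_norml; apply/andP; split; apply: ltW.
    + by rewrite !ltW.
    + by apply: ltW; apply: lt_trans vp; rewrite ltr_norml x1.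
(* c is real on the axis and c(p) = 1; its integral is computed on the imaginary axis. *)
pose h := Re (H p 0).
pose K (r x : R) : R[i] := H r x + (- h)%:C * c r x.
have hK : sector_bound v (ray_bound z) K by apply: sector_boundD hH _; exact: sector_boundZ.
have c0 (r : R) : 0 < r -> c r 0 = ((p + 1) / (r + 1))%:C.
  move=> r0; rewrite /c /polar_powR mulr0 cis0 mulr1 powRr1 ?(ltW r0)// ray1.
  by rewrite -rmorphB -fmorphV -rmorphM opprK.
have KE (r : R) : 0 < r -> Im (K r 0) = 0.
  by move=> r0; rewrite /K ImD realH// add0r c0// -rmorphM.
have Kp : K p 0 = 0.
  rewrite /K c0// mulfV ?mulr1; last by rewrite gt_eqF// addr_gt0.
  by apply: eqcP; rewrite !ReIm /= ?realH// /h; ring.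
have := cauchy_integral_real z0 z1 p0 vp hK KE Kp phiv.
have LH := cL1_cauchy_integrand z0 z1 p0 vp hH phiv.
have Lc := cL1_cauchy_integrand z0 z1 p0 vp hc phiv.
have -> : cint (onposc (fun r => cauchy_integrand K p r phi)) =
    cint (onposc (fun r => cauchy_integrand H p r phi)) +
    (- h)%:C * cint (onposc (fun r => cauchy_integrand c p r phi)).
  rewrite -cintZ// -cintD//; last exact: cL1Z.
  apply: eq_cint => r; rewrite /onposc; case: ifP => _; last by rewrite mulr0 addr0.
  by rewrite /cauchy_integrand /K; move: (H r phi) (c r phi) (ray r phi) => a b w; ring.
rewrite ImD ImRM.
have -> : Im (cint (onposc (fun r => cauchy_integrand c p r phi))) = pi.
  have p2v : 0 < (pi / 2 : R) < v by rewrite pv divr_gt0.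
  rewrite (cauchy_integral_const z0 z1 p0 vp hc phiv p2v) Im_cint.
  have [La Ia] := integral_lorentzian (@ltr01 R).
  have [Lb Ib] := integral_lorentzian p0.
  (* Partial fractions: (p + 1) / ((1 + s) (p - s)) = 1 / (1 + s) + 1 / (p - s). At s = i r the real
     parts are these two Lorentzians, each of integral pi / 2. *)
  have Ipi : pi = \int[mu]_r onpos (fun r => 1 / (1 ^+ 2 + r ^+ 2)) r +
      \int[mu]_r onpos (fun r => p / (p ^+ 2 + r ^+ 2)) r by rewrite Ia Ib -splitr.
  rewrite [RHS]Ipi -RintegralD//.
  apply: eq_Rintegral => r _; rewrite Im_onposc /onpos; case: ifP => r0; last by rewrite addr0.
  pose y : R[i] := (0 +i* r)%C.
  have yE : ray r (pi / 2) = y by apply: eqcP; rewrite /ray /= cos_pihalf sin_pihalf; ring.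
  rewrite /cauchy_integrand /c polar_powR1 ?(ltW r0)// yE ray1.
  rewrite ImRM !(ImM, ReM, ReRM, ImRM, ReV, ImV, ReD, ImD, ReN, ImN) /=.
  have r1 : 1 + r ^+ 2 != 0 by rewrite gt_eqF// ltr_wpDr ?sqr_ge0.
  have r2 : p ^+ 2 + r ^+ 2 != 0 by rewrite gt_eqF// ltr_wpDr ?sqr_ge0// exprn_gt0.
  field; rewrite ?r1 ?r2 ?gt_eqF//.
by move=> /eqP; rewrite mulNr subr_eq0 mulrC => /eqP.
Qed.

End SectorBounds.

(** * Inversion of the Laplace transform *)

Section Hankel.
Variable R : realType.
Local Notation mu := (@lebesgue_measure R).
Local Notation Re := (@complex.Re R).
Local Notation Im := (@complex.Im R).
Local Notation normc := (@ComplexField.Normc.normc R).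
Local Notation "x %:C" := (real_complex R x).
Implicit Types (H : R -> R -> R[i]) (q : R[i]).

Lemma Rintegral_zero : \int[mu]_r (0 : R) = 0.
Proof. by rewrite Rintegral_cst// mul0r. Qed.

Lemma Re_normc_itv q : q != 0 -> -1 <= Re q / normc q <= 1.
Proof.
move=> q0; have n0 := normc_gt0 q0; rewrite -ler_norml normrM normfV (gtr0_norm n0).
by rewrite ler_pdivrMr// mul1r normc_Re.
Qed.

Lemma cos_arg q : q != 0 -> cos (arg q) = Re q / normc q.
Proof.
move=> q0; rewrite /arg (negbTE q0); have qb := Re_normc_itv q0.
by case: ifP => _; rewrite ?cosN acosK// in_itv.
Qed.

Lemma arg_le_pi q : `|arg q| <= pi.
Proof.
rewrite /arg; case: eqVneq => [_|q0]; first by rewrite normr0 pi_ge0.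
have qb := Re_normc_itv q0.
by case: ifP => _; rewrite ?normrN ger0_norm ?acos_ge0// acos_lepi.
Qed.

Lemma sqr_normc_ratio q : q != 0 -> 1 - (Re q / normc q) ^+ 2 = (Im q / normc q) ^+ 2.
Proof.
move=> q0; have n0 := normc_gt0 q0; rewrite !exprMn exprVn.
apply: (mulIf (expf_neq0 2 (lt0r_neq0 n0))).
rewrite mulrBl mul1r -!mulrA mulVf ?mulr1 ?expf_neq0 ?lt0r_neq0//.
by rewrite sqr_normc addrAC subrr add0r.
Qed.

Lemma sin_arg q : q != 0 -> sin (arg q) = Im q / normc q.
Proof.
move=> q0; rewrite /arg (negbTE q0); have qb := Re_normc_itv q0.
have n0 : 0 <= (normc q)^-1 by rewrite invr_ge0 normc_ge0.
case: ifPn => [I0|]; first by rewrite sin_acos// sqr_normc_ratio// sqrtr_sqr ger0_norm ?mulr_ge0.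
rewrite -ltNge => I0; rewrite sinN sin_acos// sqr_normc_ratio// sqrtr_sqr.
by rewrite ler0_norm ?opprK// mulr_le0_ge0// ltW.
Qed.

Lemma polarE q : q = ray (normc q) (arg q).
Proof.
have [->|q0] := eqVneq q 0; first by rewrite /ray ComplexField.Normc.normc0 mul0r.
have n0 : normc q != 0 by rewrite normc_eq0.
apply: eqcP; rewrite /ray ?ReRM ?ImRM /=.
  by rewrite cos_arg// mulrC mulfVK.
by rewrite sin_arg// mulrC mulfVK.
Qed.

Lemma arg_pihalf q : 0 < Re q -> - (pi / 2) < arg q < pi / 2.
Proof.
move=> r0; have q0 : q != 0 by apply: contraTneq r0 => ->; rewrite ltxx.
have n0 := normc_gt0 q0; have c0 : 0 < cos (arg q) by rewrite cos_arg// divr_gt0.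
rewrite -ltr_norml ltNge; apply/negP => h; move: c0; apply/negP; rewrite -leNgt.
rewrite -(cos_norm (arg q)) -(@cos_pihalf R) leNgt ltr_cos ?in_itv/= ?normr_ge0 ?arg_le_pi//.
  by rewrite -leNgt.
by rewrite divr_ge0 ?pi_ge0//=; have := @pi_gt0 R; lra.
Qed.

Lemma claplace_one q : 0 < Re q ->
  cL1 (laplace_integrand (onpos (fun=> 1)) q) /\ claplace (onpos (fun=> 1)) q = q^-1.
Proof.
move=> q0; have qn : q != 0 by apply: contraTneq q0 => ->; rewrite ltxx.
have n0 := normc_gt0 qn.
have [h1 h2] := claplace_power_kernel (@ltr01 R) n0 (arg_pihalf q0).
have E : onpos (fun=> 1) = power_kernel 1 :> (R -> R).
  by apply/funext => t; rewrite /onpos; case: ifP => t0; [rewrite power_kernel1|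
    rewrite /power_kernel /onpos t0].
rewrite -(polarE q) in h1 h2; rewrite E; split=> //; rewrite h2.
have -> : q^-1 = (ray (normc q) (arg q))^-1 by rewrite -polarE.
rewrite /polar_powR /ray mulN1r cisN invfM powR_inv1 ?(ltW n0)//; congr (_ * _).
by rewrite fmorphV.
Qed.

Lemma cancel_radius (a w u : R[i]) (r : R) : 0 < r ->
  a * w * u = (r^-1)%:C * (a * (r%:C * w * u)).
Proof.
move=> r0; have rn : (r^-1)%:C * r%:C = 1 by rewrite -realcM mulVf// gt_eqF.
have -> : (r^-1)%:C * (a * (r%:C * w * u)) = ((r^-1)%:C * r%:C) * (a * w * u) by ring.
by rewrite rn mul1r.
Qed.

Definition hankel_weight H (phi r : R) : R[i] := onposc (fun r => H r phi * cis phi) r.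

Definition hankel_kernel H (phi t r : R) : R :=
  Im (hankel_weight H phi r * cexp (ray r phi * t%:C)).

(* H is real on the real axis, hence the lower ray contributes the conjugate of
   the upper one. *)
Definition hankel H (phi t : R) : R := pi^-1 * \int[mu]_r hankel_kernel H phi t r.

(** * Decay and Laplace transform of the integral over a ray of the left half plane *)

Section Contour.
Variables (H H' : R -> R -> R[i]) (z v phi C : R).
Hypotheses (z0 : 0 < z) (z1 : z < 1) (C0 : 0 <= C) (vp : v < pi).
Hypotheses (phi1 : pi / 2 < phi) (phi2 : phi < v).
Hypothesis hH : forall r x : R, 0 < r -> - v < x < v ->
  [/\ polar_derive H H' r x, normc (H r x) <= C * ray_bound z r &
      r * normc (H' r x) <= C * ray_bound z r].

(** Positive because phi > pi / 2: on the ray, |exp (s t)| = exp (- c t r). *)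
Let c : R := - cos phi.

Let phi0 : 0 < phi.
Proof. by apply: lt_trans phi1; rewrite divr_gt0// pi_gt0. Qed.

Let phiv : - v < phi < v.
Proof. by rewrite phi2 andbT (lt_trans _ phi0)// oppr_lt0 (lt_trans phi0). Qed.

Let c0 : 0 < c.
Proof.
rewrite oppr_gt0 -(@cos_pihalf R) ltr_cos ?in_itv//=.
  by rewrite divr_ge0 ?pi_ge0//= ler_pdivrMr// ler_peMr ?pi_ge0// ler1n.
by rewrite (ltW phi0) ltW// (lt_trans phi2).
Qed.

Let weight_le (r : R) : normc (hankel_weight H phi r) <= onpos (fun r => C * ray_bound z r) r.
Proof.
rewrite /hankel_weight /onposc /onpos; case: ifP => r0; last by rewrite ComplexField.Normc.normc0.
by rewrite normcM normc_cis mulr1; have [] := hH r0 phiv.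
Qed.

Let weight_le_powR (r : R) : normc (hankel_weight H phi r) <= C * onpos (fun r => r `^ (z - 1)) r.
Proof.
apply: le_trans (weight_le r) _; rewrite /onpos; case: ifP => r0; last by rewrite mulr0.
by rewrite ler_wpM2l// ge_min lexx.
Qed.

Let measurable_weight :
  measurable_fun setT (fun r => Re (hankel_weight H phi r)) /\
  measurable_fun setT (fun r => Im (hankel_weight H phi r)).
Proof.
have cw (r : R) : 0 < r -> ccont (fun r => H r phi * cis phi) r.
  move=> r0; have [d _ _] := hH r0 phiv.
  by apply: ccont_mul; [exact: polar_derive_ccont d|exact: ccont_cst].
split.
- under eq_fun do rewrite /hankel_weight Re_onposc.
  by apply: measurable_onpos => r r0; case: (cw r r0).
- under eq_fun do rewrite /hankel_weight Im_onposc.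
  by apply: measurable_onpos => r r0; case: (cw r r0).
Qed.

Let normc_exp (t r : R) : normc (cexp (ray r phi * t%:C)) = expR (- (c * t * r)).
Proof.
by rewrite normc_cexp ReMR /ray ReRM /=; congr expR; rewrite /c; ring.
Qed.

Let kernel_le (t r : R) : `|hankel_kernel H phi t r| <=
  C * onpos (fun r => r `^ (z - 1) * expR (- (c * t * r))) r.
Proof.
apply: le_trans (normc_Im _) _; rewrite normcM normc_exp.
apply: le_trans (ler_wpM2r (expR_ge0 _) (weight_le_powR r)) _.
rewrite -(mulrA C); apply: ler_wpM2l => //.
by rewrite /onpos; case: ifP => //; rewrite mul0r.
Qed.

Let exp_re (t r : R) : Re (cexp (ray r phi * t%:C)) =
  expR (r * cos phi * t) * cos (r * sin phi * t).
Proof. by rewrite Re_cexp ReMR ImMR /ray ReRM ImRM. Qed.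

Let exp_im (t r : R) : Im (cexp (ray r phi * t%:C)) =
  expR (r * cos phi * t) * sin (r * sin phi * t).
Proof. by rewrite Im_cexp ReMR ImMR /ray ReRM ImRM. Qed.

Let kernelE (t r : R) : hankel_kernel H phi t r =
  Re (hankel_weight H phi r) * (expR (r * cos phi * t) * sin (r * sin phi * t)) +
  Im (hankel_weight H phi r) * (expR (r * cos phi * t) * cos (r * sin phi * t)).
Proof. by rewrite /hankel_kernel ImM exp_re exp_im. Qed.

Let measurable_kernel (t : R) : measurable_fun setT (hankel_kernel H phi t).
Proof.
have [m1 m2] := measurable_weight.
rewrite (funext (kernelE t)); apply: measurable_funD; apply: measurable_funM => //.
- by apply: measurable_for_continuous => r; cont.
- by apply: measurable_for_continuous => r; cont.
Qed.

Let L1_kernel (t : R) : 0 < t -> L1 (hankel_kernel H phi t).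
Proof.
move=> t0; apply: L1_le (kernel_le t) _; first exact: measurable_kernel.
by apply: L1Z; exact: L1_powR_expR z0 (mulr_gt0 c0 t0).
Qed.

(** Only the branch r^{z-1} of the bound on H is used: integrated against exp (- c t r) it gives
    Gamma(z) (c t)^{-z}. *)
Lemma hankel_le : exists2 M, 0 <= M & forall t : R, 0 < t -> `|hankel H phi t| <= M * t `^ (- z).
Proof.
have ct t : 0 < t -> \int[mu]_r onpos (fun r => r `^ (z - 1) * expR (- (c * t * r))) r =
    Gamma z * (c * t) `^ (- z).
  move=> t0; have [_ <-] := power_kernel_laplace z0 (mulr_gt0 c0 t0).
  have [L _] := power_kernel_laplace z0 (mulr_gt0 c0 t0).
  rewrite -RintegralZl//; apply: eq_Rintegral => r _.
  rewrite /power_kernel /onpos; case: ifP => r0; last by rewrite !mulr0.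
  by field; rewrite gt_eqF ?Gamma_gt0.
exists (pi^-1 * (C * (Gamma z * c `^ (- z)))).
  by rewrite mulr_ge0 ?invr_ge0 ?pi_ge0// mulr_ge0// mulr_ge0 ?powR_ge0 ?ltW ?Gamma_gt0.
move=> t t0; rewrite /hankel normrM ger0_norm ?invr_ge0 ?pi_ge0// -mulrA.
apply: ler_wpM2l; first by rewrite invr_ge0 pi_ge0.
apply: le_trans (le_normr_Rintegral measurableT (L1_kernel t0)) _.
have L := L1_powR_expR z0 (mulr_gt0 c0 t0).
apply: (@le_trans _ _ (\int[mu]_r (C * onpos (fun r => r `^ (z - 1) * expR (- (c * t * r))) r))).
  by apply: le_Rintegral => //; [exact/L1_normr/L1_kernel|exact: L1Z].
rewrite RintegralZl// ct// powRM ?(ltW c0) ?(ltW t0)//.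
by rewrite !mulrA.
Qed.

Lemma hankel_cvg0 : hankel H phi @ +oo --> (0 : R).
Proof.
have [M M0 hM] := hankel_le.
have B t : 0 < t -> - (M * t^-1 `^ z) <= hankel H phi t <= M * t^-1 `^ z.
  move=> t0; rewrite -ler_norml; have -> : t^-1 `^ z = t `^ (- z); last exact: hM.
  by rewrite -[in LHS]powR_inv1 ?(ltW t0)// -powRrM mulN1r.
have l : (fun t : R => M * t^-1 `^ z) @ +oo --> (0 : R).
  rewrite -[X in _ --> X](mulr0 M); apply: cvgM; first exact: cvg_cst.
  exact: (cvg_comp _ _ (@invr_cvg_at_right R) (powR_cvg0 z0)).
apply: (@squeeze_cvgr _ _ _ _ (fun t => - (M * t^-1 `^ z)) (fun t => M * t^-1 `^ z)) => //.
- by near=> t; apply: B; near: t; exact: nbhs_pinfty_gt.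
- by rewrite -[X in _ --> X]oppr0; exact: cvgN.
Unshelve. all: end_near. Qed.

Lemma hankel_continuous (t : R) : 0 < t -> {for t, continuous (hankel H phi)}.
Proof.
move=> t0; apply: cont_mul; first by cont.
have ct : 0 < c * (t / 2) by rewrite mulr_gt0// divr_gt0.
apply: (@continuity_under_integral R _ _ mu (hankel_kernel H phi) setT measurableT (t / 2) (2 * t)
  _ _ (fun r => C * onpos (fun r => r `^ (z - 1) * expR (- (c * (t / 2) * r))) r)).
- by move=> x /=; rewrite in_itv/= => /andP[x1 _]; apply: L1_kernel; lra.
- apply: aeW => r _ x _; rewrite (funext (kernelE^~ r)).
  have cc (a b : R) : {for x, continuous (fun t : R => a * (expR (r * cos phi * t) *
      sin (r * sin phi * t)) + b * (expR (r * cos phi * t) * cos (r * sin phi * t)))} by cont.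
  exact: cc.
- by apply: L1Z; exact: L1_powR_expR.
- move=> x /=; rewrite in_itv/= => /andP[x1 _]; apply: aeW => r _.
  apply: le_trans (kernel_le x r) _; apply: ler_wpM2l => //; rewrite /onpos; case: ifP => // r0.
  rewrite ler_wpM2l ?powR_ge0// ler_expR lerN2 ler_wpM2r ?(ltW r0)// ler_wpM2l ?(ltW c0)//.
  exact: ltW.
- by rewrite inE/= in_itv/=; apply/andP; lra.
Qed.

(** The bound t^{-z} is integrable at 0 because z < 1. *)
Lemma L1_exp_hankel (p : R) : 0 < p -> L1 (fun t => expR (- (p * t)) * onpos (hankel H phi) t).
Proof.
move=> p0; have [M M0 hM] := hankel_le.
have E t : expR (- (p * t)) * onpos (hankel H phi) t =
    onpos (fun t => expR (- (p * t)) * hankel H phi t) t.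
  by rewrite /onpos; case: ifP; rewrite ?mulr0.
rewrite (funext E).
apply: (@L1_onpos_le _ _ (fun t => M * (t `^ (1 - z - 1) * expR (- (p * t))))).
- move=> t t0; apply: cont_mul; first by cont.
  exact: hankel_continuous.
- move=> t t0; rewrite normrM (ger0_norm (expR_ge0 _)) [leRHS]mulrA [leRHS]mulrC.
  rewrite ler_pM2l ?expR_gt0//; rewrite addrAC subrr add0r; exact: hM.
- by rewrite onposZ; apply: L1Z; apply: L1_powR_expR; rewrite // subr_gt0.
Qed.

(** By Fubini the exponential exp (s t) is transformed under the integral into 1 / (p - s), which
    leaves the Cauchy integral of H. *)
Lemma hankel_laplace (p : R) : 0 < p -> (forall r : R, 0 < r -> Im (H r 0) = 0) ->
  \int[mu]_t (expR (- (p * t)) * onpos (hankel H phi) t) = Re (H p 0).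
Proof.
move=> p0 realH.
have hS : sector_bound v (ray_bound z) H by exists H', C.
have pv : pi / 2 < v := lt_trans phi1 phi2.
have ph : 0 < phi < v by rewrite phi0.
have JE := cauchy_formula z0 z1 p0 pv vp hS realH ph.
have pin : pi != 0 :> R by rewrite gt_eqF// pi_gt0.
pose q r := p%:C - ray r phi.
have Rq r : Re (q r) = p + c * r by rewrite /q ReD ReN /ray ReRM /= /c; ring.
have Rq0 r : 0 < r -> 0 < Re (q r) by move=> r0; rewrite Rq addr_gt0// mulr_gt0.
pose F (w : R * R) : R := onpos (fun=> 1) w.1 * (expR (- (p * w.1)) * hankel_kernel H phi w.1 w.2).
have FE t r : F (t, r) =
    Im (hankel_weight H phi r * laplace_integrand (onpos (fun=> 1)) (q r) t).
  rewrite /F /= /hankel_kernel /laplace_integrand /q.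
  have -> : - ((p%:C - ray r phi) * t%:C) = (- (p * t))%:C + ray r phi * t%:C.
    by move: (ray r phi) => s; apply: eqcP; rewrite !ReIm /=; ring.
  rewrite cexpD; have -> : cexp (- (p * t))%:C = (expR (- (p * t)))%:C.
    by rewrite /cexp /= cis0 mulr1.
  move: (onpos _ t) (expR _) (cexp _) (hankel_weight H phi r) => a b e w.
  by rewrite !(ImM, ReM) /=; ring.
have w0 r : r <= 0 -> hankel_weight H phi r = 0 by rewrite /hankel_weight /onposc leNgt => /negbTE ->.
have Fz r : r <= 0 -> (fun t => F (t, r)) = fun=> 0.
  by move=> r0; apply/funext => t; rewrite FE w0// mul0r.
have FL r : L1 (fun t => F (t, r)).
  have [r0|r0] := ltP 0 r; last by rewrite (Fz r r0); exact: L10.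
  have [cl _] := claplace_one (Rq0 r r0).
  by have [_] := cL1Z (hankel_weight H phi r) cl; under eq_fun do rewrite -FE.
have ray0 r : 0 < r -> 0 < p + c * r by move=> r0; rewrite addr_gt0// mulr_gt0.
(* Re (p - s) = p + c r >= m (1 + r), so that integrating |F| in t gives at most C [ray_bound] / (m
   (1 + r)), of the form handled by [ray_bound_decay]. *)
pose m := Num.min p c.
have m0 : 0 < m by rewrite lt_min p0.
pose G := onpos (fun r => C / m * (4 * algebraic_decay z r)).
have GL : L1 G by rewrite /G onposZ; apply: L1Z; rewrite onposZ; exact/L1Z/L1_algebraic_decay.
have [Fx Fy Exy] : [/\ L1 (fun t => \int[mu]_r F (t, r)), L1 (fun r => \int[mu]_t F (t, r)) &
      \int[mu]_t \int[mu]_r F (t, r) = \int[mu]_r \int[mu]_t F (t, r)].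
  apply: (fubini_line _ FL GL).
  - have [m1 m2] := measurable_weight.
    have mK : measurable_fun setT (fun w : R * R => w.2 * cos phi * w.1).
      by apply: measurable_funM => //; apply: measurable_funM.
    have mS : measurable_fun setT (fun w : R * R => w.2 * sin phi * w.1).
      by apply: measurable_funM => //; apply: measurable_funM.
    have mE : measurable_fun setT (fun w : R * R => expR (w.2 * cos phi * w.1)).
      by apply: measurableT_comp mK; exact: measurable_expR.
    rewrite /F; apply: measurable_funM.
      apply: (@measurableT_comp _ _ _ _ _ _ (onpos (fun=> 1 : R))) => //.
      by apply: measurable_onpos => t _; cont.
    apply: measurable_funM.
      apply: (@measurableT_comp _ _ _ _ _ _ (fun t : R => expR (- (p * t)))) => //.
      by apply: measurable_for_continuous => t; cont.
    rewrite (_ : (fun w : R * R => _) = fun w : R * R => 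
      Re (hankel_weight H phi w.2) * (expR (w.2 * cos phi * w.1) * sin (w.2 * sin phi * w.1)) +
      Im (hankel_weight H phi w.2) * (expR (w.2 * cos phi * w.1) * cos (w.2 * sin phi * w.1))); last first.
      by apply/funext => w; rewrite kernelE.
    apply: measurable_funD; apply: measurable_funM.
    + exact: (measurableT_comp m1).
    + apply: measurable_funM => //; apply: (measurableT_comp _ mS).
      by apply: continuous_measurable_fun; exact: continuous_sin.
    + exact: (measurableT_comp m2).
    + apply: measurable_funM => //; apply: (measurableT_comp _ mS).
      by apply: continuous_measurable_fun; exact: continuous_cos.
  - move=> r; have [r0|r0] := ltP 0 r; last first.
      under eq_Rintegral do rewrite FE w0// mul0r /= normr0.
      by rewrite Rintegral_zero /G onpos0.
    have [L I] := power_kernel_laplace (@ltr01 R) (ray0 r r0).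
    apply: (@le_trans _ _ (\int[mu]_t (C * ray_bound z r * (expR (- ((p + c * r) * t)) * power_kernel 1 t)))).
      apply: le_Rintegral => //; first exact/L1_normr/FL.
        exact: L1Z.
      move=> t _; rewrite /F /= normrM normrM (ger0_norm (expR_ge0 _)) /onpos.
      case: ifP => t0; last first.
        by rewrite normr0 mul0r /power_kernel /onpos t0 !mulr0.
      rewrite normr1 mul1r power_kernel1// mulr1.
      have : `|hankel_kernel H phi t r| <= C * ray_bound z r * expR (- (c * t * r)).
        apply: le_trans (normc_Im _) _; rewrite normcM normc_exp ler_wpM2r ?expR_ge0//.
        by have := weight_le r; rewrite onposE.
      move=> h; apply: le_trans (ler_wpM2l (expR_ge0 _) h) _.
      rewrite mulrCA -expRD le_eqVlt; apply/orP; left; apply/eqP; congr (_ * expR _); ring.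
    rewrite RintegralZl// I powR_inv1 ?(ltW (ray0 r r0))// /G onposE//.
    have h0 : 0 < 1 + r by rewrite addr_gt0.
    apply: (@le_trans _ _ (C * ray_bound z r * (m * (1 + r))^-1)).
      apply: ler_wpM2l; first by rewrite mulr_ge0 ?ray_bound_ge0.
      rewrite lef_pV2 ?posrE ?mulr_gt0 ?ray0//.
      rewrite mulrDr mulr1 lerD ?ge_min ?lexx//.
      by rewrite ler_wpM2r ?(ltW r0)// ge_min lexx orbT.
    have -> : C * ray_bound z r / (m * (1 + r)) = C / m * (ray_bound z r / (1 + r)).
      by field; rewrite !gt_eqF.
    by apply: ler_wpM2l; [rewrite divr_ge0// ltW|exact: ray_bound_decay].
have h1 t : expR (- (p * t)) * onpos (hankel H phi) t = pi^-1 * \int[mu]_r F (t, r).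
  rewrite /F /= /onpos; case: ifP => t0; last first.
    under eq_Rintegral do rewrite mul0r.
    by rewrite Rintegral_zero !mulr0.
  under eq_Rintegral do rewrite mul1r.
  rewrite RintegralZl; [|exact: measurableT|exact: L1_kernel].
  exact: mulrCA.
under eq_Rintegral do rewrite h1.
rewrite RintegralZl; [|exact: measurableT|exact: Fx].
rewrite Exy.
have h2 r : \int[mu]_t F (t, r) = Im (onposc (fun r => cauchy_integrand H p r phi) r).
  have [r0|r0] := ltP 0 r; last first.
    by rewrite (Fz r r0) Rintegral_zero /onposc ltNge r0.
  have [cl cE] := claplace_one (Rq0 r r0).
  under eq_Rintegral do rewrite FE.
  rewrite -(Im_cint (fun t => hankel_weight H phi r * laplace_integrand (onpos (fun=> 1)) (q r) t)).
  rewrite (cintZ (hankel_weight H phi r) cl).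
  have -> : cint (laplace_integrand (onpos (fun=> 1)) (q r)) = (q r)^-1 := cE.
  have -> : hankel_weight H phi r = H r phi * cis phi by rewrite /hankel_weight /onposc r0.
  have -> : onposc (fun r => cauchy_integrand H p r phi) r = cauchy_integrand H p r phi.
    by rewrite /onposc r0.
  rewrite /cauchy_integrand; congr Im.
  exact: cancel_radius.
under eq_Rintegral do rewrite h2.
rewrite -Im_cint.
rewrite JE; exact: (mulKf pin).
Qed.

End Contour.
End Hankel.

(** * Inverse transforms of p^a times rational functions of p^alpha *)

Section RationalInversion.
Variable R : realType.
Local Notation mu := (@lebesgue_measure R).
Local Notation Re := (@complex.Re R).
Local Notation Im := (@complex.Im R).
Local Notation normc := (@ComplexField.Normc.normc R).
Local Notation "x %:C" := (real_complex R x).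
Implicit Types (H : R -> R -> R[i]) (s : seq R[i]).

Lemma cos_le_away2 (e x : R) : 0 < e -> e <= pi -> e <= `|x| <= 2 * pi - e -> cos x <= cos e.
Proof.
move=> e0 ep /andP[ex xe]; have [xp|px] := leP `|x| pi.
  by apply: (@cos_le_away R e pi) => //; rewrite ex.
rewrite -(cos_norm x) -(cosN `|x|) -(cosD2pi _); apply: (@cos_le_away R e pi) => //.
have -> : - `|x| + pi *+ 2 = 2 * pi - `|x| by rewrite mulr2n; ring.
by rewrite ger0_norm; [apply/andP; lra|lra].
Qed.

(** The angles alpha x stay at distance e from arg zeta, also modulo 2 pi, since alpha v + |arg
    zeta| = 2 |arg zeta| - e <= 2 pi - e. *)
Lemma sector_bound_root (v alpha : R) (zeta : R[i]) : 0 < alpha -> 0 < v ->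
  alpha * v < `|arg zeta| ->
  sector_bound v (fun r => (1 + r `^ alpha)^-1) (fun r x => (polar_powR alpha r x - zeta)^-1).
Proof.
move=> a0 v0 hz; have z0 : zeta != 0.
  apply: contraTneq hz => ->; rewrite /arg eqxx normr0 -leNgt mulr_ge0 ?ltW//.
pose e := `|arg zeta| - alpha * v.
have yp := arg_le_pi zeta.
have av0 : 0 < alpha * v by rewrite mulr_gt0.
have e0 : 0 < e by rewrite subr_gt0.
have ep : e <= pi by rewrite /e; lra.
rewrite [in X in sector_bound _ _ X](polarE zeta).
apply: (@sector_bound_resolvent _ v alpha (Num.max 0 (cos e))) => //.
- exact: normc_gt0.
- by rewrite gt_max ltr01 cos_lt1// e0.
- move=> x /andP[x1 x2]; rewrite le_max; apply/orP; right; apply: cos_le_away2 => //.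
  have xv : `|x| < v by rewrite ltr_norml x1.
  have ax : `|alpha * x| <= alpha * v by rewrite normrM (gtr0_norm a0) ler_wpM2l// ltW.
  have d1 : `|alpha * x - arg zeta| <= `|alpha * x| + `|arg zeta| by exact: ler_normB.
  have d2 : `|arg zeta| - `|alpha * x| <= `|alpha * x - arg zeta|.
    by rewrite distrC; exact: lerB_dist.
  by apply/andP; rewrite /e; lra.
Qed.

Lemma sector_bound_ext (v : R) f g F G : (forall r : R, f r = g r) ->
  (forall r x : R, F r x = G r x) -> @sector_bound R v f F -> sector_bound v g G.
Proof. by move=> /funext -> h; have -> : F = G by apply/funext => r; apply/funext. Qed.

Lemma sector_bound_roots (v alpha : R) s : 0 < alpha -> 0 < v ->
  (forall zeta, zeta \in s -> alpha * v < `|arg zeta|) ->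
  sector_bound v (fun r => (1 + r `^ alpha)^-1 ^+ size s)
    (fun r x => (\prod_(zeta <- s) (polar_powR alpha r x - zeta))^-1).
Proof.
move=> a0 v0; elim: s => [_|zeta s IH hs].
  by apply: sector_bound_ext (sector_bound_cst v 1) => // r x; rewrite big_nil invr1.
have hz : alpha * v < `|arg zeta| by apply: hs; rewrite mem_head.
have hs' xi : xi \in s -> alpha * v < `|arg xi|.
  by move=> h; apply: hs; rewrite inE h orbT.
apply: sector_bound_ext (sector_boundM (sector_bound_root a0 v0 hz) (IH hs')).
  by move=> r; rewrite exprS.
by move=> r x; rewrite big_cons invfM.
Qed.

Lemma sector_bound_exp (v alpha : R) (j : nat) :
  sector_bound v (fun r => (r `^ alpha) ^+ j) (fun r x => polar_powR alpha r x ^+ j).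
Proof.
elim: j => [|j IH]; first exact: (sector_bound_cst v 1).
apply: sector_bound_ext (sector_boundM (sector_bound_powR v alpha) IH).
  by move=> r; rewrite exprS.
by move=> r x; rewrite exprS.
Qed.

(** At 0 the worse exponent is alpha - 2, and at infinity it is alpha - 1 - alpha = -1: these are
    the two branches of [ray_bound] for z = alpha - 1. *)
Lemma powR_quotient_le (alpha a r : R) : 1 < alpha -> alpha < 2 -> 0 < r ->
  a = alpha - 1 \/ a = alpha - 2 -> r `^ a / (1 + r `^ alpha) <= ray_bound (alpha - 1) r.
Proof.
move=> a1 a2 r0 ha; have ap : 0 < alpha by lra.
have b0 : 0 < 1 + r `^ alpha by rewrite addr_gt0// powR_gt0.
have mono (x y : R) : 0 <= x -> x <= y -> r `^ x <= 1 + r `^ y.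
  move=> x0 xy; have [r1|r1] := leP r 1.
    rewrite (@le_trans _ _ 1)// ?lerDl ?powR_ge0//.
    have -> : 1 = (1 : R) `^ x by rewrite powR1.
    by rewrite ge0_ler_powR ?nnegrE ?(ltW r0).
  by rewrite (@le_trans _ _ (r `^ y)) ?ler_powR ?(ltW r1)// lerDr.
have r1 : r `^ (-1) = r^-1 by rewrite powR_inv1// ltW.
rewrite /ray_bound le_min; apply/andP; split; rewrite ler_pdivrMr//.
- case: ha => ->; last first.
    have -> : alpha - 1 - 1 = alpha - 2 by ring.
    by rewrite ler_peMr ?powR_ge0// lerDl powR_ge0.
  rewrite (_ : alpha - 1 = (alpha - 1 - 1) + 1); last by ring.
  rewrite powRDgt0// subrK ler_wpM2l ?powR_ge0//.
  by apply: mono => //; exact: ltW.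
- rewrite -r1; case: ha => ->.
    rewrite (_ : alpha - 1 = -1 + alpha); last by ring.
    by rewrite powRDgt0// ler_wpM2l ?powR_ge0// lerDr.
  rewrite (_ : alpha - 2 = -1 + (alpha - 1)); last by ring.
  by rewrite powRDgt0// ler_wpM2l ?powR_ge0//; apply: mono; lra.
Qed.

(** Finitely many strict inequalities leave room for a sector slightly wider than the right half
    plane. *)
Lemma sector_opening (alpha : R) s : 0 < alpha -> alpha < 2 ->
  (forall zeta, zeta \in s -> pi / 2 * alpha < `|arg zeta|) ->
  exists v : R, [/\ pi / 2 < v, v < pi & forall zeta, zeta \in s -> alpha * v < `|arg zeta|].
Proof.
move=> a0 a2; have p0 := @pi_gt0 R; elim: s => [_|zeta s IH hs].
  by exists (3 / 4 * pi); split => //; lra.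
have [zeta' zs|v [v1 v2 v3]] := IH; first by apply: hs; rewrite inE zs orbT.
have hz : pi / 2 < `|arg zeta| / alpha by rewrite ltr_pdivlMr// hs// mem_head.
pose w := (`|arg zeta| / alpha + pi / 2) / 2.
have w1 : pi / 2 < w by rewrite /w; lra.
have w2 : w < `|arg zeta| / alpha by rewrite /w; lra.
exists (Num.min v w); split.
- by rewrite lt_min v1.
- by rewrite gt_min v2.
- move=> xi; rewrite inE => /orP[/eqP ->|/v3 h].
    rewrite mulrC -ltr_pdivlMr// (le_lt_trans _ w2)// ge_min lexx orbT//.
  by apply: le_lt_trans h; rewrite ler_pM2l// ge_min lexx.
Qed.

Lemma laplace_inversion (z v : R) H : 0 < z -> z < 1 -> pi / 2 < v -> v < pi ->
  sector_bound v (ray_bound z) H -> (forall r : R, 0 < r -> Im (H r 0) = 0) ->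
  exists h : R -> R, [/\ forall t : R, 0 < t -> {for t, continuous h},
    h @ +oo --> (0 : R) &
    forall p : R, 0 < p -> L1 (fun t => expR (- (p * t)) * onpos h t) /\
      \int[mu]_t (expR (- (p * t)) * onpos h t) = Re (H p 0)].
Proof.
move=> z0 z1 pv vp [H' [C [C0 hH]]] realH; pose phi := (pi / 2 + v) / 2.
have p1 : pi / 2 < phi by rewrite /phi; lra.
have p2 : phi < v by rewrite /phi; lra.
exists (hankel H phi); split.
- by move=> t; exact: (hankel_continuous z0 C0 vp p1 p2 hH).
- exact: (hankel_cvg0 z0 C0 vp p1 p2 hH).
- move=> p p0; split; first exact: (L1_exp_hankel z0 z1 C0 vp p1 p2 hH).
  exact: (hankel_laplace z0 z1 C0 vp p1 p2 hH).
Qed.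

Lemma rational_inversion (alpha a : R) (Q : {poly R}) (j : nat) : 1 < alpha -> alpha < 2 ->
  Q != 0 -> (forall zeta, root (map_poly (real_complex R) Q) zeta -> pi / 2 * alpha < `|arg zeta|) ->
  a = alpha - 1 \/ a = alpha - 2 -> (j.+1 < size Q)%N ->
  exists h : R -> R, [/\ forall t : R, 0 < t -> {for t, continuous h},
    h @ +oo --> (0 : R) &
    forall p : R, 0 < p -> L1 (fun t => expR (- (p * t)) * onpos h t) /\
      \int[mu]_t (expR (- (p * t)) * onpos h t) = p `^ a * ((p `^ alpha) ^+ j / Q.[p `^ alpha])].
Proof.
move=> a1 a2 Q0 hQ ha jQ; have a0 : 0 < alpha by lra.
pose QC := map_poly (real_complex R) Q.
have [s QE] := closed_field_poly_normal QC.
have lE : lead_coef QC = (lead_coef Q)%:C by rewrite lead_coef_map.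
have l0 : lead_coef Q != 0 by rewrite lead_coef_eq0.
have l0C : lead_coef QC != 0 by rewrite lE fmorph_eq0.
have sQ : size Q = (size s).+1.
  by rewrite -(size_map_poly (real_complex R) Q) -/QC QE size_scale// size_prod_XsubC.
have rs zeta : zeta \in s -> pi / 2 * alpha < `|arg zeta|.
  by move=> zs; apply: hQ; rewrite -/QC QE rootZ// root_prod_XsubC.
have [v [pv vp hv]] := sector_opening a0 a2 rs.
have v0 : 0 < v by apply: lt_trans pv; rewrite divr_gt0// pi_gt0.
pose P (r x : R) := \prod_(zeta <- s) (polar_powR alpha r x - zeta).
pose H (r x : R) : R[i] := (lead_coef Q)%:C^-1 *
  (polar_powR a r x * (polar_powR alpha r x ^+ j * (P r x)^-1)).
have hH : sector_bound v (ray_bound (alpha - 1)) H.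
  apply: sector_boundZ.
  have := sector_boundM (sector_bound_powR v a)
    (sector_boundM (sector_bound_exp v alpha j) (sector_bound_roots a0 v0 hv)).
  apply: sector_bound_le (@ler01 R) _ => r r0; rewrite mul1r.
  apply: le_trans (powR_quotient_le a1 a2 r0 ha); apply: ler_wpM2l; first exact: powR_ge0.
  have w0 := powR_ge0 r alpha; have b0 : 0 < 1 + r `^ alpha by rewrite addr_gt0// powR_gt0.
  have ib : (1 + r `^ alpha)^-1 <= 1 by rewrite invf_le1// lerDl.
  have i0 : 0 <= (1 + r `^ alpha)^-1 by rewrite invr_ge0 ltW.
  (* Let w be r^alpha. Of the deg Q factors 1 / (1 + w), one is kept for [powR_quotient_le], j
     absorb w^j, and the others are at most 1. *)
  rewrite sQ ltnS in jQ; rewrite -(subnK jQ) addnS exprS exprD mulrCA ler_piMr//.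
  rewrite mulrCA -exprMn mulr_ile1 ?exprn_ge0 ?mulr_ge0 ?exprn_ile1 ?mulr_ge0//.
  by rewrite ler_pdivrMr// mul1r lerDr.
have HE (p : R) : 0 < p -> H p 0 = (p `^ a * ((p `^ alpha) ^+ j / Q.[p `^ alpha]))%:C.
  move=> p0; have pE b : polar_powR b p 0 = (p `^ b)%:C by rewrite /polar_powR mulr0 cis0 mulr1.
  have QP : QC.[(p `^ alpha)%:C] = (lead_coef Q)%:C * P p 0.
    rewrite {1}QE hornerZ lE horner_prod /P pE; congr (_ * _).
    by apply: eq_bigr => zeta _; rewrite hornerXsubC.
  rewrite horner_map in QP.
  rewrite /H !pE !rmorphM fmorphV rmorphXn; rewrite -[X in _ = _ * (_ * X^-1)]/(real_complex R Q.[p `^ alpha]) QP invfM.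
  by rewrite mulrCA; congr (_ * _); rewrite mulrCA; congr (_ * _).
have z0 : 0 < alpha - 1 by rewrite subr_gt0.
have z1 : alpha - 1 < 1 by lra.
have realH (r : R) : 0 < r -> Im (H r 0) = 0 by move=> r0; rewrite HE.
have [h [h1 h2 h3]] := laplace_inversion z0 z1 pv vp hH realH.
exists h; split=> // p p0; have [L I] := h3 p p0; split=> //.
by rewrite I HE.
Qed.

End RationalInversion.

(** * Reduction to a normal form *)

Section NormalForm.
Variable R : realType.
Local Notation mu := (@lebesgue_measure R).
Local Notation "x %:C" := (real_complex R x).

Lemma caputo_differentiable_cont (f : R -> R) : caputo_differentiable f ->
  forall t : R, 0 < t -> {for t, continuous f}.
Proof.
move=> [_ df _] t /df[d _ _].
exact: der_continuous (DeriveDef d erefl).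
Qed.

Lemma der_sum (n : nat) (f : 'I_n -> R -> R) (df : 'I_n -> R) (t : R) :
  (forall i, is_derive t 1 (f i) (df i)) ->
  is_derive t 1 (fun s => \sum_i f i s) (\sum_i df i).
Proof.
elim: n f df => [|n IH] f df h.
  by rewrite big_ord0; under eq_fun do rewrite big_ord0; exact: der_cst.
rewrite big_ord_recl; under eq_fun do rewrite big_ord_recl.
by apply: der_add => //; exact: IH.
Qed.

Lemma derive_lincomb0 (n : nat) (a : 'I_n -> R) (f df : 'I_n -> R -> R) :
  (forall i (t : R), 0 < t -> is_derive t 1 (f i) (df i t)) ->
  (forall t : R, 0 < t -> \sum_i a i * f i t = 0) ->
  forall t : R, 0 < t -> \sum_i a i * df i t = 0.
Proof.
move=> dff f0 t t0.
have d1 : is_derive t 1 (fun s => \sum_i a i * f i s) (\sum_i a i * df i t).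
  by apply: der_sum => i; apply: der_scale; exact: dff.
have e : 'D_1 (fun s => \sum_i a i * f i s) t = 'D_1 (fun=> 0 : R) t.
  by apply: near_eq_derive; near=> s; rewrite f0//; near: s; exact: lt_nbhsr.
by have [_ <-] := d1; rewrite e; have [_ ->] := der_cst t (0 : R).
Unshelve. all: end_near. Qed.

(** The relation is differentiated twice and integrated against the kernel. Preserving linear
    relations is the only form in which D^alpha is applied repeatedly. *)
Lemma caputo_lincomb0 (alpha : R) (n : nat) (a : 'I_n -> R) (f : 'I_n -> R -> R) :
  1 < alpha -> alpha < 2 -> (forall i, caputo_differentiable (f i)) ->
  (forall t : R, 0 < t -> \sum_i a i * f i t = 0) ->
  forall t : R, 0 < t -> \sum_i a i * caputo alpha (f i) t = 0.
Proof.
move=> a1 a2 hf f0 t t0.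
have f1 : forall t : R, 0 < t -> \sum_i a i * (f i)^`()%classic t = 0.
  apply: (derive_lincomb0 _ f0) => i s s0; have [_ /(_ s s0) [d _ _] _] := hf i.
  by rewrite derive1E; exact: DeriveDef.
have f2 : forall t : R, 0 < t -> \sum_i a i * (f i)^`(2)%classic t = 0.
  apply: (derive_lincomb0 _ f1) => i s s0; have [_ /(_ s s0) [_ d _] _] := hf i.
  by rewrite /= derive1E; exact: DeriveDef.
have T0 : 0 < t + 1 by rewrite addr_gt0.
have tT : t < t + 1 by rewrite ltrDl.
pose k i s := power_kernel (2 - alpha) (t - s) * truncate (t + 1) (f i)^`(2)%classic s.
have kL i : L1 (k i) := (caputo_conv a1 a2 (hf i) T0 tT).1.
have kE i : caputo alpha (f i) t = \int[mu]_s k i s.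
  by have [_] := caputo_conv a1 a2 (hf i) T0 tT; rewrite onposE.
have sumI (m : nat) (b : 'I_m -> R) (g : 'I_m -> R -> R) : (forall i, L1 (g i)) ->
    L1 (fun s => \sum_i b i * g i s) /\
    \int[mu]_s (\sum_i b i * g i s) = \sum_i b i * \int[mu]_s g i s.
  elim: m b g => [|m IH] b g gL.
    under eq_fun do rewrite big_ord0; rewrite big_ord0; split; first exact: L10.
    exact: Rintegral_zero.
  have [L I] := IH (fun i => b (lift ord0 i)) (fun i => g (lift ord0 i)) (fun i => gL (lift ord0 i)).
  have Lb := L1Z (b ord0) (gL ord0).
  under eq_fun do rewrite big_ord_recl; split; first exact: L1D.
  rewrite big_ord_recl -I RintegralD//; congr (_ + _).
  by rewrite RintegralZl; [|exact: measurableT|exact: gL].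
under eq_bigr do rewrite kE.
have [_ <-] := sumI n a k kL.
have E s : \sum_i a i * k i s = 0.
  rewrite /k; under eq_bigr do rewrite mulrCA; rewrite -mulr_sumr.
  have [st|st] := boolP (0 < s < t + 1).
    by under eq_bigr do rewrite truncateE//; rewrite f2 ?mulr0//; case/andP: st.
  by under eq_bigr do rewrite truncate_eq0// mulr0; rewrite big1_eq mulr0.
by under eq_Rintegral do rewrite E; exact: Rintegral_zero.
Qed.

Lemma caputo_vec_mul0 (alpha : R) (m n : nat) (M : 'M[R]_(m, n)) (x : R -> 'cV[R]_n) :
  1 < alpha -> alpha < 2 -> (forall i, caputo_differentiable (coordinate x i)) ->
  (forall t : R, 0 < t -> M *m x t = 0) ->
  forall t : R, 0 < t -> M *m caputo_vec alpha x t = 0.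
Proof.
move=> a1 a2 hx Mx t t0; apply/colP => i; rewrite !mxE.
under eq_bigr do rewrite mxE.
apply: (caputo_lincomb0 a1 a2 hx) => // s s0.
by have /colP/(_ i) := Mx s s0; rewrite !mxE.
Qed.

Lemma pencil_char_poly (n : nat) (N : 'M[R]_n.+1) : exists (m : nat) (q : {poly R}),
  q.[0] != 0 /\ char_poly N = q * 'X^m.
Proof.
have [m [q /implyP h e]] := multiplicity_XsubC (char_poly N) 0.
exists m, q; rewrite subr0 in e; split=> //; apply: h.
by rewrite monic_neq0// char_poly_monic.
Qed.

(** X^d q(1/X), where d is the degree of q. Its constant coefficient is the leading one of q, so 0
    is not a root when q is nonzero. *)
Definition reverse_poly (q : {poly R}) : {poly R} := \poly_(k < size q) q`_((size q).-1 - k).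

Lemma reverse_poly_neq0 (q : {poly R}) : q != 0 -> reverse_poly q != 0.
Proof.
move=> q0; apply/eqP => /polyP/(_ 0%N); rewrite coef_poly coef0 size_poly_gt0 q0 subn0.
by apply/eqP; rewrite -lead_coefE lead_coef_eq0.
Qed.

Lemma horner_reverse_poly (K : fieldType) (f : {rmorphism R -> K}) (q : {poly R}) (z : K) :
  q != 0 -> z != 0 ->
  (map_poly f (reverse_poly q)).[z] = z ^+ (size q).-1 * (map_poly f q).[z^-1].
Proof.
move=> q0 z0; have sq : size q = (size q).-1.+1 by rewrite prednK// size_poly_gt0.
rewrite (horner_coef_wide (n := size q)); last by rewrite size_map_poly size_poly.
rewrite (horner_coef_wide (n := size q)); last by rewrite size_map_poly.
rewrite mulr_sumr (reindex_inj rev_ord_inj) /=; apply: eq_bigr => k _.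
rewrite !coef_map coef_poly /=.
have lt : (size q - k.+1 < size q)%N by rewrite ltn_subrL size_poly_gt0 q0.
have kq : (k <= (size q).-1)%N by rewrite -ltnS -sq ltn_ord.
have e : (size q - k.+1 = (size q).-1 - k)%N by rewrite {1}sq subSS.
rewrite lt e subKn// exprVn mulrCA; congr (_ * _).
by rewrite -[in RHS](subnK kq) exprD mulfK// expf_neq0.
Qed.

(** The inverse of a root z is an eigenvalue of A^-1 E; if v is a left eigenvector, then v A^-1 is
    in the left kernel of z E - A. *)
Lemma reverse_poly_root_spec (n : nat) (E A : 'M[R]_n.+1) (m : nat) (q : {poly R}) (z : R[i]) :
  A \in unitmx -> q.[0] != 0 -> char_poly (invmx A *m E) = q * 'X^m ->
  root (map_poly (real_complex R) (reverse_poly q)) z -> spec E A z.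
Proof.
move=> uA q00 cp; have q0 : q != 0 by apply: contraNneq q00 => ->; rewrite horner0.
set f := real_complex R.
have [->|z0] := eqVneq z 0.
  rewrite /root horner_coef0 coef_map coef_poly size_poly_gt0 q0 subn0 -lead_coefE.
  by rewrite fmorph_eq0 lead_coef_eq0 (negbTE q0).
rewrite /root horner_reverse_poly// mulf_eq0 expf_eq0 (negbTE z0) andbF /= => rq.
have : root (char_poly (map_mx f (invmx A *m E))) z^-1.
  by rewrite -map_char_poly cp rmorphM /= rootM /root rq.
rewrite -eigenvalue_root_char => /eigenvalueP[v vN v0].
apply/eqP/det0P; have uAC : map_mx f A \in unitmx by rewrite map_unitmx.
exists (v *m invmx (map_mx f A)).
  apply: contra_neq v0 => vA; rewrite -[v](mulmxKV uAC) vA mul0mx//.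
rewrite mulmxBr -scalemxAr mulmxKV//.
move: vN; rewrite map_mxM map_invmx mulmxA => ->.
by rewrite scalerA mulfV// scale1r subrr.
Qed.

(** On x, B inverts N, so that B^k x = B^d N^(d - k) x and the reversed polynomial of B acts as B^d
    q(N), where d is the degree of q. *)
Lemma reverse_poly_horner_mx (n : nat) (N B : 'M[R]_n.+1) (q : {poly R}) (x : 'cV[R]_n.+1) :
  q != 0 -> GRing.comm N B -> N *m (B *m x) = x -> horner_mx N q *m x = 0 ->
  horner_mx B (reverse_poly q) *m x = 0.
Proof.
move=> q0 cNB NBx qx; pose d := (size q).-1.
have sq : size q = d.+1 by rewrite prednK// size_poly_gt0.
have cj j : N ^+ j * B ^+ j = B ^+ j * N ^+ j.
  by apply: commrX; apply/commr_sym; apply: commrX; exact/commr_sym.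
have NBj j : (N ^+ j * B ^+ j) *m x = x.
  elim: j => [|j IH]; first by rewrite !expr0 mulr1 mul1mx.
  have -> : N ^+ j.+1 * B ^+ j.+1 = (N ^+ j * B ^+ j) * (N * B).
    have cNBj : (N * B) * B ^+ j = B ^+ j * (N * B).
      by apply: commrX; apply/commr_sym; apply: commrM; [exact/commr_sym|exact: commr_refl].
    by rewrite exprSr exprS -!mulrA (mulrA N B) cNBj.
  by rewrite -mulmxE -!mulmxA NBx mulmxA mulmxE IH.
have termE (c : R) k : (k <= d)%N -> horner_mx B (c *: 'X^k) *m x =
    B ^+ d *m (c *: (N ^+ (d - k) *m x)).
  move=> kd; rewrite linearZ rmorphXn /= horner_mx_X -[in LHS](NBj (d - k)%N).
  rewrite cj -scalemxAl -scalemxAr !mulmxA; congr (_ *: (_ *m _)).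
  by rewrite !mulmxE -exprD subnKC.
have termN (c : R) k : horner_mx N (c *: 'X^k) *m x = c *: (N ^+ k *m x).
  by rewrite linearZ rmorphXn /= horner_mx_X -scalemxAl.
rewrite /reverse_poly poly_def raddf_sum mulmx_suml sq.
have -> : \sum_(k < d.+1) horner_mx B (q`_(d.+1.-1 - k) *: 'X^k) *m x =
    B ^+ d *m \sum_(k < d.+1) q`_(d - k) *: (N ^+ (d - k) *m x).
  by rewrite mulmx_sumr; apply: eq_bigr => k _; rewrite termE// -ltnS.
rewrite (reindex_inj rev_ord_inj) /=.
have <- : horner_mx N q *m x = \sum_(k < d.+1) q`_(d - (d.+1 - k.+1)) *: (N ^+ (d - (d.+1 - k.+1)) *m x).
  rewrite -{1}[q]coefK poly_def raddf_sum mulmx_suml sq; apply: eq_bigr => k _.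
  have -> : (d - (d.+1 - k.+1) = k)%N by rewrite subSS subKn// -ltnS.
  exact: termN.
by rewrite qx mulmx0.
Qed.

Lemma fractional_normal_form (n : nat) (alpha : R) (E A : 'M[R]_n.+1) : A \in unitmx ->
  1 < alpha -> alpha < 2 ->
  exists (B : 'M[R]_n.+1) (Q : {poly R}), [/\ Q != 0,
    forall z, root (map_poly (real_complex R) Q) z -> spec E A z &
    forall x, is_solution alpha E A (fun=> 0) x -> forall t : R, 0 < t ->
      caputo_vec alpha x t = B *m x t /\ horner_mx B Q *m x t = 0].
Proof.
move=> uA a1 a2; pose N := invmx A *m E.
have [m [q [q00 cp]]] := pencil_char_poly N.
have q0 : q != 0 by apply: contraNneq q00 => ->; rewrite horner0.
(* From q = X (q / X) + q(0) follows X b = 1 - q / q(0), so that b(N) inverts N on the kernel of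
   q(N). *)
pose b := - q.[0]^-1 *: (q %/ 'X).
have qE : q = (q %/ 'X) * 'X + (q.[0])%:P.
  by rewrite -[in RHS](subr0 'X) -polyC0 -modp_XsubC -divp_eq.
have bE : 'X * b + q.[0]^-1 *: q = 1.
  rewrite [X in _ + _ *: X]qE scalerDr /b -scalerAr scaleNr [X in - (_ *: X)]mulrC addrA addNr add0r.
  by rewrite -mul_polyC -polyCM mulVf.
pose B := horner_mx N b.
have cNB : GRing.comm N B by exact: comm_mx_horner.
have NBE : N * B = 1 - q.[0]^-1 *: horner_mx N q.
  have hq : horner_mx N (q.[0]^-1 *: q) = q.[0]^-1 *: horner_mx N q by exact: linearZ.
  have e1 : N * B + q.[0]^-1 *: horner_mx N q = 1.
    by rewrite -hq -[RHS](rmorph1 (horner_mx N)) -bE rmorphD rmorphM /= horner_mx_X.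
  by rewrite -e1 addrK.
exists B, (reverse_poly q); split; first exact: reverse_poly_neq0.
  by move=> z; exact: reverse_poly_root_spec uA q00 cp.
move=> x [hx xE]; pose D := caputo_vec alpha x.
have ND t : 0 < t -> x t = N *m D t.
  by move=> t0; rewrite /N -mulmxA xE// addr0 mulKmx.
(* D = D^alpha x and x = N D, so that a factor N in front of D can be traded
   for one application of D^alpha. *)
have nil j : (j <= m)%N -> forall t, 0 < t -> (N ^+ (m - j) * horner_mx N q) *m D t = 0.
  elim: j => [|j IH] jm t t0.
    have := Cayley_Hamilton N; rewrite cp rmorphM rmorphXn /= horner_mx_X subn0.
    have <- : horner_mx N q * N ^+ m = N ^+ m * horner_mx N q.
      by apply: commrX; apply/commr_sym; exact: comm_mx_horner.
    by move=> ->; rewrite mul0mx.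
  apply: (caputo_vec_mul0 a1 a2 hx) => // s s0.
  rewrite ND// mulmxA mulmxE -mulrA.
  have <- : N * horner_mx N q = horner_mx N q * N by exact: comm_mx_horner.
  by rewrite mulrA -exprSr -subSn// subSS IH// ltnW.
have qD t : 0 < t -> horner_mx N q *m D t = 0.
  by move=> t0; have := nil m (leqnn m) t t0; rewrite subnn expr0 mul1r.
have qx t : 0 < t -> horner_mx N q *m x t = 0.
  move=> t0; rewrite ND// mulmxA.
  have <- : N *m horner_mx N q = horner_mx N q *m N by exact: comm_mx_horner.
  by rewrite -mulmxA qD// mulmx0.
move=> t t0; split.
  rewrite ND// mulmxA.
  have <- : N *m B = B *m N := cNB.
  by rewrite mulmxE NBE mulmxBl mul1mx -scalemxAl qD// scaler0 subr0.
apply: (@reverse_poly_horner_mx _ N) => //; last exact: qx.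
by rewrite mulmxA mulmxE NBE mulmxBl mul1mx -scalemxAl qx// scaler0 subr0.
Qed.

End NormalForm.

(** * Stability *)

Section Stability.
Variable R : realType.
Local Notation mu := (@lebesgue_measure R).
Local Notation Re := (@complex.Re R).
Local Notation Im := (@complex.Im R).
Local Notation "x %:C" := (real_complex R x).

(** In the supremum norm weighted by e^{-pt}, convolution costs the mass of the weighted kernel,
    which is its Laplace transform p^{-z}. *)
Lemma power_kernel_conv_le (z p K c : R) (g : R -> R) : 0 < z -> 0 < p -> 0 <= K ->
  (forall t : R, 0 < t -> {for t, continuous g}) ->
  (forall t : R, 0 < t -> t < c -> `|g t| <= K * expR (p * t)) ->
  `|conv (power_kernel z) (onpos g) c| <= K * expR (p * c) * p `^ (- z).
Proof.
move=> z0 p0 K0 cg gK.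
have [wL wI] := power_kernel_laplace z0 p0.
pose w (u : R) := expR (- (p * u)) * power_kernel z u : R.
have bL : L1 (fun s => K * expR (p * c) * w (c - s)) by apply: L1Z; exact: L1_rsub.
have le s : `|power_kernel z (c - s) * onpos g s| <= K * expR (p * c) * w (c - s).
  have k0 := power_kernel_ge0 (c - s) z0.
  have w0 : 0 <= K * expR (p * c) * w (c - s).
    by rewrite mulr_ge0 ?mulr_ge0 ?expR_ge0.
  have [s0|s0] := leP s 0; first by rewrite onpos0// mulr0 normr0.
  have [cs|sc] := leP c s; first by rewrite power_kernel0 ?mul0r ?normr0// subr_le0.
  rewrite normrM (ger0_norm k0) onposE// /w.
  apply: le_trans (ler_wpM2l k0 (gK s s0 sc)) _.
  have -> : expR (p * s) = expR (p * c) * expR (- (p * (c - s))).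
    by rewrite -expRD; congr expR; ring.
  by rewrite le_eqVlt; apply/orP; left; apply/eqP; ring.
have aL : L1 (fun s => power_kernel z (c - s) * onpos g s).
  apply: L1_le bL => //; apply: measurable_funM; last exact: measurable_onpos.
  apply: measurableT_comp; first exact: measurable_power_kernel.
  by apply: measurable_funB => //; exact: measurable_cst.
apply: le_trans (le_normr_Rintegral measurableT aL) _.
apply: (@le_trans _ _ (\int[mu]_s (K * expR (p * c) * w (c - s)))).
  apply: le_Rintegral => //; [exact: L1_normr].
rewrite RintegralZl; [|exact: measurableT|exact: L1_rsub].
by rewrite Rintegral_rsub// wI.
Qed.

(** A Gronwall estimate by a maximum argument: at a point c where e^{-ps} G(s) is maximal on [0, t],
    the integral equation bounds the maximum by C plus half of itself. The weight also absorbs the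
    term linear in time, as p >= 1. *)
Lemma caputo_linear_growth (n : nat) (alpha : R) (B : 'M[R]_n) (x : R -> 'cV[R]_n) :
  1 < alpha -> alpha < 2 -> (forall i, caputo_differentiable (coordinate x i)) ->
  (forall t : R, 0 < t -> caputo_vec alpha x t = B *m x t) ->
  exists M sigma : R, [/\ 0 <= M, 0 <= sigma &
    forall (t : R) i, 0 < t -> `|x t i 0| <= M * expR (sigma * t)].
Proof.
move=> a1 a2 hx xB; have a0 : 0 < alpha by lra.
pose g i (t : R) := (B *m x t) i 0.
have gE i t : g i t = \sum_j B i j * x t j 0 by rewrite /g mxE.
have cx i (t : R) : 0 < t -> {for t, continuous (coordinate x i)}.
  exact: caputo_differentiable_cont.
have csum (I : seq 'I_n) (f : 'I_n -> R -> R) (t : R) : (forall i, {for t, continuous (f i)}) ->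
    {for t, continuous (fun t => \sum_(i <- I) f i t)}.
  move=> cf; elim: I => [|i I IH]; first by apply: cont_ext (fun t => big_nil _ _ _ _) _; cont.
  by apply: cont_ext (fun t => big_cons _ _ _ _ _ _) _; exact: cont_add.
have cg i (t : R) : 0 < t -> {for t, continuous (g i)}.
  move=> t0; apply: cont_ext (gE i) _; apply: csum => j.
  by apply: cont_mul; [exact: cont_cst|exact: cx].
have prim i : exists f1 : R, forall t : R, 0 < t ->
    x t i 0 = x 0 i 0 + f1 * t + conv (power_kernel alpha) (onpos (g i)) t.
  have [|f1 _ h] := @caputo_primitive R alpha (coordinate x i) (g i) a1 a2 (hx i); last by exists f1.
  by move=> t t0; rewrite /g -xB// mxE.
have [f1 hf1] := choice prim.
pose b := \sum_i \sum_j `|B i j|.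
have b0 : 0 <= b by apply: sumr_ge0 => i _; exact: sumr_ge0.
(* Weighted by expR (- (p * t)), the kernel has mass p `^ (- alpha) <= (2 * b)^-1. *)
pose p := 2 * b + 1.
have p1 : 1 <= p by rewrite /p lerDr mulr_ge0.
have p0 : 0 < p := lt_le_trans ltr01 p1.
have pb : p `^ (- alpha) * b <= 1 / 2.
  have pa : p <= p `^ alpha.
    by rewrite -[leLHS]powRr1 ?(ltW p0)//; apply: ler_powR => //; exact: ltW.
  have pa0 : 0 < p `^ alpha := lt_le_trans p0 pa.
  rewrite powRN mulrC ler_pdivrMr// mul1r ler_pdivlMl//.
  by apply: le_trans pa; rewrite /p lerDl.
pose C := \sum_i (`|x 0 i 0| + `|f1 i|).
have C0 : 0 <= C by apply: sumr_ge0 => i _; rewrite addr_ge0.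
pose G (t : R) := \sum_i `|x t i 0|.
have G0 t : 0 <= G t by exact: sumr_ge0.
have xG t i : `|x t i 0| <= G t.
  by rewrite /G (bigD1 i)//= lerDl sumr_ge0.
exists (2 * C), p; split; [by rewrite mulr_ge0|exact: ltW|move=> t i t0].
apply: le_trans (xG t i) _.
pose phi (s : R) := expR (- (p * s)) * G s.
have cphi : {within `[0, t], continuous phi}.
  have cxi i' : {within `[0, t], continuous (fun s => `|x s i' 0|)}.
    have [cw _ _] := hx i'; apply: continuous_subspaceW (_ : `[0, t] `<=` `[0, +oo[) _.
      by move=> s /=; rewrite !in_itv/= => /andP[->].
    by move=> s; apply: cvg_norm; exact: cw.
  move=> s; apply: cvgM.
    have h : continuous (fun s : R => expR (- (p * s))) 
      by move=> y; have : {for y, continuous (fun s : R => expR (- (p * s)))} by cont.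
    exact: (continuous_subspaceT h).
  rewrite /G; elim: (index_enum _) => [|i' I IH].
    by rewrite big_nil (funext (fun t => big_nil _ _ _ _)); exact: cvg_cst.
  rewrite big_cons (funext (fun t => big_cons _ _ _ _ _ _)) /=.
  by apply: cvgD => //; exact: cxi.
have [c cT cmax] := EVT_max (ltW t0) cphi.
have phi0 s : 0 <= phi s by rewrite mulr_ge0 ?expR_ge0.
suff h : phi c <= 2 * C.
  have := le_trans (cmax t _) h; rewrite in_itv/= lexx (ltW t0) => /(_ isT).
  by rewrite /phi expRN ler_pdivrMl ?expR_gt0// mulrC.
move: cT; rewrite in_itv/= => /andP[]; rewrite le_eqVlt => /orP[/eqP <- _|c0 ct].
  rewrite /phi mulr0 oppr0 expR0 mul1r; apply: (@le_trans _ _ C).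
    by apply: ler_sum => j _; rewrite lerDl.
  by rewrite -[leLHS]mul1r ler_wpM2r// ler1n.
have step j : `|x c j 0| <= `|x 0 j 0| + `|f1 j| * c +
    (\sum_k `|B j k|) * phi c * expR (p * c) * p `^ (- alpha).
  rewrite hf1//; apply: le_trans (ler_normD _ _) _; apply: lerD.
    by apply: le_trans (ler_normD _ _) _; rewrite normrM (gtr0_norm c0).
  apply: power_kernel_conv_le => //; first by rewrite mulr_ge0 ?sumr_ge0.
    by move=> s; exact: cg.
  move=> s s0 sc; rewrite gE; apply: le_trans (ler_norm_sum _ _ _) _.
  rewrite -mulrA mulr_suml; apply: ler_sum => k _; rewrite normrM ler_wpM2l//.
  apply: le_trans (xG s k) _.
  have := cmax s; rewrite in_itv/= (ltW s0) (le_trans (ltW sc) ct) => /(_ isT).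
  by rewrite {1}/phi expRN ler_pdivrMl ?expR_gt0// mulrC.
have cexp_le : expR (- (p * c)) * c <= 1.
  rewrite expRN ler_pdivrMl ?expR_gt0// mulr1 (le_trans _ (expR_ge1Dx _))//.
  by rewrite (@le_trans _ _ (p * c)) ?ler_peMl ?(ltW c0)// lerDr.
have e1 : expR (- (p * c)) <= 1 by rewrite -expR0 ler_expR oppr_le0 mulr_ge0 ?ltW.
have : phi c <= C + phi c * (p `^ (- alpha) * b).
  rewrite {1}/phi /G mulr_sumr /C /b mulr_sumr mulr_sumr -big_split /=.
  apply: ler_sum => j _; apply: le_trans (ler_wpM2l (expR_ge0 _) (step j)) _.
  rewrite !mulrDr; apply: lerD; first apply: lerD.
  - by rewrite ler_piMl.
  - by rewrite mulrCA -[leRHS]mulr1 ler_wpM2l.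
  - have -> : expR (- (p * c)) * ((\sum_k `|B j k|) * phi c * expR (p * c) * p `^ (- alpha)) =
       (expR (- (p * c)) * expR (p * c)) * (phi c * (p `^ (- alpha) * \sum_k `|B j k|)) by ring.
    by rewrite -expRD addNr expR0 mul1r.
have : phi c * (p `^ (- alpha) * b) <= phi c * (1 / 2) by rewrite ler_wpM2l.
lra.
Qed.

(** A linear class of pairs of a function vanishing at infinity and its transform. Real p > p0 are
    enough, as injectivity uses the transform along an arithmetic progression only. *)
Definition vanishing_laplace (p0 : R) (f F : R -> R) : Prop :=
  [/\ forall t : R, 0 < t -> {for t, continuous f}, f @ +oo --> (0 : R) &
    forall p : R, p0 < p -> L1 (fun t => expR (- (p * t)) * onpos f t) /\
      \int[mu]_t (expR (- (p * t)) * onpos f t) = F p].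

Lemma vanishing_laplace0 (p0 : R) : vanishing_laplace p0 (fun=> 0) (fun=> 0).
Proof.
split; [by move=> t _; cont|exact: cvg_cst|move=> p _].
have -> : (fun t => expR (- (p * t)) * onpos (fun=> 0) t) = (fun=> 0 : R).
  by apply/funext => t; rewrite /onpos; case: ifP; rewrite mulr0.
by split; [exact: L10|exact: Rintegral_zero].
Qed.

Lemma vanishing_laplaceD (p0 : R) f g F G : vanishing_laplace p0 f F -> vanishing_laplace p0 g G ->
  vanishing_laplace p0 (fun t => f t + g t) (fun p => F p + G p).
Proof.
move=> [f1 f2 f3] [g1 g2 g3]; split.
- by move=> t t0; apply: cont_add; [exact: f1|exact: g1].
- by rewrite -[X in _ --> X]addr0; exact: cvgD.
- move=> p pp; have [fL fI] := f3 p pp; have [gL gI] := g3 p pp.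
  have E t : expR (- (p * t)) * onpos (fun t => f t + g t) t =
      expR (- (p * t)) * onpos f t + expR (- (p * t)) * onpos g t.
    by rewrite /onpos; case: ifP; rewrite ?mulr0 ?addr0// mulrDr.
  rewrite (funext E); split; first exact: L1D.
  by rewrite RintegralD ?fI ?gI.
Qed.

Lemma vanishing_laplaceZ (p0 c : R) f F : vanishing_laplace p0 f F ->
  vanishing_laplace p0 (fun t => c * f t) (fun p => c * F p).
Proof.
move=> [f1 f2 f3]; split.
- by move=> t t0; apply: cont_mul; [exact: cont_cst|exact: f1].
- by rewrite -[X in _ --> X](mulr0 c); apply: cvgM => //; exact: cvg_cst.
- move=> p pp; have [fL fI] := f3 p pp.
  have E t : expR (- (p * t)) * onpos (fun t => c * f t) t =
      c * (expR (- (p * t)) * onpos f t).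
    by rewrite onposZ mulrCA.
  rewrite (funext E); split; first exact: L1Z.
  by rewrite RintegralZl ?fI//; exact: measurableT.
Qed.

Lemma vanishing_laplace_sum (p0 : R) (I : Type) (r : seq I) (f F : I -> R -> R) :
  (forall i, vanishing_laplace p0 (f i) (F i)) ->
  vanishing_laplace p0 (fun t => \sum_(i <- r) f i t) (fun p => \sum_(i <- r) F i p).
Proof.
move=> h; elim: r => [|i r IH].
  rewrite (funext (fun t => big_nil _ _ _ _)) (funext (fun t => big_nil _ _ _ _)).
  exact: vanishing_laplace0.
rewrite (funext (fun t => big_cons _ _ _ _ _ _)) (funext (fun t => big_cons _ _ _ _ _ _)) /=.
exact: vanishing_laplaceD.
Qed.

Lemma vanishing_laplace_le (p0 p1 : R) f F G : p0 <= p1 -> vanishing_laplace p0 f F ->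
  (forall p, p1 < p -> F p = G p) -> vanishing_laplace p1 f G.
Proof.
move=> p01 [f1 f2 f3] FG; split=> // p pp; rewrite -FG//; apply: f3.
exact: le_lt_trans pp.
Qed.

(** g and f have the same transform beyond p0, hence coincide on the half line by
    [laplace_injective], used from an abscissa above both p0 and sigma. *)
Lemma vanishing_laplace_cvg0 (p0 M sigma : R) (f g F : R -> R) :
  (forall t : R, 0 < t -> {for t, continuous g}) ->
  (forall t : R, 0 < t -> `|g t| <= M * expR (sigma * t)) ->
  vanishing_laplace p0 f F ->
  (forall p : R, p0 < p -> \int[mu]_t (expR (- (p * t)) * onpos g t) = F p) ->
  g @ +oo --> (0 : R).
Proof.
move=> cg gM [f1 f2 f3] gF.
pose q := Num.max p0 sigma + 1.
have q1 k : p0 < q + k%:R.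
  rewrite (@lt_le_trans _ _ q) ?lerDl// /q (@le_lt_trans _ _ (Num.max p0 sigma)) ?ltrDl//.
  by rewrite le_max lexx.
have q2 k : sigma < q + k%:R.
  rewrite (@lt_le_trans _ _ q) ?lerDl// /q (@le_lt_trans _ _ (Num.max p0 sigma)) ?ltrDl//.
  by rewrite le_max lexx orbT.
have gL k := L1_exp_bounded (q2 k) cg gM.
have E p t : expR (- (p * t)) * onpos (fun t => g t - f t) t =
    expR (- (p * t)) * onpos g t - expR (- (p * t)) * onpos f t.
  by rewrite /onpos; case: ifP; rewrite ?mulr0 ?subr0// mulrBr.
have gf (t : R) : 0 < t -> g t - f t = 0.
  apply: (@laplace_injective _ (fun t => g t - f t) q).
  - by move=> s s0; apply: cont_sub; [exact: cg|exact: f1].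
  - rewrite (funext (E q)); have := q1 0%N; have := gL 0%N; rewrite addr0 => gL0 /f3[fL _].
    exact: L1B.
  - move=> k; have [fL fI] := f3 _ (q1 k).
    by rewrite (funext (E _)) RintegralB// ?gF ?fI ?subrr//; exact: gL.
apply: cvg_trans f2; apply: near_eq_cvg; near=> t.
apply/eqP; rewrite eq_sym -subr_eq0 gf//; near: t; exact: nbhs_pinfty_gt.
Unshelve. all: end_near. Qed.

Lemma Re_claplace_real (f : R -> R) (p : R) :
  Re (claplace f (ray p 0)) = \int[mu]_t (expR (- (p * t)) * f t).
Proof.
rewrite /claplace Re_cint; apply: eq_Rintegral => t _.
rewrite /laplace_integrand ReRM Re_cexp ReN ImN ReMR ImMR /ray ReRM ImRM /=.
by rewrite sin0 cos0 mulr1 mulr0 mul0r oppr0 cos0 mulr1 mulrC.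
Qed.

(* Q(w) - Q(B) is a multiple of w - B. *)
Lemma resolvent_poly (n : nat) (B : 'M[R]_n.+1) (Q : {poly R}) (w : R) (X u : 'cV[R]_n.+1) :
  horner_mx B Q *m X = 0 -> w *: X - B *m X = u ->
  Q.[w] *: X = \sum_(k < size Q) \sum_(i < k) (Q`_k * w ^+ (k.-1 - i)) *: (B ^+ i *m u).
Proof.
move=> QX wX; pose W : 'M[R]_n.+1 := w%:M.
have cWB : GRing.comm W B by exact: comm_scalar_mx.
have WX j (y : 'cV[R]_n.+1) : W ^+ j *m y = w ^+ j *: y.
  by rewrite /W -rmorphXn /= mul_scalar_mx.
have uE : (W - B) *m X = u by rewrite mulmxBl mul_scalar_mx.
have QB : horner_mx B Q *m X = \sum_(k < size Q) Q`_k *: (B ^+ k *m X).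
  rewrite -{1}[Q]coefK poly_def linear_sum mulmx_suml; apply: eq_bigr => k _.
  by rewrite linearZ rmorphXn /= horner_mx_X -scalemxAl.
have -> : Q.[w] *: X = \sum_(k < size Q) Q`_k *: (W ^+ k *m X) - horner_mx B Q *m X.
  rewrite QX subr0 horner_coef scaler_suml; apply: eq_bigr => k _.
  by rewrite WX scalerA.
rewrite QB -sumrB; apply: eq_bigr => k _.
rewrite -scalerBr -mulmxBl subrXX_comm//.
have -> : (W - B) * (\sum_(i < k) W ^+ (k.-1 - i) * B ^+ i) =
    (\sum_(i < k) W ^+ (k.-1 - i) * B ^+ i) * (W - B).
  rewrite mulr_suml mulr_sumr; apply: eq_bigr => i _.
  suff c : GRing.comm (W - B) (W ^+ (k.-1 - i) * B ^+ i) by exact: c.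
  apply: commrM; apply: commrX.
    by apply/commr_sym; apply: commrB => //; exact: commr_refl.
  by apply/commr_sym; apply: commrB; [exact/commr_sym|exact: commr_refl].
rewrite -mulmxE -mulmxA uE mulmx_suml scaler_sumr; apply: eq_bigr => i _.
by rewrite -mulmxA WX scalerA.
Qed.

End Stability.

(** * Sufficiency of the spectral condition *)

Section StabilityCriterion.
Variable R : realType.
Local Notation mu := (@lebesgue_measure R).
Local Notation Re := (@complex.Re R).
Local Notation Im := (@complex.Im R).
Local Notation "x %:C" := (real_complex R x).

Lemma normr_col_le (n : nat) (v : 'cV[R]_n) (i : 'I_n) : `|v i 0| <= `|v|.
Proof.
have -> : `|v| = mx_norm v by [].
rewrite mx_normrE; exact: (le_bigmax _ (fun ij : 'I_n * 'I_1 => `|v ij.1 ij.2|) (i, ord0)).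
Qed.

Lemma normr_col_sum (n : nat) (v : 'cV[R]_n) : `|v| <= \sum_i `|v i 0|.
Proof.
have -> : `|v| = mx_norm v by [].
rewrite mx_normrE; apply: bigmax_le => [|[i j] _ /=]; first exact: sumr_ge0.
by rewrite (ord1 j) (bigD1 i)//= lerDl sumr_ge0.
Qed.

Lemma normr_col_cvg0 (n : nat) (x : R -> 'cV[R]_n) :
  (forall i, (fun t => x t i 0) @ +oo --> (0 : R)) -> `|x t| @[t --> +oo] --> (0 : R).
Proof.
move=> hx; have sum0 : (fun t => \sum_i `|x t i 0|) @ +oo --> (0 : R).
  elim: (index_enum _) => [|i I IH].
    by rewrite (funext (fun t => big_nil _ _ _ _)); exact: cvg_cst.
  rewrite (funext (fun t => big_cons _ _ _ _ _ _)) /= -[X in _ --> X]addr0.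
  apply: cvgD => //.
  by rewrite -[X in _ --> X](@normr0 R R); apply: cvg_norm; exact: hx.
apply: (@squeeze_cvgr _ _ _ _ (cst 0) (fun t => \sum_i `|x t i 0|)) => //.
  by apply: nearW => t; rewrite normr_ge0 normr_col_sum.
exact: cvg_cst.
Qed.

Lemma coordinate_cvg0 (n : nat) (x : R -> 'cV[R]_n) (i : 'I_n) :
  `|x t| @[t --> +oo] --> (0 : R) -> (fun t => x t i 0) @ +oo --> (0 : R).
Proof.
move=> hx.
apply: (@squeeze_cvgr _ _ _ _ (fun t => - `|x t|) (fun t => `|x t|)) => //.
  by apply: nearW => t; rewrite -ler_norml normr_col_le.
by rewrite -[X in _ --> X]oppr0; exact: cvgN.
Qed.

Lemma arg_real_gt0 (w : R) : 0 < w -> arg w%:C = 0.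
Proof.
move=> w0; rewrite /arg; case: eqVneq => // _ /=.
by rewrite expr0n addr0 sqrtr_sqr gtr0_norm// divff ?gt_eqF// acos1 lexx.
Qed.

Lemma laplace_mulmx (n : nat) (M : 'M[R]_n) (x : R -> 'cV[R]_n) (p : R) (l : 'I_n) :
  (forall j, L1 (fun t => expR (- (p * t)) * onpos (fun t => x t j 0) t)) ->
  (M *m \col_j \int[mu]_t (expR (- (p * t)) * onpos (fun t => x t j 0) t)) l 0 =
  \int[mu]_t (expR (- (p * t)) * onpos (fun t => (M *m x t) l 0) t).
Proof.
move=> xL; rewrite mxE; under eq_bigr do rewrite mxE.
have E t : expR (- (p * t)) * onpos (fun t => (M *m x t) l 0) t =
    \sum_j M l j * (expR (- (p * t)) * onpos (fun t => x t j 0) t).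
  rewrite /onpos; case: ifP => t0; last by rewrite mulr0 big1// => j _; rewrite mulr0.
  by rewrite mxE mulr_sumr; apply: eq_bigr => j _; rewrite mulrCA.
rewrite (funext E); have : L1 (fun t => \sum_j M l j * (expR (- (p * t)) * onpos (fun t => x t j 0) t)) /\
   \int[mu]_t (\sum_j M l j * (expR (- (p * t)) * onpos (fun t => x t j 0) t)) =
   \sum_j M l j * \int[mu]_t (expR (- (p * t)) * onpos (fun t => x t j 0) t).
  elim: (index_enum _) => [|i I [L IH]].
    rewrite (funext (fun t => big_nil _ _ _ _)) big_nil.
    by split; [exact: L10|exact: Rintegral_zero].
  rewrite (funext (fun t => big_cons _ _ _ _ _ _)) big_cons /=.
  have Li := L1Z (M l i) (xL i).
  split; first exact: L1D.
  by rewrite -IH RintegralD//; congr (_ + _); rewrite RintegralZl; [|exact: measurableT|exact: xL].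
by case.
Qed.

Lemma spec_stable (n : nat) (alpha : R) (E A : 'M[R]_n) : 1 < alpha -> alpha < 2 ->
  (forall lambda : R[i], spec E A lambda -> pi / 2 * alpha < `|arg lambda|) ->
  asymptotically_stable alpha E A.
Proof.
(* Polynomials in a matrix require positive dimension; in dimension 0 there is no coordinate to
   control. *)
case: n E A => [|n] E A a1 a2 hspec x0 _ x hx _.
  by apply: normr_col_cvg0; case.
have a0 : 0 < alpha by lra.
(* With the convention arg 0 = 0, the hypothesis excludes 0 from the spectrum. *)
have uA : A \in unitmx.
  rewrite unitmxE unitfE; apply/eqP => dA.
  have s0 : spec E A 0.
    by rewrite /spec /= scale0r add0r -scaleN1r detZ det_map_mx dA rmorph0 mulr0.
  have := hspec 0 s0; rewrite /arg eqxx normr0 ltNge mulr_ge0 ?(ltW a0)//.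
  by rewrite divr_ge0 ?pi_ge0.
have [B [Q [Q0 rootQ hB]]] := fractional_normal_form E uA a1 a2.
have hxB := hB x hx; have [dx _] := hx.
have xB (t : R) : 0 < t -> caputo_vec alpha x t = B *m x t by move=> /hxB[].
have xQ (t : R) : 0 < t -> horner_mx B Q *m x t = 0 by move=> /hxB[].
have [M [sigma [M0 sigma0 gM]]] := caputo_linear_growth a1 a2 dx xB.
have Qpos (w : R) : 0 < w -> Q.[w] != 0.
  move=> w0; apply/eqP => Qw.
  have : root (map_poly (real_complex R) Q) w%:C by rewrite /root horner_map /= Qw.
  move=> /rootQ/hspec; rewrite arg_real_gt0// normr0 ltNge mulr_ge0 ?(ltW a0)//.
  by rewrite divr_ge0 ?pi_ge0.
have hroot z : root (map_poly (real_complex R) Q) z -> pi / 2 * alpha < `|arg z|.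
  by move=> /rootQ; exact: hspec.
have inv (a : R) : a = alpha - 1 \/ a = alpha - 2 -> exists h : nat -> R -> R, forall j,
    (j.+1 < size Q)%N -> vanishing_laplace 0 (h j)
      (fun p => p `^ a * ((p `^ alpha) ^+ j / Q.[p `^ alpha])).
  move=> ha; suff /choice[h hh] : forall j, exists h : R -> R, (j.+1 < size Q)%N ->
      vanishing_laplace 0 h (fun p => p `^ a * ((p `^ alpha) ^+ j / Q.[p `^ alpha])) by exists h.
  move=> j; have [jQ|_] := ltnP j.+1 (size Q); last by exists (fun=> 0).
  have [h [h1 h2 h3]] := rational_inversion a1 a2 Q0 hroot ha jQ.
  by exists h => _; split.
have [h1 hh1] := inv (alpha - 1) (or_introl erefl).
have [h2 hh2] := inv (alpha - 2) (or_intror erefl).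
have cx i (t : R) : 0 < t -> {for t, continuous (coordinate x i)}.
  exact: caputo_differentiable_cont.
have xL p j : sigma < p -> L1 (fun t => expR (- (p * t)) * onpos (fun t => x t j 0) t).
  by move=> sp; apply: (L1_exp_bounded sp (cx j) (M := M)) => t t0; exact: gM.
have /choice[v hv] : forall i, exists v : R, (coordinate x i)^`()%classic @ 0^'+ --> v.
  move=> i.
  have [|f1 h _] := @caputo_primitive R alpha (coordinate x i) (fun t => (B *m x t) i 0) a1 a2 (dx i).
    by move=> t t0; rewrite -xB// mxE.
  by exists f1.
pose V : 'cV[R]_n.+1 := \col_i v i.
pose Y p : 'cV[R]_n.+1 := \col_j \int[mu]_t (expR (- (p * t)) * onpos (fun t => x t j 0) t).
have Bx_bound l (t : R) : 0 < t -> `|(B *m x t) l 0| <= (\sum_j `|B l j| * M) * expR (sigma * t).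
  move=> t0; rewrite mxE; apply: le_trans (ler_norm_sum _ _ _) _.
  rewrite mulr_suml; apply: ler_sum => j _; rewrite normrM -mulrA ler_wpM2l//; exact: gM.
(* The transformed equation multiplied by p^alpha: the powers p^{-1} and p^{-2} carried by x(0) and
   x'(0) become those of exponents alpha - 1 and alpha - 2. *)
have YE p : sigma < p -> p `^ alpha *: Y p - B *m Y p =
    p `^ (alpha - 1) *: x 0 + p `^ (alpha - 2) *: V.
  move=> sp; have p0 : 0 < p := le_lt_trans sigma0 sp.
  apply/colP => l; have L := laplace_mulmx B l (fun j => xL p j sp).
  rewrite [LHS]mxE [(_ *: Y p) l 0]mxE [(- (B *m Y p)) l 0]mxE L !mxE.
  have p2 : - (pi / 2) < (0 : R) < pi / 2 by rewrite oppr_lt0 divr_gt0 ?pi_gt0.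
  have sR : sigma < Re (ray p 0) by rewrite /ray ReRM /= cos0 mulr1.
  have cBx (t : R) : 0 < t -> {for t, continuous (fun t => (B *m x t) l 0)}.
    move=> t0; have E' t' : (B *m x t') l 0 = \sum_j B l j * x t' j 0 by rewrite mxE.
    apply: cont_ext E' _; elim: (index_enum _) => [|i I IH].
      by apply: cont_ext (fun t => big_nil _ _ _ _) _; cont.
    apply: cont_ext (fun t => big_cons _ _ _ _ _ _) _; apply: cont_add => //.
    by apply: cont_mul; [exact: cont_cst|exact: cx].
  have eqx (t : R) : 0 < t -> caputo alpha (coordinate x l) t = (B *m x t) l 0.
    by move=> t0; rewrite -xB// mxE.
  have Mb : 0 <= \sum_j `|B l j| * M by apply: sumr_ge0 => j _; rewrite mulr_ge0.
  have := claplace_caputo a1 a2 (dx l) eqx (hv l) cBx Mb (Bx_bound l) p0 p2 sR.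
  move=> /(congr1 Re).
  have pE b : polar_powR b p 0 = (p `^ b)%:C by rewrite /polar_powR mulr0 cis0 mulr1.
  have Lg := Re_claplace_real (onpos (fun t => (B *m x t) l 0)) p.
  rewrite (Re_claplace_real (onpos (coordinate x l)) p).
  move: (claplace (onpos (fun t => (B *m x t) l 0)) _) Lg => c Lg.
  rewrite !pE !ReD !ReRM !ReR Lg => ->.
  have e1 : p `^ alpha * p `^ (- 1) = p `^ (alpha - 1) by rewrite -powRDgt0.
  have e2 : p `^ alpha * p `^ (- 2) = p `^ (alpha - 2) by rewrite -powRDgt0.
  have e3 : p `^ alpha * p `^ (- alpha) = 1 by rewrite -powRDgt0// subrr powRr0.
  rewrite -e1 -e2 !mulrDr /coordinate.
  move: (\int[mu]_t _) => I; rewrite (mulrA _ (p `^ (- alpha)) I) e3; ring.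
have QY p : sigma < p -> horner_mx B Q *m Y p = 0.
  move=> sp; apply/colP => l; rewrite laplace_mulmx; last by move=> j; exact: xL.
  have E' t : expR (- (p * t)) * onpos (fun t => (horner_mx B Q *m x t) l 0) t = 0.
    by rewrite /onpos; case: ifP => t0; rewrite ?mulr0// xQ// mxE mulr0.
  by rewrite (funext E') Rintegral_zero mxE.
apply: normr_col_cvg0 => l.
(* [resolvent_poly] divided by Q(p^alpha) expresses the transform of the coordinate as [F], and [f]
   is the same combination of the inverse transforms. Its exponents k - 1 - i are below deg Q, as
   [rational_inversion] requires. *)
pose f t := \sum_(k < size Q) \sum_(i < k)
  ((Q`_k * (B ^+ i *m x 0) l 0) * h1 (k.-1 - i)%N t + (Q`_k * (B ^+ i *m V) l 0) * h2 (k.-1 - i)%N t).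
pose F p := \sum_(k < size Q) \sum_(i < k)
  ((Q`_k * (B ^+ i *m x 0) l 0) * (p `^ (alpha - 1) * ((p `^ alpha) ^+ (k.-1 - i) / Q.[p `^ alpha])) +
   (Q`_k * (B ^+ i *m V) l 0) * (p `^ (alpha - 2) * ((p `^ alpha) ^+ (k.-1 - i) / Q.[p `^ alpha]))).
have fF : vanishing_laplace 0 f F.
  apply: vanishing_laplace_sum => k; apply: vanishing_laplace_sum => i.
  have ki : ((k.-1 - i).+1 < size Q)%N.
    apply: leq_ltn_trans (ltn_ord k); rewrite -ltnS.
    have aux (a c : nat) : (c < a)%N -> ((a.-1 - c).+1 < a.+1)%N.
      by case: a => // a _; rewrite !ltnS leq_subr.
    exact: aux.
  by apply: vanishing_laplaceD; apply: vanishing_laplaceZ; [exact: hh1|exact: hh2].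
have fF' : vanishing_laplace sigma f F by exact: vanishing_laplace_le sigma0 fF (fun p _ => erefl).
apply: (vanishing_laplace_cvg0 (cx l) _ fF') => [t t0|p sp]; first exact: gM.
have p0 : 0 < p := le_lt_trans sigma0 sp.
have Qp : Q.[p `^ alpha] != 0 by apply: Qpos; exact: powR_gt0.
apply: (mulfI Qp).
have := congr1 (fun y : 'cV[R]_n.+1 => y l 0) (resolvent_poly (QY p sp) (YE p sp)).
rewrite !mxE => ->; rewrite /F mulr_sumr summxE; apply: eq_bigr => k _.
rewrite mulr_sumr summxE; apply: eq_bigr => i _.
rewrite mulmxDr -!scalemxAr !mxE.
move: (B ^+ i *m x 0) (B ^+ i *m V) => y1 y2; field.
by [].
Qed.

End StabilityCriterion.

(** * Mittag-Leffler solutions *)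

Section MittagLeffler.
Variable R : realType.
Local Notation mu := (@lebesgue_measure R).
Implicit Types (a c : nat -> R).

(** Decay faster than every geometric sequence, that is an infinite radius of convergence, in a form
    stable under shifts and under factors linear in k. *)
Definition entire_coef a := forall rho : R, 0 < rho ->
  exists M : R, forall k, `|a k| <= M * rho ^+ k.

Definition psum a (y : R) : R := limn (pseries a y).

Lemma half_sum_le (M : R) (n : nat) : 0 <= M -> \sum_(0 <= k < n) M * (1 / 2) ^+ k <= 2 * M.
Proof.
move=> M0; have -> : \sum_(0 <= k < n) M * (1 / 2) ^+ k = 2 * M - 2 * M * (1 / 2) ^+ n.
  elim: n => [|n IH]; first by rewrite big_geq// expr0 mulr1 subrr.
  rewrite big_nat_recr//= IH exprS; by move: ((1 / 2) ^+ n) => w; field.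
by rewrite gerBl !mulr_ge0 ?exprn_ge0// divr_ge0.
Qed.

(** The choice rho = 1 / (2 (Y + 1)) leaves a factor 2^{-k} on |y| <= Y; adding 1 covers Y = 0. *)
Lemma entire_coef_term a (Y : R) : entire_coef a -> 0 <= Y ->
  exists2 M : R, 0 <= M & forall (y : R) k, `|y| <= Y -> `|a k * y ^+ k| <= M * (1 / 2) ^+ k.
Proof.
move=> ha Y0; have Y1 : 0 < Y + 1 by rewrite ltr_wpDl.
have rho0 : 0 < (2 * (Y + 1))^-1 by rewrite invr_gt0 mulr_gt0.
have [M hM] := ha _ rho0.
have M0 : 0 <= M by have := hM 0%N; rewrite expr0 mulr1; exact: le_trans.
exists M => // y k yY; rewrite normrM normrX.
apply: le_trans (_ : _ <= M * (2 * (Y + 1))^-1 ^+ k * (Y + 1) ^+ k) _.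
  apply: ler_pM; rewrite ?exprn_ge0//; apply: lerXn2r; rewrite ?nnegrE ?(ltW Y1)//.
  by rewrite (le_trans yY)// lerDl.
rewrite -mulrA -exprMn ler_wpM2l// le_eqVlt; apply/orP; left; apply/eqP.
by congr (_ ^+ _); field; rewrite gt_eqF.
Qed.

Lemma pseries_bound a (Y : R) : entire_coef a -> 0 <= Y ->
  exists2 C : R, 0 <= C & forall (y : R) n, `|y| <= Y -> `|pseries a y n| <= C.
Proof.
move=> ha Y0; have [M M0 hM] := entire_coef_term ha Y0.
exists (2 * M); first by rewrite mulr_ge0.
move=> y n yY; apply: le_trans (half_sum_le n M0).
by apply: le_trans (ler_norm_sum _ _ _) _; apply: ler_sum => k _; exact: hM.
Qed.

Lemma pseries_cvg a (y : R) : entire_coef a -> pseries a y @ \oo --> psum a y.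
Proof.
move=> ha; have [M M0 hM] := entire_coef_term ha (normr_ge0 y).
suff h : cvgn (pseries a y) by [].
apply: normed_cvg; apply: (@series_le_cvg _ _ (geometric M (1 / 2))).
- by move=> n; exact: normr_ge0.
- by move=> n; rewrite /geometric/= mulr_ge0// exprn_ge0.
- by move=> n; exact: hM.
- by apply: is_cvg_geometric_series; rewrite ger0_norm//; lra.
Qed.

Arguments pseries_cvg : clear implicits.

Lemma psum_bound a (Y : R) : entire_coef a -> 0 <= Y ->
  exists2 C : R, 0 <= C & forall y : R, `|y| <= Y -> `|psum a y| <= C.
Proof.
move=> ha Y0; have [C C0 hC] := pseries_bound ha Y0; exists C => // y yY.
have h : (fun n => `|pseries a y n|) @ \oo --> `|psum a y|.
  by apply: cvg_norm; exact: pseries_cvg.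
by apply: (cvgr_to_le h); apply: nearW => n; exact: hC.
Qed.

(** Since k <= 2^k, a linear factor is paid for by using the hypothesis at rho / 2. *)
Lemma entire_coef_linear a (b c : R) : entire_coef a ->
  entire_coef (fun k => (b + c * k%:R) * a k).
Proof.
move=> ha rho rho0; have rho2 : 0 < rho / 2 by rewrite divr_gt0.
have [M hM] := ha _ rho2; exists ((`|b| + `|c|) * M) => k.
have M0 : 0 <= M by have := hM 0%N; rewrite expr0 mulr1; exact: le_trans.
have k2 : (k%:R : R) <= 2 ^+ k by rewrite -natrX ler_nat; exact/ltnW/ltn_expl.
have o2 : 1 <= 2 ^+ k :> R by rewrite exprn_ege1// ler1n.
rewrite normrM; apply: le_trans (_ : _ <= (`|b| + `|c|) * 2 ^+ k * (M * (rho / 2) ^+ k)) _.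
  apply: ler_pM => //; apply: le_trans (ler_normD _ _) _; rewrite normrM (ger0_norm (ler0n _ _)) mulrDl.
  by apply: lerD; [rewrite ler_peMr|rewrite ler_wpM2l].
rewrite le_eqVlt; apply/orP; left; apply/eqP.
have -> : rho ^+ k = 2 ^+ k * (rho / 2) ^+ k by rewrite -exprMn mulrC divfK.
by ring.
Qed.

Lemma entire_coef_shift a : entire_coef a -> entire_coef (fun k => a k.+1).
Proof.
move=> ha rho rho0; have [M hM] := ha _ rho0; exists (M * rho) => k.
by rewrite -mulrA -exprS; exact: hM.
Qed.

Lemma entire_coef_diffs a : entire_coef a -> entire_coef (pseries_diffs a).
Proof.
move=> ha; have := entire_coef_shift (entire_coef_linear 0 1 ha).
by congr entire_coef; apply/funext => k; rewrite /pseries_diffs add0r mul1r.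
Qed.

Lemma is_derive_psum a (y : R) : entire_coef a ->
  is_derive y 1 (psum a) (psum (pseries_diffs a) y).
Proof.
move=> ha; have hd := entire_coef_diffs ha; have hdd := entire_coef_diffs hd.
apply: (@pseries_snd_diffs R a (`|y| + 1)).
- exact: cvgP (pseries_cvg a (`|y| + 1) ha).
- exact: cvgP (pseries_cvg _ (`|y| + 1) hd).
- exact: cvgP (pseries_cvg _ (`|y| + 1) hdd).
- by rewrite (ger0_norm (addr_ge0 _ _))// ltrDl.
Qed.

Lemma psum_shift a (y : R) : entire_coef a ->
  psum a y = a 0%N + y * psum (fun k => a k.+1) y.
Proof.
move=> ha; have h1 := pseries_cvg a y ha; have h2 := pseries_cvg _ y (entire_coef_shift ha).
have h3 : (fun n => a 0%N + y * pseries (fun k => a k.+1) y n) @ \oo -->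
    a 0%N + y * psum (fun k => a k.+1) y.
  by apply: cvgD; [exact: cvg_cst|apply: cvgM => //; exact: cvg_cst].
have h4 : (fun n => pseries a y n.+1) @ \oo --> psum a y by rewrite (cvg_shiftS (pseries a y)).
have E n : pseries a y n.+1 = a 0%N + y * pseries (fun k => a k.+1) y n.
  rewrite /pseries /series /= big_nat_recl// expr0 mulr1 mulr_sumr; congr (_ + _).
  by apply: eq_bigr => k _; rewrite exprS; ring.
rewrite (funext E) in h4.
by apply: (cvg_unique _ h4 h3).
Qed.

Lemma psum_lin a1 a2 (b1 b2 y : R) : entire_coef a1 -> entire_coef a2 ->
  entire_coef (fun k => b1 * a1 k + b2 * a2 k) ->
  psum (fun k => b1 * a1 k + b2 * a2 k) y = b1 * psum a1 y + b2 * psum a2 y.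
Proof.
move=> h1 h2 h; have c := pseries_cvg _ y h.
have c' : (fun n => b1 * pseries a1 y n + b2 * pseries a2 y n) @ \oo -->
    b1 * psum a1 y + b2 * psum a2 y.
  by apply: cvgD; apply: cvgM; try exact: cvg_cst; exact: pseries_cvg.
have E n : pseries (fun k => b1 * a1 k + b2 * a2 k) y n = b1 * pseries a1 y n + b2 * pseries a2 y n.
  rewrite /pseries /series /= !mulr_sumr -big_split /=.
  by apply: eq_bigr => k _; ring.
rewrite (funext E) in c.
by apply: (cvg_unique _ c c').
Qed.

Lemma psum_linear a (b c y : R) : entire_coef a ->
  psum (fun k => (b + c * k%:R) * a k) y = b * psum a y + c * (y * psum (pseries_diffs a) y).
Proof.
move=> ha; have hk := entire_coef_linear 0 1 ha.
have E1 : (fun k => (b + c * k%:R) * a k) = (fun k => b * a k + c * ((0 + 1 * k%:R) * a k)).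
  by apply/funext => k; ring.
rewrite E1 psum_lin//; last by rewrite -E1; exact: entire_coef_linear.
congr (_ + _ * _); rewrite psum_shift// mulr0 addr0 mul0r add0r; congr (_ * psum _ _).
by apply/funext => k; rewrite /pseries_diffs add0r mul1r.
Qed.

Lemma is_derive_powR_psum a (alpha b t : R) : 0 < alpha -> entire_coef a -> 0 < t ->
  is_derive t 1 (fun s => s `^ b * psum a (s `^ alpha))
    (t `^ (b - 1) * psum (fun k => (b + alpha * k%:R) * a k) (t `^ alpha)).
Proof.
move=> a0 ha t0.
have d1 := der_powR b t0 (der_id t).
have d2 := @der_comp R (psum a) (fun s => s `^ alpha) t _ _ (is_derive_psum (t `^ alpha) ha) (der_powR alpha t0 (der_id t)).
apply: der_eq (der_mul d1 d2) _.
rewrite psum_linear// !powR_subr1//.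
by field; rewrite gt_eqF.
Qed.

Lemma entire_coefD a1 a2 : entire_coef a1 -> entire_coef a2 ->
  entire_coef (fun k => a1 k + a2 k).
Proof.
move=> h1 h2 rho rho0; have [M hM] := h1 _ rho0; have [N hN] := h2 _ rho0.
exists (M + N) => k; rewrite mulrDl; apply: le_trans (ler_normD _ _) _.
exact: lerD.
Qed.

Lemma entire_coefZ (b : R) a : entire_coef a -> entire_coef (fun k => b * a k).
Proof.
move=> ha; have := entire_coef_linear b 0 ha.
by congr entire_coef; apply/funext => k; rewrite mul0r addr0.
Qed.

Lemma psum0 (y : R) : psum (fun=> 0) y = 0.
Proof.
have h : entire_coef (fun=> 0) by move=> rho _; exists 0 => k; rewrite normr0 mul0r.
have E n : pseries (fun=> 0) y n = 0 by rewrite /pseries /series /= big1// => k _; rewrite mul0r.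
have := pseries_cvg _ y h; rewrite (funext E) => c.
by apply: (cvg_unique _ c) => //; exact: cvg_cst.
Qed.

Lemma psum_sum (I : Type) (s : seq I) (b : I -> R) (a : I -> nat -> R) (y : R) :
  (forall i, entire_coef (a i)) ->
  entire_coef (fun k => \sum_(i <- s) b i * a i k) /\
  psum (fun k => \sum_(i <- s) b i * a i k) y = \sum_(i <- s) b i * psum (a i) y.
Proof.
move=> ha; elim: s => [|i s [IH1 IH2]].
  have E : (fun k => \sum_(i <- [::]) b i * a i k) = fun=> 0.
    by apply/funext => k; rewrite big_nil.
  by rewrite E big_nil psum0; split=> // rho _; exists 0 => k; rewrite normr0 mul0r.
have E : (fun k => \sum_(j <- i :: s) b j * a j k) =
    fun k => b i * a i k + 1 * \sum_(j <- s) b j * a j k.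
  by apply/funext => k; rewrite big_cons mul1r.
have h : entire_coef (fun k => b i * a i k + 1 * \sum_(j <- s) b j * a j k).
  by apply: entire_coefD; apply: entire_coefZ.
by rewrite E; split=> //; rewrite psum_lin// big_cons mul1r IH2.
Qed.

Definition mittag_coef (alpha : R) c (k : nat) : R := c k / Gamma (alpha * k%:R + 1).

(* For c k = lambda ^+ k this is E_alpha (lambda t^alpha). *)
Definition mittag (alpha : R) c (t : R) : R := psum (mittag_coef alpha c) (t `^ alpha).

(** [Gamma_ge] at r bounds the coefficient by a constant times (L / r^alpha)^k, and r = 1 + L / rho
    makes this ratio at most rho because r^alpha >= r. *)
Lemma entire_mittag_coef (alpha K L : R) c : 1 < alpha -> 0 <= K -> 0 <= L ->
  (forall k, `|c k| <= K * L ^+ k) -> entire_coef (mittag_coef alpha c).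
Proof.
move=> a1 K0 L0 hc rho rho0; pose r := 1 + L / rho.
have r1 : 1 <= r by rewrite lerDl divr_ge0// ltW.
have r0 : 0 < r := lt_le_trans ltr01 r1.
have ra : L / r `^ alpha <= rho.
  have ra0 : 0 < r `^ alpha by exact: powR_gt0.
  rewrite ler_pdivrMr// mulrC -ler_pdivrMr//.
  apply: (@le_trans _ _ r); first by rewrite lerDr.
  by rewrite -[leLHS]powRr1 ?(ltW r0)//; apply: ler_powR => //; exact: ltW.
clearbody r; exists (K * ((r + 1) * expR (r + 1) / r)) => k.
have z0 : 0 < alpha * k%:R + 1 by rewrite ltr_wpDl// mulr_ge0// ltW// (lt_trans _ a1).
have G := Gamma_ge z0 r0; have G0 := Gamma_gt0 z0.
have B0 : 0 < r `^ (alpha * k%:R + 1) / (r + 1) * expR (- (r + 1)).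
  by rewrite mulr_gt0 ?expR_gt0// divr_gt0 ?powR_gt0 ?addr_gt0.
rewrite /mittag_coef normrM normfV (gtr0_norm G0).
apply: (@le_trans _ _ (K * L ^+ k * (r `^ (alpha * k%:R + 1) / (r + 1) * expR (- (r + 1)))^-1)).
  by apply: ler_pM; rewrite ?invr_ge0 ?(ltW G0)// lef_pV2.
have -> : r `^ (alpha * k%:R + 1) = r * (r `^ alpha) ^+ k.
  by rewrite powRDgt0// powRr1 ?(ltW r0)// powRrM powR_mulrn ?powR_ge0// mulrC.
have -> : K * L ^+ k / (r * (r `^ alpha) ^+ k / (r + 1) * expR (- (r + 1))) =
    K * ((r + 1) * expR (r + 1) / r) * (L / r `^ alpha) ^+ k.
  rewrite expRN exprMn exprVn.
  have e0 : (r `^ alpha) ^+ k != 0 by rewrite expf_neq0// gt_eqF// powR_gt0.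
  move: ((r `^ alpha) ^+ k) e0 => u u0.
  by field; rewrite u0 !gt_eqF ?expR_gt0// addr_gt0.
apply: ler_wpM2l.
  by rewrite mulr_ge0// divr_ge0 ?(ltW r0)// mulr_ge0 ?expR_ge0// addr_ge0 ?(ltW r0).
by apply: lerXn2r; rewrite ?nnegrE ?(ltW rho0) ?divr_ge0 ?powR_ge0.
Qed.

Lemma measurable_truncate (T : R) (f : R -> R) :
  (forall t : R, 0 < t -> {for t, continuous f}) -> measurable_fun setT (truncate T f).
Proof.
move=> cf; have -> : truncate T f = truncate T (onpos f).
  apply/funext => s; have [sT|sT] := boolP (0 < s < T); last by rewrite !truncate_eq0.
  by rewrite !truncateE// onposE//; case/andP: sT.
apply/(measurable_restrictT _ _).1; first exact: measurable_itv.
by apply: measurable_funTS; exact: measurable_onpos.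
Qed.

(** * Caputo derivative of a Mittag-Leffler series *)

Section Solution.
Variables (alpha K L : R) (c : nat -> R).
Hypotheses (a1 : 1 < alpha) (a2 : alpha < 2) (K0 : 0 <= K) (L0 : 0 <= L).
Hypothesis hc : forall k, `|c k| <= K * L ^+ k.

Let phi := mittag_coef alpha c.
(** The derivatives of [mittag alpha c] are t^{alpha-1} and t^{alpha-2} times the series in t^alpha
    with coefficients [phi1] and [phi2]. The shift in [phi1] comes from the constant term, which
    disappears. *)
Let phi1 k := alpha * k.+1%:R * phi k.+1.
Let phi2 k := (alpha - 1 + alpha * k%:R) * phi1 k.

Let a0 : 0 < alpha. Proof. exact: lt_trans a1. Qed.

Let hphi : entire_coef phi. Proof. exact: entire_mittag_coef hc. Qed.

Let hphi1 : entire_coef phi1.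
Proof.
have := entire_coef_shift (entire_coef_linear 0 alpha hphi).
by congr entire_coef; apply/funext => k; rewrite add0r.
Qed.

Let hphi2 : entire_coef phi2. Proof. exact: entire_coef_linear. Qed.

Let der1 (t : R) : 0 < t ->
  is_derive t 1 (mittag alpha c) (t `^ (alpha - 1) * psum phi1 (t `^ alpha)).
Proof.
move=> t0; have d := is_derive_powR_psum 0 a0 hphi t0.
have E s : mittag alpha c s = s `^ 0 * psum phi (s `^ alpha) by rewrite powRr0 mul1r.
rewrite -(funext E) in d; apply: der_eq d _.
rewrite psum_shift; last exact: entire_coef_linear.
rewrite mulr0 addr0 mul0r !add0r mulrA -powRDgt0// addrC; congr (_ * psum _ _).
by apply/funext => k; rewrite add0r.
Qed.

Let F2 (t : R) := t `^ (alpha - 2) * psum phi2 (t `^ alpha).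

Let der2 (t : R) : 0 < t -> is_derive t 1 (mittag alpha c)^`()%classic (F2 t).
Proof.
move=> t0; have d := is_derive_powR_psum (alpha - 1) a0 hphi1 t0.
have E1 : (alpha - 1 - 1 = alpha - 2)%R by ring.
rewrite E1 in d; apply: near_eq_is_derive d; near=> s.
have s0 : 0 < s by near: s; exact: lt_nbhsr.
by rewrite derive1E; have [_ ->] := der1 s0.
Unshelve. all: end_near. Qed.

Let cpsum a (t : R) : entire_coef a -> 0 < t -> {for t, continuous (fun s => psum a (s `^ alpha))}.
Proof.
move=> ha t0; apply: (@cont_comp _ (psum a) (fun s => s `^ alpha)).
  exact: der_continuous (is_derive_psum _ ha).
by apply: cont_powR => //; cont.
Qed.

Let cF2 (t : R) : 0 < t -> {for t, continuous F2}.
Proof.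
move=> t0; apply: cont_mul; last exact: cpsum.
by apply: cont_powR => //; cont.
Qed.

Let d2E (t : R) : 0 < t -> (mittag alpha c)^`(2)%classic t = F2 t.
Proof. by move=> t0; rewrite /= derive1E; have [_ ->] := der2 t0. Qed.

Lemma mittag_at_right : mittag alpha c @ 0^'+ --> c 0%N.
Proof.
have c0 : psum phi 0 = c 0%N.
  by rewrite psum_shift// mul0r addr0 /phi /mittag_coef mulr0 add0r Gamma1 divr1.
rewrite -c0.
have h : psum phi @ (0 : R) --> psum phi 0 := der_continuous (is_derive_psum 0 hphi).
exact: (cvg_comp _ _ (powR_cvg0 a0) h).
Qed.

Lemma mittag0 : mittag alpha c 0 = c 0%N.
Proof.
rewrite /mittag powR0 ?gt_eqF// psum_shift// mul0r addr0.
by rewrite /phi /mittag_coef mulr0 add0r Gamma1 divr1.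
Qed.

Lemma mittag_derive_at_right : (mittag alpha c)^`()%classic @ 0^'+ --> (0 : R).
Proof.
have h1 : psum phi1 @ (0 : R) --> psum phi1 0 := der_continuous (is_derive_psum 0 hphi1).
have h2 : psum phi1 (t `^ alpha) @[t --> (0 : R)^'+] --> psum phi1 0.
  exact: (cvg_comp _ _ (powR_cvg0 a0) h1).
have h3 : t `^ (alpha - 1) @[t --> (0 : R)^'+] --> (0 : R) by apply: powR_cvg0; rewrite subr_gt0.
have h4 : (fun t => t `^ (alpha - 1) * psum phi1 (t `^ alpha)) @ (0 : R)^'+ --> (0 : R).
  by rewrite -[X in _ --> X](mul0r (psum phi1 0)); exact: cvgM.
apply: cvg_trans h4; apply: near_eq_cvg; near=> s.
have s0 : 0 < s by near: s; exact: nbhs_right_gt.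
by rewrite derive1E; have [_ ->] := der1 s0.
Unshelve. all: end_near. Qed.

Lemma mittag_locally_bounded (T : R) : 0 <= T -> exists2 C, 0 <= C &
  forall t : R, 0 < t -> t <= T -> `|mittag alpha c t| <= C.
Proof.
move=> T0; have [C C0 hC] := psum_bound hphi (powR_ge0 T alpha); exists C => // t t0 tT.
by apply: hC; rewrite ger0_norm ?powR_ge0// ge0_ler_powR ?nnegrE ?(ltW a0) ?(ltW t0).
Qed.

Let F2_bound (T : R) : 0 < T -> exists2 C, 0 <= C & forall t : R, 0 < t -> t < T ->
  (forall n, `|pseries phi2 (t `^ alpha) n| <= C) /\ `|psum phi2 (t `^ alpha)| <= C.
Proof.
move=> T0; have Y0 : 0 <= T `^ alpha := powR_ge0 _ _.
have [C C0 hC] := pseries_bound hphi2 Y0; have [D D0 hD] := psum_bound hphi2 Y0.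
exists (C + D) => [|t t0 tT]; first exact: addr_ge0.
have tY : `|t `^ alpha| <= T `^ alpha.
  by rewrite ger0_norm ?powR_ge0// ge0_ler_powR ?nnegrE ?(ltW a0) ?(ltW t0) ?(ltW T0) ?(ltW tT).
split=> [n|]; first by rewrite (le_trans (hC _ n tY))// lerDl.
by rewrite (le_trans (hD _ tY))// lerDr.
Qed.

Let L1_powR_truncate (T : R) : 0 < T -> L1 (truncate T (fun t => t `^ (alpha - 2))).
Proof.
move=> T0; have z0 : 0 < alpha - 1 by rewrite subr_gt0.
have := L1Z (expR T) (L1_powR_expR z0 ltr01); apply: L1_le.
  by apply: measurable_truncate => t t0; cont.
move=> t; have [tT|tT] := boolP (0 < t < T); last first.
  rewrite truncate_eq0// normr0 mulr_ge0 ?expR_ge0// /onpos; case: ifP => // _.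
  by rewrite mulr_ge0 ?powR_ge0 ?expR_ge0.
case/andP: (tT) => t0 tT'.
rewrite truncateE// onposE// ger0_norm ?powR_ge0//.
have -> : alpha - 1 - 1 = alpha - 2 by ring.
rewrite mulrCA ler_peMr ?powR_ge0// -expRD mul1r -expR0 ler_expR subr_ge0 ltW//.
Qed.

Lemma mittag_caputo_differentiable : caputo_differentiable (mittag alpha c).
Proof.
split.
- apply/continuous_within_itvcyP; split.
    move=> t; rewrite in_itv/= andbT => t0; exact: der_continuous (der1 t0).
  by rewrite mittag0; exact: mittag_at_right.
- move=> t t0; split.
  + by case: (der1 t0).
  + by case: (der2 t0).
  + have near_eq : \forall s \near t, F2 s = (mittag alpha c)^`(2)%classic s.
      by near=> s; rewrite d2E//; near: s; exact: lt_nbhsr.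
    suff : (mittag alpha c)^`(2)%classic s @[s --> t] --> F2 t by rewrite -d2E.
    apply: cvg_trans (cF2 t0); exact: near_eq_cvg near_eq.
- move=> T T0; apply/L1_truncateP.
  have [C C0 hC] := F2_bound T0.
  have E : truncate T (mittag alpha c)^`(2)%classic = truncate T F2.
    apply/funext => s; have [sT|sT] := boolP (0 < s < T); last by rewrite !truncate_eq0.
    by rewrite !truncateE// d2E//; case/andP: sT.
  rewrite E; apply: L1_le (L1Z C (L1_powR_truncate T0)).
    by apply: measurable_truncate => t; exact: cF2.
  move=> s; have [sT|sT] := boolP (0 < s < T); last by rewrite !truncate_eq0// normr0 mulr0.
  rewrite !truncateE//; case/andP: sT => s0 sT.
  rewrite /F2 normrM (ger0_norm (powR_ge0 _ _)) mulrC ler_wpM2r ?powR_ge0//.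
  by have [_] := hC s s0 sT.
Unshelve. all: end_near. Qed.

Let phi2E k : phi2 k = c k.+1 / Gamma (alpha * k.+1%:R - 1).
Proof.
have ak : alpha * k.+1%:R - 1 = alpha - 1 + alpha * k%:R by rewrite -natr1; ring.
have ak0 : 0 < alpha * k.+1%:R - 1.
  by rewrite ak ltr_wpDr ?subr_gt0// mulr_ge0// ltW.
have ak1 : 0 < alpha * k.+1%:R by rewrite mulr_gt0.
rewrite /phi2 /phi1 /phi /mittag_coef Gamma_succ// -ak.
have <- : Gamma (alpha * k.+1%:R - 1 + 1) = Gamma (alpha * k.+1%:R) by rewrite subrK.
rewrite Gamma_succ//; have := Gamma_gt0 ak0.
move: (Gamma (alpha * k.+1%:R - 1)) => g; move: (alpha * k.+1%:R) ak0 ak1 {ak} => w w1 w0 g0.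
by field; rewrite !gt_eqF.
Qed.

Let term_kernel k (s : R) : 0 < s ->
  s `^ (alpha - 2) * (phi2 k * (s `^ alpha) ^+ k) = c k.+1 * power_kernel (alpha * k.+1%:R - 1) s.
Proof.
move=> s0; rewrite phi2E /power_kernel onposE//.
have -> : s `^ (alpha * k.+1%:R - 1 - 1) = s `^ (alpha - 2) * (s `^ alpha) ^+ k.
  rewrite -powR_mulrn ?powR_ge0// -powRrM -powRDgt0//; congr (_ `^ _).
  by rewrite -natr1; ring.
by ring.
Qed.

(** Term by term, the kernels of orders 2 - alpha and alpha (k + 1) - 1 convolve to order alpha k +
    1, so D^alpha shifts the coefficients. The partial sums of the second derivative are dominated
    by a multiple of the kernel of order alpha - 1. *)
Lemma mittag_caputo (t : R) : 0 < t ->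
  caputo alpha (mittag alpha c) t = mittag alpha (fun k => c k.+1) t.
Proof.
move=> t0; have b0 : 0 < 2 - alpha by rewrite subr_gt0.
have T0 : 0 < t + 1 by rewrite addr_gt0.
have tT : t < t + 1 by rewrite ltrDl.
have [_] := caputo_conv a1 a2 mittag_caputo_differentiable T0 tT; rewrite onposE// => <-.
have kz k : 0 < alpha * k.+1%:R - 1.
  rewrite subr_gt0 (lt_le_trans a1)// ler_peMr ?(ltW a0)// ler1n//.
pose f n s := \sum_(0 <= k < n) c k.+1 * (power_kernel (2 - alpha) (t - s) * power_kernel (alpha * k.+1%:R - 1) s).
have fE n s : 0 < s -> f n s = power_kernel (2 - alpha) (t - s) *
    (s `^ (alpha - 2) * pseries phi2 (s `^ alpha) n).
  move=> s0; rewrite /f /pseries /series /= !mulr_sumr; apply: eq_bigr => k _.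
  by rewrite term_kernel//; ring.
have f0 n s : s <= 0 -> f n s = 0.
  by move=> s0; rewrite /f big1// => k _; rewrite [X in _ * (_ * X)]power_kernel0// !mulr0.
have fL n : L1 (f n) /\ \int[mu]_s f n s = pseries (mittag_coef alpha (fun k => c k.+1)) (t `^ alpha) n.
  have step k : L1 (fun s => c k.+1 * (power_kernel (2 - alpha) (t - s) * power_kernel (alpha * k.+1%:R - 1) s)).
    exact/L1Z/power_kernel_conv_L1.
  have stepI k : \int[mu]_s (c k.+1 * (power_kernel (2 - alpha) (t - s) * power_kernel (alpha * k.+1%:R - 1) s)) =
      mittag_coef alpha (fun k => c k.+1) k * (t `^ alpha) ^+ k.
    rewrite RintegralZl; [|exact: measurableT|exact: power_kernel_conv_L1].
    rewrite -/(conv _ _ t) power_kernel_conv// /power_kernel onposE// /mittag_coef.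
    have -> : 2 - alpha + (alpha * k.+1%:R - 1) = alpha * k%:R + 1 by rewrite -natr1; ring.
    by rewrite addrK -powR_mulrn ?powR_ge0// -powRrM mulrA.
  elim: n => [|n [IL IE]].
    have E : f 0%N = fun=> 0 by apply/funext => s; rewrite /f big_geq.
    by rewrite E; split; [exact: L10|rewrite Rintegral_zero /pseries /series /= big_geq].
  have E : f n.+1 = fun s => f n s + c n.+1 * (power_kernel (2 - alpha) (t - s) * power_kernel (alpha * n.+1%:R - 1) s).
    by apply/funext => s; rewrite /f big_nat_recr.
  rewrite E; split; first exact: L1D.
  have -> : pseries (mittag_coef alpha (fun k => c k.+1)) (t `^ alpha) n.+1 =
      pseries (mittag_coef alpha (fun k => c k.+1)) (t `^ alpha) n +
      mittag_coef alpha (fun k => c k.+1) n * (t `^ alpha) ^+ n.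
    by rewrite /pseries /series /= big_nat_recr.
  rewrite -IE -stepI; apply: RintegralD; [exact: measurableT|exact: IL|exact: step].
have [C C0 hC] := F2_bound T0.
have [||||_ lim] := @dominated_cvg_line R f
  (fun s => power_kernel (2 - alpha) (t - s) * truncate (t + 1) (mittag alpha c)^`(2)%classic s)
  (fun s => C * Gamma (alpha - 1) * (power_kernel (2 - alpha) (t - s) * power_kernel (alpha - 1) s)).
- by move=> n; apply: L1_measurable; case: (fL n).
- move=> s; have [s0|s0] := leP s 0.
    rewrite truncate_eq0 ?mulr0 ?ltNge ?s0// (funext (fun n => f0 n s s0)).
    exact: cvg_cst.
  have [Ts|sT] := leP (t + 1) s.
    rewrite truncate_eq0 ?mulr0 ?[s < _]ltNge ?Ts ?andbF//.
    have E n : f n s = 0.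
      by rewrite fE// [X in X * _]power_kernel0 ?mul0r// subr_le0 (le_trans (ltW tT)).
    by rewrite (funext E); exact: cvg_cst.
  rewrite (funext (fun n => fE n s s0)); apply: cvgM; first exact: cvg_cst.
  rewrite truncateE ?s0// d2E//; apply: cvgM; first exact: cvg_cst.
  exact: pseries_cvg.
- move=> n s; have [s0|s0] := leP s 0.
    by rewrite f0// normr0 [X in _ * (_ * X)]power_kernel0// !mulr0.
  have [ts|st] := leP t s.
    by rewrite fE// [X in X * _]power_kernel0 ?subr_le0// mul0r normr0 [X in _ * (X * _)]power_kernel0 ?subr_le0// mul0r mulr0.
  have [hb _] := hC s s0 (lt_trans st tT).
  have k0 := power_kernel_ge0 (t - s) b0.
  rewrite fE// normrM (ger0_norm k0) normrM (ger0_norm (powR_ge0 _ _)).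
  have -> : C * Gamma (alpha - 1) * (power_kernel (2 - alpha) (t - s) * power_kernel (alpha - 1) s) =
      power_kernel (2 - alpha) (t - s) * (s `^ (alpha - 2) * C).
    rewrite {2}/power_kernel onposE//; have -> : alpha - 1 - 1 = alpha - 2 by ring.
    have g0 : 0 < Gamma (alpha - 1) by apply: Gamma_gt0; rewrite subr_gt0.
    by move: (Gamma _) (power_kernel _ _) g0 => g k g0; field; rewrite gt_eqF.
  by apply: ler_wpM2l => //; apply: ler_wpM2l; rewrite ?powR_ge0.
- by apply: L1Z; apply: power_kernel_conv_L1; rewrite // subr_gt0.
have hs : entire_coef (mittag_coef alpha (fun k => c k.+1)).
  apply: (@entire_mittag_coef alpha (K * L) L) => //; first exact: mulr_ge0.
  by move=> k; rewrite -mulrA -exprS.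
rewrite /mittag; apply: (cvg_unique _ lim) => //.
by rewrite (funext (fun n => (fL n).2)); exact: pseries_cvg.
Qed.

End Solution.
End MittagLeffler.

(** * Necessity of the spectral condition *)

Section SpectralNecessity.
Variable R : realType.
Local Notation mu := (@lebesgue_measure R).
Local Notation Re := (@complex.Re R).
Local Notation Im := (@complex.Im R).
Local Notation normc := (@ComplexField.Normc.normc R).
Local Notation "x %:C" := (real_complex R x).

Lemma Re_sum (I : Type) (s : seq I) (f : I -> R[i]) : Re (\sum_(i <- s) f i) = \sum_(i <- s) Re (f i).
Proof.
by elim: s => [|i s IH]; rewrite ?big_nil// !big_cons ReD IH.
Qed.

Lemma normcX (z : R[i]) (k : nat) : normc (z ^+ k) = normc z ^+ k.
Proof.
elim: k => [|k IH]; last by rewrite !exprS normcM IH.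
by rewrite !expr0 /= expr0n addr0 expr1n sqrtr1.
Qed.

Definition mode_coef (z lambda : R[i]) (k : nat) : R := Re (z * lambda ^+ k).

Lemma mode_coef_le (z lambda : R[i]) (k : nat) :
  `|mode_coef z lambda k| <= normc z * normc lambda ^+ k.
Proof. by rewrite /mode_coef -normcX -normcM normc_Re. Qed.

(** Taking real parts in the coefficients rather than in the sum keeps the Mittag-Leffler series
    real. *)
Definition mode (n : nat) (alpha : R) (c lambda : R[i]) (v : 'I_n -> R[i]) (t : R) : 'cV[R]_n :=
  \col_i mittag alpha (mode_coef (c * v i) lambda) t.

Lemma mode_is_solution (n : nat) (alpha : R) (E A : 'M[R]_n) (c lambda : R[i]) (v : 'I_n -> R[i]) :
  1 < alpha -> alpha < 2 ->
  (forall i, \sum_j (lambda * (E i j)%:C - (A i j)%:C) * v j = 0) ->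
  is_solution alpha E A (fun=> 0) (mode alpha c lambda v).
Proof.
move=> a1 a2 hv; have nl := normc_ge0 lambda.
have co i : coordinate (mode alpha c lambda v) i = mittag alpha (mode_coef (c * v i) lambda).
  by apply/funext => t; rewrite /coordinate mxE.
have hb i := mode_coef_le (c * v i) lambda.
split=> [i|t t0].
  rewrite co; exact: (mittag_caputo_differentiable a1 (normc_ge0 _) nl (hb i)).
apply/colP => i; rewrite addr0 !mxE.
under eq_bigr do rewrite mxE co (mittag_caputo a1 a2 (normc_ge0 _) nl (hb _) t0).
under [RHS]eq_bigr do rewrite mxE.
have hs j : entire_coef (mittag_coef alpha (fun k => mode_coef (c * v j) lambda k.+1)).
  apply: (@entire_mittag_coef _ alpha (normc (c * v j) * normc lambda) (normc lambda)) => //.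
    by rewrite mulr_ge0 ?normc_ge0.
  by move=> k; rewrite -mulrA -exprS.
have hs' j : entire_coef (mittag_coef alpha (mode_coef (c * v j) lambda)).
  exact: (entire_mittag_coef a1 (normc_ge0 _) nl (hb j)).
have [_ <-] := psum_sum (index_enum 'I_n) (E i) (t `^ alpha) hs.
have [_ <-] := psum_sum (index_enum 'I_n) (A i) (t `^ alpha) hs'.
congr psum; apply/funext => k; rewrite /mittag_coef.
have G0 : Gamma (alpha * k%:R + 1) != 0.
  by rewrite gt_eqF// Gamma_gt0// ltr_wpDl// mulr_ge0// ltW// (lt_trans _ a1).
apply: (mulIf G0); rewrite !mulr_suml.
under eq_bigr do rewrite mulrA divfK//.
under [RHS]eq_bigr do rewrite mulrA divfK//.
rewrite /mode_coef.
under eq_bigr do rewrite -ReRM.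
under [RHS]eq_bigr do rewrite -ReRM.
rewrite -!Re_sum; congr Re; apply/eqP; rewrite -subr_eq0 -sumrB; apply/eqP.
transitivity (c * lambda ^+ k * \sum_j (lambda * (E i j)%:C - (A i j)%:C) * v j); last by rewrite hv mulr0.
by rewrite mulr_sumr; apply: eq_bigr => j _; rewrite exprS; ring.
Qed.

(** Normalising one coordinate to 1 makes that coordinate of the mode a scalar Mittag-Leffler
    function, so that stability applies to it directly. *)
Lemma kernel_vector (n : nat) (E A : 'M[R]_n) (lambda : R[i]) : spec E A lambda ->
  exists (v : 'I_n -> R[i]) i0, v i0 = 1 /\
    forall i, \sum_j (lambda * (E i j)%:C - (A i j)%:C) * v j = 0.
Proof.
rewrite /spec /= -det_tr => /eqP/det0P[w w0 wM].
have [i0 wi0] : exists i0, w 0 i0 != 0.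
  by move/rV0Pn : w0.
exists (fun j => w 0 j / w 0 i0), i0; split; first by rewrite mulfV.
move=> i; have h : \sum_j w 0 j * (lambda * (E i j)%:C - (A i j)%:C) = 0.
  have := congr1 (fun y : 'rV[R[i]]_n => y 0 i) wM; rewrite !mxE => wi.
  by rewrite -[RHS]wi; apply: eq_bigr => j _; rewrite !mxE.
transitivity ((\sum_j w 0 j * (lambda * (E i j)%:C - (A i j)%:C)) / w 0 i0).
  by rewrite mulr_suml; apply: eq_bigr => j _; rewrite mulrA (mulrC _ (w 0 j)).
by rewrite h mul0r.
Qed.

(** The times before T contribute a bounded amount and the later ones at most eta / Re s. As eta may
    be taken small, this is the bound o(1 / Re s) for a function vanishing at infinity. *)
Lemma claplace_tauber (f : R -> R) (M eta T r x : R) : 0 < T -> 0 <= M -> 0 <= eta ->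
  (forall t : R, 0 < t -> {for t, continuous f}) ->
  (forall t : R, 0 < t -> `|f t| <= M) -> (forall t : R, T <= t -> `|f t| <= eta) ->
  0 < Re (ray r x) ->
  normc (claplace (onpos f) (ray r x)) <= 2 * (M * expR 1 * T + eta / Re (ray r x)).
Proof.
move=> T0 M0 eta0 cf fM fT; move: (ray r x) => s s0.
have Ti : 0 < T^-1 by rewrite invr_gt0.
have [L1a Ia] := power_kernel_laplace (@ltr01 R) Ti.
have [L1b Ib] := power_kernel_laplace (@ltr01 R) s0.
rewrite powR_inv1 ?(ltW Ti)// invrK in Ia; rewrite powR_inv1 ?(ltW s0)// in Ib.
(* On ]0, T[ the constant M is at most M e exp (- t / T), whose integral over the half line is M e
   T. *)
pose g t := M * expR 1 * (expR (- (T^-1 * t)) * power_kernel 1 t) +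
  eta * (expR (- (Re s * t)) * power_kernel 1 t).
have gL : L1 g by apply: L1D; exact: L1Z.
have -> : M * expR 1 * T + eta / Re s = \int[mu]_t g t.
  rewrite /g RintegralD; [|exact: measurableT|exact: L1Z|exact: L1Z].
  rewrite RintegralZl; [|exact: measurableT|exact: L1a].
  by rewrite RintegralZl; [rewrite Ia Ib|exact: measurableT|exact: L1b].
apply: normc_cint_le => //.
  apply: cL1_laplace; first exact: measurable_onpos.
  apply: (@L1_exp_bounded _ f M 0) => // t t0.
  by rewrite mul0r expR0 mulr1; exact: fM.
move=> t; rewrite normc_laplace_integrand /g.
have [t0|t0] := leP t 0.
  by rewrite onpos0// !power_kernel0// !mulr0 normr0 addr0.
rewrite onposE// power_kernel1// !mulr1 normrM ger0_norm ?expR_ge0//.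
have e1 : expR (- (Re s * t)) <= 1 by rewrite -expR0 ler_expR oppr_le0 mulr_ge0 ?ltW.
have [Tt|tT] := leP T t.
  rewrite mulrC (le_trans (ler_wpM2r (expR_ge0 _) (fT t Tt)))// lerDr.
  by rewrite !mulr_ge0 ?expR_ge0.
rewrite (@le_trans _ _ M)//.
  by rewrite -[leRHS]mul1r; apply: ler_pM; rewrite ?expR_ge0 ?fM.
rewrite (@le_trans _ _ (M * expR 1 * expR (- (T^-1 * t))))//; last first.
  by rewrite lerDl mulr_ge0 ?expR_ge0.
rewrite -mulrA -expRD ler_peMr// -expR0 ler_expR subr_ge0 mulrC ler_pdivrMr//.
by rewrite expR0 mul1r ltW.
Qed.

Lemma normc_cis_sub (a b : R) : normc (cis a - cis b) <= 2 * `|a - b|.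
Proof.
apply: le_trans (normc_le_ReIm _) _; rewrite ReD ImD ReN ImN /= mulrDl mul1r.
have mv (f f' : R -> R) : (forall y : R, is_derive y 1 f (f' y)) -> (forall y : R, `|f' y| <= 1) ->
    `|f a - f b| <= `|a - b|.
  move=> df bf; rewrite -[leRHS]mul1r.
  by apply: (@mean_value_le _ f f') => y _; exact: bf.
apply: lerD.
- by apply: (mv cos (fun y => - sin y)) => y; rewrite normrN sin_max.
- by apply: (mv sin cos) => y; exact: cos_max.
Qed.

Lemma eventually_le (f : R -> R) (eta : R) : 0 < eta -> f @ +oo --> (0 : R) ->
  exists2 T : R, 0 < T & forall t, T <= t -> `|f t| <= eta.
Proof.
move=> eta0 f0; have [B [_ hB]] : \forall t \near +oo, `|f t| <= eta by exact: cvgr0_norm_le.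
exists (Num.max B 0 + 1); first by rewrite ltr_wpDl// le_max lexx orbT.
move=> t Tt; apply: hB; apply: lt_le_trans Tt; rewrite (@le_lt_trans _ _ (Num.max B 0)) ?ltrDl//.
by rewrite le_max lexx.
Qed.

Lemma vanishing_bounded (f : R -> R) :
  (forall T : R, 0 <= T -> exists2 C, 0 <= C & forall t : R, 0 < t -> t <= T -> `|f t| <= C) ->
  f @ +oo --> (0 : R) -> exists2 M : R, 0 <= M & forall t : R, 0 < t -> `|f t| <= M.
Proof.
move=> hf f0; have [T T0 hT] := eventually_le ltr01 f0.
have [C C0 hC] := hf T (ltW T0); exists (C + 1); first exact: addr_ge0.
move=> t t0; have [tT|/ltW Tt] := leP t T.
  by rewrite (le_trans (hC t t0 tT))// lerDl.
by rewrite (le_trans (hT t Tt))// lerDr.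
Qed.

Lemma cont_lincomb (f g : R -> R) (b1 b2 t : R) : {for t, continuous f} ->
  {for t, continuous g} -> {for t, continuous (fun t => b1 * f t + b2 * g t)}.
Proof. by move=> cf cg; apply: cont_add; apply: cont_mul => //; exact: cont_cst. Qed.

(** * Transform of a scalar mode and the argument of its eigenvalue *)

Section Mode.
Variables (alpha : R) (lambda : R[i]).
Hypotheses (a1 : 1 < alpha) (a2 : alpha < 2).

(* Real and imaginary parts of E_alpha (lambda t^alpha): the factor -i turns the
   real part of lambda ^+ k into its imaginary part. *)
Let fR := mittag alpha (mode_coef 1 lambda).
Let fI := mittag alpha (mode_coef (0 +i* -1)%C lambda).

Hypotheses (fR0 : fR @ +oo --> (0 : R)) (fI0 : fI @ +oo --> (0 : R)).

Let nl := normc_ge0 lambda.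
Let hR := mode_coef_le 1 lambda.
Let hI := mode_coef_le (0 +i* -1)%C lambda.

Let a0 : 0 < alpha. Proof. exact: lt_trans a1. Qed.

Let coefR k : mode_coef 1 lambda k = Re (lambda ^+ k).
Proof. by rewrite /mode_coef mul1r. Qed.

Let coefI k : mode_coef (0 +i* -1)%C lambda k = Im (lambda ^+ k).
Proof. by rewrite /mode_coef ReM /=; ring. Qed.

Let eR := entire_mittag_coef a1 (normc_ge0 _) nl hR.
Let eI := entire_mittag_coef a1 (normc_ge0 _) nl hI.

Let lin (b1 b2 t : R) : psum (fun k => b1 * mittag_coef alpha (mode_coef 1 lambda) k +
    b2 * mittag_coef alpha (mode_coef (0 +i* -1)%C lambda) k) (t `^ alpha) = b1 * fR t + b2 * fI t.
Proof. by rewrite psum_lin//; apply: entire_coefD; exact: entire_coefZ. Qed.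

Let capR (t : R) : 0 < t -> caputo alpha fR t = Re lambda * fR t + - Im lambda * fI t.
Proof.
move=> t0; rewrite (mittag_caputo a1 a2 (normc_ge0 _) nl hR t0) -lin; congr psum.
apply/funext => k; rewrite /mittag_coef !coefR coefI exprS ReM; ring.
Qed.

Let capI (t : R) : 0 < t -> caputo alpha fI t = Im lambda * fR t + Re lambda * fI t.
Proof.
move=> t0; rewrite (mittag_caputo a1 a2 (normc_ge0 _) nl hI t0) -lin; congr psum.
apply/funext => k; rewrite /mittag_coef !coefI coefR exprS ImM; ring.
Qed.

Let dR : caputo_differentiable fR.
Proof. exact: mittag_caputo_differentiable a1 (normc_ge0 _) nl hR. Qed.

Let dI : caputo_differentiable fI.
Proof. exact: mittag_caputo_differentiable a1 (normc_ge0 _) nl hI. Qed.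

Let fR_0 : fR 0 = 1.
Proof. by rewrite /fR (mittag0 a1 (normc_ge0 _) nl hR) coefR expr0. Qed.

Let fI_0 : fI 0 = 0.
Proof. by rewrite /fI (mittag0 a1 (normc_ge0 _) nl hI) coefI expr0. Qed.

Let bound : exists2 M, 0 <= M & forall t : R, 0 < t -> `|fR t| <= M /\ `|fI t| <= M.
Proof.
have [M M0 hM] := vanishing_bounded (mittag_locally_bounded a1 (normc_ge0 _) nl hR) fR0.
have [N N0 hN] := vanishing_bounded (mittag_locally_bounded a1 (normc_ge0 _) nl hI) fI0.
exists (M + N) => [|t t0]; first exact: addr_ge0.
by split; [rewrite (le_trans (hM t t0))// lerDl|rewrite (le_trans (hN t t0))// lerDr].
Qed.

(** The two real functions solve a linear 2 by 2 system, diagonalised by u + i v. At complex s the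
    transforms of [fR] and [fI] are themselves complex, hence this explicit combination. *)
Lemma mode_laplace (r x : R) : 0 < r -> - (pi / 2) < x < pi / 2 ->
  (polar_powR alpha r x - lambda) *
    (claplace (onpos fR) (ray r x) + (0 +i* 1)%C * claplace (onpos fI) (ray r x)) =
  polar_powR (alpha - 1) r x.
Proof.
move=> r0 xp; have [M M0 hM] := bound.
have s0 := Re_ray_gt0 r0 xp.
have cR := caputo_differentiable_cont dR; have cI := caputo_differentiable_cont dI.
have LR : cL1 (laplace_integrand (onpos fR) (ray r x)).
  apply: cL1_laplace; first exact: measurable_onpos.
  apply: (@L1_exp_bounded _ fR M 0) => // t t0; rewrite mul0r expR0 mulr1.
  by case: (hM t t0).
have LI : cL1 (laplace_integrand (onpos fI) (ray r x)).
  apply: cL1_laplace; first exact: measurable_onpos.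
  apply: (@L1_exp_bounded _ fI M 0) => // t t0; rewrite mul0r expR0 mulr1.
  by case: (hM t t0).
have comb (b1 b2 : R) : claplace (onpos (fun t => b1 * fR t + b2 * fI t)) (ray r x) =
    b1%:C * claplace (onpos fR) (ray r x) + b2%:C * claplace (onpos fI) (ray r x).
  have E : onpos (fun t => b1 * fR t + b2 * fI t) = (fun t => b1 * onpos fR t + b2 * onpos fI t).
    by apply/funext => t; rewrite /onpos; case: ifP => //; rewrite !mulr0 addr0.
  have [l1 e1] := claplaceZ b1 LR; have [l2 e2] := claplaceZ b2 LI.
  by have [_] := claplaceD l1 l2; rewrite E e1 e2.
have bnd (b1 b2 t : R) : 0 < t -> `|b1 * fR t + b2 * fI t| <= ((`|b1| + `|b2|) * M) * expR (0 * t).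
  move=> t0; have [h1 h2] := hM t t0; rewrite mul0r expR0 mulr1 mulrDl.
  by apply: le_trans (ler_normD _ _) _; rewrite !normrM; apply: lerD; exact: ler_wpM2l.
have cc (b1 b2 t : R) : 0 < t -> {for t, continuous (fun t => b1 * fR t + b2 * fI t)}.
  by move=> t0; apply: cont_lincomb; [exact: cR|exact: cI].
have b0 (b1 b2 : R) : 0 <= (`|b1| + `|b2|) * M by rewrite mulr_ge0// addr_ge0.
have dR0 := mittag_derive_at_right a1 (normc_ge0 _) nl hR.
have dI0 := mittag_derive_at_right a1 (normc_ge0 _) nl hI.
have UR := claplace_caputo a1 a2 dR capR dR0 (cc _ _) (b0 _ _) (bnd _ _) r0 xp s0.
have UI := claplace_caputo a1 a2 dI capI dI0 (cc _ _) (b0 _ _) (bnd _ _) r0 xp s0.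
rewrite comb fR_0 mul0r addr0 mul1r in UR.
rewrite comb fI_0 !mul0r !add0r in UI.
have w1 : polar_powR alpha r x * polar_powR (- alpha) r x = 1.
  by rewrite -polar_powRD// subrr /polar_powR powRr0 mul0r cis0 mul1r.
have w2 : polar_powR alpha r x * polar_powR (-1) r x = polar_powR (alpha - 1) r x.
  by rewrite -polar_powRD.
have lE : lambda = (Re lambda)%:C + (0 +i* 1)%C * (Im lambda)%:C.
  by apply: eqcP; rewrite !(ReD, ImD, ReM, ImM) /=; ring.
have ii : (0 +i* 1)%C * (0 +i* 1)%C = -1 :> R[i].
  by apply: eqcP; rewrite !(ReM, ImM) /=; ring.
rewrite -w2.
move: (claplace (onpos fR) _) (claplace (onpos fI) _) UR UI => u v UR UI.
move: ii lE w1; move: (0 +i* 1)%C => j jj lE w1.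
move: (polar_powR alpha r x) (polar_powR (- alpha) r x) (polar_powR (-1) r x) UR UI w1 => w wi q UR UI w1.
rewrite rmorphN in UR.
have e1 : w * u = w * q + ((Re lambda)%:C * u - (Im lambda)%:C * v).
  by rewrite [in LHS]UR mulrDr mulrA w1 mul1r mulNr.
have e2 : w * v = (Im lambda)%:C * u + (Re lambda)%:C * v.
  by rewrite [in LHS]UI mulrA w1 mul1r.
move: (Re lambda)%:C (Im lambda)%:C lE e1 e2 => a b -> e1 e2.
have -> : (w - (a + j * b)) * (u + j * v) =
    w * u + j * (w * v) - (a * u + j * b * u + j * a * v + (j * j) * b * v) by ring.
by rewrite e1 e2 jj; ring.
Qed.

(** Otherwise the points s of modulus |lambda|^{1/alpha} and angle (1 - e) arg lambda / alpha are in
    the open right half plane and tend to a root of s^alpha = lambda. In [mode_laplace] the right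
    side has constant modulus Z, while the left side is at most a multiple of e (D + eta / (kappa
    e)), with eta at will. *)
Lemma mode_arg : lambda != 0 -> pi / 2 * alpha < `|arg lambda|.
Proof.
move=> l0; rewrite ltNge; apply/negP => th.
have [M M0 hM] := bound.
set theta := arg lambda in th.
have L0 : 0 < normc lambda by exact: normc_gt0.
pose r := normc lambda `^ alpha^-1.
have r0 : 0 < r by exact: powR_gt0.
have ra : r `^ alpha = normc lambda by rewrite /r -powRrM mulVf ?gt_eqF// powRr1 ?ltW.
have p0 := @pi_gt0 R.
pose y := theta / alpha.
have yb : `|y| <= pi / 2 by rewrite /y normrM normfV (gtr0_norm a0) ler_pdivrMr.
(* Lower bound for the real part: Re s >= kappa e, by [sin_ge_linear] at the complementary angle. *)
pose kappa := r * cos 1.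
have c1 := @cos1_gt0 R.
have k0 : 0 < kappa by rewrite mulr_gt0.
(* Upper bound for the first factor: |s^alpha - lambda| <= B e, by [normc_cis_sub] and |arg lambda|
   <= pi. *)
pose B := 2 * normc lambda * pi.
have B0 : 0 < B by rewrite !mulr_gt0.
pose Z := r `^ (alpha - 1).
have Z0 : 0 < Z by exact: powR_gt0.
(* Chosen so that 4 B eta / kappa = Z / 4. *)
pose eta := kappa * Z / (16 * B).
have eta0 : 0 < eta by rewrite divr_gt0 ?mulr_gt0.
have [T1 T10 hT1] := eventually_le eta0 fR0; have [T2 T20 hT2] := eventually_le eta0 fI0.
pose T := Num.max T1 T2.
have T0 : 0 < T by rewrite lt_max T10.
have T1T : T1 <= T by rewrite le_max lexx.
have T2T : T2 <= T by rewrite le_max lexx orbT.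
have key (e : R) : 0 < e -> e < 1 -> e * (pi / 2) <= 1 -> Z <= B * (4 * (M * expR 1 * T * e + eta / kappa)).
  move=> e0 e1 ep; pose x := (1 - e) * y.
  have xb : `|x| <= (1 - e) * (pi / 2).
    by rewrite /x normrM ger0_norm ?subr_ge0 ?(ltW e1)// ler_wpM2l// subr_ge0 ltW.
  have xp : - (pi / 2) < x < pi / 2.
    by rewrite -ltr_norml (le_lt_trans xb)// gtr_pMl ?divr_gt0// gtrBl.
  have cx : cos 1 * e <= cos x.
    have -> : cos x = cos `|x| by rewrite cos_norm.
    apply: (@le_trans _ _ (cos ((1 - e) * (pi / 2)))).
      have -> : (1 - e) * (pi / 2) = pi / 2 - e * (pi / 2) by ring.
      rewrite cosB cos_pihalf sin_pihalf mul0r add0r mul1r.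
      apply: le_trans (_ : _ <= cos 1 * (e * (pi / 2))) _.
        rewrite ler_wpM2l ?(ltW c1)// ler_peMr ?(ltW e0)// ler_pdivlMr// mul1r.
        exact: pi_ge2.
      by apply: sin_ge_linear; rewrite ep mulr_ge0 ?divr_ge0 ?(ltW e0) ?(ltW p0).
    rewrite leNgt ltr_cos -?leNgt// in_itv/= ?normr_ge0/=.
      rewrite mulr_ge0 ?subr_ge0 ?(ltW e1) ?divr_ge0 ?(ltW p0)//=.
      rewrite (@le_trans _ _ (pi / 2))//; last by rewrite ler_pdivrMr// ler_peMr ?(ltW p0)// ler1n.
      by rewrite ler_piMl ?divr_ge0 ?(ltW p0)// gerBl ltW.
    rewrite (le_trans xb)// (@le_trans _ _ (pi / 2))//; last by rewrite ler_pdivrMr// ler_peMr ?(ltW p0)// ler1n.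
    by rewrite ler_piMl ?divr_ge0 ?(ltW p0)// gerBl ltW.
  have s0 := Re_ray_gt0 r0 xp.
  have sk : kappa * e <= Re (ray r x).
    by rewrite /ray ReRM /= /kappa -mulrA ler_wpM2l// ltW.
  have tb (f : R -> R) : (forall t : R, 0 < t -> {for t, continuous f}) ->
      (forall t : R, 0 < t -> `|f t| <= M) -> (forall t : R, T <= t -> `|f t| <= eta) ->
      normc (claplace (onpos f) (ray r x)) <= 2 * (M * expR 1 * T + eta / (kappa * e)).
    move=> cf fM fT; apply: le_trans (claplace_tauber T0 M0 (ltW eta0) cf fM fT s0) _.
    rewrite ler_wpM2l// lerD2l ler_wpM2l ?(ltW eta0)// lef_pV2 ?posrE ?mulr_gt0//.
  have tR := tb fR (caputo_differentiable_cont dR) (fun t t0 => (hM t t0).1)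
    (fun t Tt => hT1 t (le_trans T1T Tt)).
  have tI := tb fI (caputo_differentiable_cont dI) (fun t t0 => (hM t t0).2)
    (fun t Tt => hT2 t (le_trans T2T Tt)).
  have := congr1 normc (mode_laplace r0 xp).
  rewrite (normcM (polar_powR alpha r x - lambda)) (normc_polar_powR (alpha - 1)) -/Z => <-.
  have wl : normc (polar_powR alpha r x - lambda) <= B * e.
    have -> : polar_powR alpha r x - lambda =
        (normc lambda)%:C * (cis ((1 - e) * theta) - cis theta).
      have -> : polar_powR alpha r x = (normc lambda)%:C * cis ((1 - e) * theta).
        by rewrite /polar_powR ra; congr (_ * cis _); rewrite /x /y; field; rewrite gt_eqF.
      rewrite mulrBr; congr (_ - _); exact: polarE.
    rewrite normcM normcR gtr0_norm//; apply: le_trans (ler_wpM2l (ltW L0) (normc_cis_sub _ _)) _.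
    have -> : (1 - e) * theta - theta = - (e * theta) by ring.
    rewrite normrN normrM (gtr0_norm e0).
    have -> : B * e = normc lambda * (2 * (e * pi)) by rewrite /B; ring.
    by rewrite ler_pM2l// ler_pM2l// ler_pM2l// arg_le_pi.
  have Ul : normc (claplace (onpos fR) (ray r x) + (0 +i* 1)%C * claplace (onpos fI) (ray r x)) <=
      4 * (M * expR 1 * T + eta / (kappa * e)).
    apply: le_trans (le_normcD _ _) _; rewrite normcM.
    have -> : normc (0 +i* 1)%C = 1 by rewrite /= expr0n expr1n add0r sqrtr1.
    rewrite mul1r; apply: le_trans (lerD tR tI) _.
    by rewrite le_eqVlt; apply/orP; left; apply/eqP; ring.
  apply: le_trans (ler_pM (normc_ge0 _) (normc_ge0 _) wl Ul) _.
  rewrite le_eqVlt; apply/orP; left; apply/eqP.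
  by field; rewrite !gt_eqF.
pose D := M * expR 1 * T.
have D0 : 0 <= D by rewrite mulr_ge0 ?(ltW T0)// mulr_ge0 ?expR_ge0.
have D1 : 0 < D + 1 by rewrite ltr_wpDl.
(* The last entry makes 4 B D e <= Z / 4, so that the total is at most Z / 2 < Z; D + 1 replaces D,
   which may be zero. The other entries ensure e < 1 and e pi / 2 <= 1. *)
pose e := Num.min (1 / 4) (Num.min pi^-1 (Z / (16 * B * (D + 1)))).
have Q0 : 0 < Z / (16 * B * (D + 1)) by rewrite divr_gt0// mulr_gt0// mulr_gt0.
have e0 : 0 < e by rewrite !lt_min invr_gt0 p0 Q0 divr_gt0.
have e1 : e <= 1 / 4 by rewrite ge_min lexx.
have e2 : e <= pi^-1 by rewrite !ge_min lexx orbT.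
have e3 : e <= Z / (16 * B * (D + 1)) by rewrite !ge_min lexx !orbT.
have le1 : e < 1 by lra.
have epi : e * (pi / 2) <= 1.
  apply: (@le_trans _ _ (pi^-1 * (pi / 2))).
    by rewrite ler_wpM2r// divr_ge0// ltW.
  by rewrite mulrA mulVf ?gt_eqF//; lra.
have := key e e0 le1 epi; rewrite -/D.
have ek : eta / kappa = Z / (16 * B).
  by rewrite /eta; field; rewrite !gt_eqF.
rewrite ek; have h1 : B * (4 * (D * e)) <= Z / 4.
  apply: (@le_trans _ _ (B * (4 * ((D + 1) * (Z / (16 * B * (D + 1))))))).
    rewrite ler_pM2l// ler_pM2l//; apply: ler_pM => //; first exact: ltW.
    by rewrite lerDl.
  rewrite le_eqVlt; apply/orP; left; apply/eqP.
  by field; rewrite !gt_eqF.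
have h2 : B * (4 * (Z / (16 * B))) = Z / 4 by field; rewrite gt_eqF.
rewrite mulrDr mulrDr h2 => h.
by move: h1 h Z0; move: (B * (4 * (D * e))) (Z) => u w; lra.
Qed.

End Mode.

Lemma stable_spec (n : nat) (alpha : R) (E A : 'M[R]_n) : 1 < alpha -> alpha < 2 ->
  asymptotically_stable alpha E A ->
  forall lambda : R[i], spec E A lambda -> pi / 2 * alpha < `|arg lambda|.
Proof.
move=> a1 a2 st lam /kernel_vector[v [i0 [vi0 hv]]].
have hx c : mittag alpha (mode_coef c lam) @ +oo --> (0 : R).
  have sol := mode_is_solution c a1 a2 hv.
  have ad : admissible alpha E A (mode alpha c lam v 0) by exists (mode alpha c lam v).
  have := coordinate_cvg0 i0 (st _ ad _ sol erefl).
  by rewrite (funext (fun t => mxE _ _ i0 0)) vi0 mulr1.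
have [l0|l0] := eqVneq lam 0; last exact: (mode_arg a1 a2 (hx _) (hx _) l0).
(* For lambda = 0 only the constant term survives, and a constant mode contradicts stability. *)
have f1 t : mittag alpha (mode_coef 1 lam) t = 1.
  rewrite /mittag psum_shift; last first.
    exact: (entire_mittag_coef a1 (normc_ge0 _) (normc_ge0 _) (mode_coef_le 1 lam)).
  have -> : (fun k => mittag_coef alpha (mode_coef 1 lam) k.+1) = fun=> 0.
    by apply/funext => k; rewrite /mittag_coef /mode_coef l0 exprS mul0r mulr0 /= mul0r.
  by rewrite psum0 mulr0 addr0 /mittag_coef /mode_coef mulr0 add0r Gamma1 divr1 expr0 mulr1.
have := hx 1; rewrite (funext f1) => h.
have e : (1 : R) = 0 by apply: (cvg_unique _ _ h) => //; exact: cvg_cst.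
by have := @oner_neq0 R; rewrite e eqxx.
Qed.

End SpectralNecessity.

Theorem theorem22 (R : realType) (n : nat) (alpha : R) (E A : 'M[R]_n) :
  1 < alpha -> alpha < 2 ->
  regular alpha E A ->
  asymptotically_stable alpha E A <->
  (forall lambda : R[i], spec E A lambda -> pi / 2 * alpha < `|arg lambda|).
Proof. by move=> a1 a2 _; split; [exact: stable_spec|exact: spec_stable]. Qed.
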